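(* Let $\mathcal{A}$ and $\mathcal{B}$ be alphabets of size at least 2. A non-erasing morphism $\sigma : \mathcal{A}^* \to \mathcal{B}^*$ preserves the codings of regular interval exchange transformations if and only if one of the two following cases holds: (1) $\# \mathcal{A} = 2$ and $\sigma$ is a Sturmian morphism; (2) $\# \mathcal{A} \geq 3$ and $\sigma$ is a bijective coding.
   Context: A morphism $\sigma : \mathcal{A}^* \to \mathcal{B}^*$ is a monoid homomorphism, with the convention that every letter of $\mathcal{B}$ appears in the image under $\sigma$ of some letter. It is non-erasing if no letter is mapped to the empty word; it then extends to bi-infinite words. A bijective coding is a morphism mapping letters to single letters, with distinct letters having distinct images. Interval exchanges: given two total orders $\leq, \preceq$ on $\mathcal{A} = \{a_1, \dots, a_k\}$ and lengths $\lambda_{a_1}, \dots, \lambda_{a_k} > 0$ with $\sum_i \lambda_{a_i} = 1$, let $I_{a_i} = [\sum_{a_j < a_i} \lambda_{a_j}, \sum_{a_j \leq a_i} \lambda_{a_j})$ and $J_{a_i} = [\sum_{a_j \prec a_i} \lambda_{a_j}, \sum_{a_j \preceq a_i} \lambda_{a_j})$. The associated interval exchange transformation is the bijection $T : [0,1) \to [0,1)$ mapping each $I_{a_i}$ onto $J_{a_i}$ by translation. It is regular (an RIET) if the orbits under $T$ of the non-zero points among $\sum_{a_j < a_i} \lambda_{a_j}$, $1 \le i \le k$, are infinite and disjoint. The (natural) coding of $z \in [0,1)$ is the word $x \in \mathcal{A}^{\mathbb{Z}}$ with $x_n = a_i$ iff $T^n(z) \in I_{a_i}$. A morphism $\sigma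 : \mathcal{A}^*\to\mathcal{B}^*$ preserves the codings of RIET if, for every $x \in \mathcal{A}^{\mathbb{Z}}$ that is the coding of a point in an RIET with intervals indexed by $\mathcal{A}$, the word $\sigma(x)$ is the coding of a point in an RIET with intervals indexed by $\mathcal{B}$. Sturmian morphisms: on a two-letter alphabet $\{0,1\}$ these are, up to a bijective coding, the morphisms generated under composition by $L_0 : 0 \mapsto 0, 1 \mapsto 01$; $R_0 : 0 \mapsto 0, 1 \mapsto 10$; $L_1 : 0 \mapsto 10, 1 \mapsto 1$; $R_1 : 0 \mapsto 01, 1 \mapsto 1$. *)

(* Defs.v *)
From HB Require Import structures.
From mathcomp Require Import all_boot all_order all_algebra.
From mathcomp Require Import boolp classical_sets cardinality reals.

Set Implicit Arguments.
Unset Strict Implicit.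
Unset Printing Implicit Defensive.

Import Order.TTheory GRing.Theory Num.Theory.

Local Open Scope classical_set_scope.
Local Open Scope ring_scope.

(* The free monoid over an alphabet A is [seq A] with concatenation. *)
Definition morphism (A B : finType) (s : seq A -> seq B) : Prop :=
  [/\ s [::] = [::],
      {morph s : u v / u ++ v >-> u ++ v} &
      forall b : B, exists a : A, b \in s [:: a]].

Definition nonerasing (A B : finType) (s : seq A -> seq B) : Prop :=
  forall a : A, s [:: a] != [::].

Definition bijective_coding (A B : finType) (s : seq A -> seq B) : Prop :=
  exists2 f : A -> B, injective f & forall a, s [:: a] = [:: f a].

(* Position at which the block s (x n) starts in the bi-infinite word s(x),
   the block s (x 0) starting at 0:
   |s (x 0)| + ... + |s (x (n - 1))| if n >= 0, and
   - (|s (x (-1))| + ... + |s (x n)|) if n < 0. *)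
Definition block_start (A B : finType) (s : seq A -> seq B) (x : int -> A)
    (n : int) : int :=
  match n with
  | Posz k => (\sum_(i < k) size (s [:: x (Posz i)]))%N%:Z
  | Negz k => - (\sum_(i < k.+1) size (s [:: x (Negz i)]))%N%:Z
  end.

(* y = s(x).  For a non-erasing morphism there is exactly one such y:
   see [word_image_exists] and [word_image_unique]. *)
Definition word_image (A B : finType) (s : seq A -> seq B)
    (x : int -> A) (y : int -> B) : Prop :=
  forall n : int,
    [seq y (block_start s x n + i%:Z) | i <- iota 0 (size (s [:: x n]))]
      = s [:: x n].

Section WordImage.
Variables (A B : finType) (s : seq A -> seq B) (x : int -> A).
Hypothesis s_ne : nonerasing s.

Lemma block_startS n :
  block_start s x (n + 1) = block_start s x n + (size (s [:: x n]))%:Z.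
Proof.
case: n => [k|[|k]].
- by rewrite -PoszD addn1 /= big_ord_recr.
- by rewrite /= big_ord0 big_ord_recr big_ord0 /= add0n addNr.
- have -> : Negz k.+1 + 1 = Negz k.
    by rewrite !NegzE -[k.+2]addn1 PoszD opprD addrNK.
  by rewrite /= [in RHS]big_ord_recr /= PoszD opprD addrNK.
Qed.

Lemma block_start_lt n : block_start s x n < block_start s x (n + 1).
Proof. by rewrite block_startS ltrDl ltz_nat lt0n size_eq0 s_ne. Qed.

Lemma block_start_homo (m n : int) : m < n -> block_start s x m < block_start s x n.
Proof.
move=> mn; have [k ->] : exists k : nat, n = m + k%:Z + 1.
  exists (absz (n - m - 1)%R); rewrite gez0_abs; first by rewrite -addrA subrK addrC subrK.
  by rewrite -addrA -opprD subr_ge0 lezD1.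
elim: k {mn} => [|k IH]; first by rewrite addr0 block_start_lt.
apply: (lt_trans IH); rewrite -[k.+1]addn1 PoszD !addrA; exact: block_start_lt.
Qed.

Lemma block_exists (m : int) :
  exists n, block_start s x n <= m < block_start s x (n + 1).
Proof.
elim/int_ind: m => [|m [n /andP[l r]]|m [n /andP[l r]]].
- exists 0; have := block_start_lt 0; rewrite {1 2}/block_start /= big_ord0.
  by move=> ->.
- have [h|h] := ltP (m.+1%:Z) (block_start s x (n + 1)).
    by exists n; rewrite h andbT (le_trans l)// lez_nat.
  exists (n + 1); rewrite h /=; apply: le_lt_trans (block_start_lt _).
  by rewrite -addn1 PoszD lezD1.
- have [h|h] := leP (block_start s x n) (- m.+1%:Z).
    by exists n; rewrite h /= (le_lt_trans _ r)// lerN2 lez_nat.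
  exists (n - 1); rewrite subrK h andbT -ltzD1.
  rewrite -[m.+1]addn1 PoszD opprD subrK; apply: lt_le_trans l.
  by rewrite -{2}(subrK 1 n) block_start_lt.
Qed.

Lemma word_image_exists : exists y, word_image s x y.
Proof.
have b0 : B by have := s_ne (x 0); case: (s _) => // b.
have [p pP] := choice block_exists.
exists (fun m => nth b0 (s [:: x (p m)]) (absz (m - block_start s x (p m))%R)) => n.
apply: (@eq_from_nth _ b0); rewrite size_map size_iota // => i ilt.
rewrite (nth_map 0%N) ?size_iota // nth_iota // add0n.
set m := _ + i%:Z; have /andP[l r] := pP m.
suff -> : p m = n by rewrite /m addrAC subrr add0r.
have lm : block_start s x n <= m by rewrite lerDl.
have rm : m < block_start s x (n + 1) by rewrite block_startS ltrD2l ltz_nat.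
have le_of u v : block_start s x u <= m -> m < block_start s x (v + 1) -> u <= v.
  move=> hu hv; rewrite -ltzD1 ltNge; apply/negP => h.
  have : block_start s x (v + 1) <= block_start s x u.
    by move: h; rewrite le_eqVlt => /predU1P[->//|/block_start_homo/ltW].
  by rewrite leNgt (le_lt_trans hu hv).
by apply/le_anti/andP; split; exact: le_of.
Qed.

Lemma word_image_unique y y' : word_image s x y -> word_image s x y' -> y = y'.
Proof.
move=> yP y'P; apply/funext => m; have [n /andP[l r]] := block_exists m.
have im : (absz (m - block_start s x n)%R < size (s [:: x n]))%N.
  by rewrite -ltz_nat gez0_abs ?subr_ge0// ltrBlDl -block_startS.
have := congr1 (fun w => nth (y 0) w (absz (m - block_start s x n)%R))
  (etrans (yP n) (esym (y'P n))).
rewrite !(nth_map 0%N) ?size_iota // nth_iota // add0n.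
by rewrite gez0_abs ?subr_ge0// addrC subrK.
Qed.

End WordImage.

Definition total_order (A : finType) (le : rel A) : Prop :=
  [/\ reflexive le, antisymmetric le, transitive le & total le].

Section Exchange.
Variables (R : realType) (A : finType).

Definition left_end (le : rel A) (len : A -> R) (a : A) : R :=
  \sum_(b | le b a && (b != a)) len b.

Definition right_end (le : rel A) (len : A -> R) (a : A) : R :=
  \sum_(b | le b a) len b.

Definition piece (le : rel A) (len : A -> R) (a : A) : interval R :=
  `[left_end le len a, right_end le len a[.

(* Translates each [piece le1 len a] onto [piece le2 len a]; the points
   outside [0, 1), which belong to no piece, are left fixed. *)
Definition exchange (le1 le2 : rel A) (len : A -> R) (z : R) : R :=
  if [pick a | z \in piece le1 len a] is Some a
  then z - left_end le1 len a + left_end le2 len a else z.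

Record iet := Iet {
  dom_le : rel A;
  img_le : rel A;
  len : A -> R;
  dom_le_order : total_order dom_le;
  img_le_order : total_order img_le;
  len_gt0 : forall a, 0 < len a;
  len_sum1 : \sum_a len a = 1 }.

Definition iet_map (T : iet) : R -> R := exchange (dom_le T) (img_le T) (len T).

(* The inverse of [iet_map T] on [0, 1): see [iet_mapK] and [iet_invK]. *)
Definition iet_inv (T : iet) : R -> R := exchange (img_le T) (dom_le T) (len T).

Definition iet_iter (T : iet) (n : int) (z : R) : R :=
  match n with
  | Posz k => iter k (iet_map T) z
  | Negz k => iter k.+1 (iet_inv T) z
  end.

Definition iet_orbit (T : iet) (z : R) : set R := range (fun n => iet_iter T n z).

Definition regular (T : iet) : Prop :=
  let P := [set z : R | z != 0 /\ exists a, z = left_end (dom_le T) (len T) a] in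
  (forall z, P z -> infinite_set (iet_orbit T z)) /\ trivIset P (iet_orbit T).

Definition coding (T : iet) (z : R) (x : int -> A) : Prop :=
  forall (n : int) (a : A),
    x n = a <-> iet_iter T n z \in piece (dom_le T) (len T) a.

Definition riet_coding (x : int -> A) : Prop :=
  exists (T : iet) (z : R), [/\ regular T, z \in `[0, 1[ & coding T z x].

End Exchange.

Definition preserves_riet_codings (R : realType) (A B : finType)
    (s : seq A -> seq B) : Prop :=
  forall x : int -> A, riet_coding R x ->
  forall y : int -> B, word_image s x y -> riet_coding R y.

Section ExchangeInverse.
Variables (R : realType) (A : finType) (len : A -> R).
Hypothesis len_gt0 : forall a, 0 < len a.

Lemma right_endE (le : rel A) a :
  total_order le -> right_end le len a = left_end le len a + len a.
Proof. by case=> rf _ _ _; rewrite /right_end (bigD1 a) ?rf //= addrC. Qed.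

Lemma left_end_ge0 (le : rel A) a : 0 <= left_end le len a.
Proof. by apply: sumr_ge0 => b _; exact: ltW. Qed.

Lemma right_end_le_left_end (le : rel A) a b : total_order le ->
  le a b -> a != b -> right_end le len a <= left_end le len b.
Proof.
case=> rf anti tr tot ab neq; rewrite /right_end /left_end.
rewrite [leRHS](bigID (le^~ a)) /=.
rewrite (eq_bigl (fun c => (le c b && (c != b)) && le c a)).
  by rewrite lerDl sumr_ge0 // => c _; exact: ltW.
move=> c; rewrite andbC; case ca: (le c a) => //=.
rewrite (tr _ _ _ ca ab) /=; apply/esym; apply: contraNN neq => /eqP cb.
by apply/eqP; apply: anti; rewrite ab -cb ca.
Qed.

Lemma piece_inj (le : rel A) a b z : total_order le ->
  z \in piece le len a -> z \in piece le len b -> a = b.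
Proof.
move=> o; rewrite !in_itv /= => /andP[la ra] /andP[lb rb].
apply/eqP; apply/negP => /negP neq.
have [_ _ _ tot] := o; have /orP[ab|ba] := tot a b.
  by have := lt_le_trans ra (right_end_le_left_end o ab neq); rewrite ltNge lb.
rewrite eq_sym in neq.
by have := lt_le_trans rb (right_end_le_left_end o ba neq); rewrite ltNge la.
Qed.

Lemma total_order_max (le : rel A) (P : pred A) a : total_order le -> P a ->
  exists2 c, P c & forall b, P b -> le b c.
Proof.
case=> rf anti tr tot Pa.
case: (arg_maxnP (fun c => #|[pred u | le u c]|) Pa) => c Pc cmax.
exists c => // b Pb; have /orP[//|cb] := tot b c.
have /eqP <- : c == b; last exact: rf.
apply/negP => /negP neq; have := cmax b Pb; rewrite /= leqNgt => /negP; apply.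
apply: proper_card; apply/properP; split.
  by apply/fintype.subsetP => u; rewrite !inE => uc; exact: tr uc cb.
exists b; rewrite !inE ?rf //; apply: contraNN neq => bc.
by apply/eqP/anti; rewrite cb bc.
Qed.

Lemma piece_exists (le : rel A) z : total_order le -> \sum_a len a = 1 ->
  z \in `[0, 1[ -> exists a, z \in piece le len a.
Proof.
move=> o sum1; rewrite in_itv /= => /andP[z0 z1].
have [rf anti tr tot] := o.
have [a0 _|A0] := pickP A; last first.
  by move: sum1; rewrite big_pred0 // => /eqP; rewrite eq_sym oner_eq0.
have o' : total_order (fun u v => le v u).
  split=> [//|u v|u v w uv vw|u v].
  - by rewrite andbC; exact: anti.
  - exact: tr vw uv.
  - exact: tot.
have [m _ mmin] := total_order_max (P := predT) (a := a0) o' isT.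
have [c lc cmax] : exists2 c, left_end le len c <= z &
    forall b, left_end le len b <= z -> le b c.
  apply: (total_order_max (P := fun a => left_end le len a <= z) (a := m)) => //.
  rewrite /left_end big_pred0 // => b; apply/negbTE.
  rewrite negb_and negbK -implybE; apply/implyP => bm.
  by apply/eqP/anti; rewrite bm mmin.
exists c; rewrite in_itv /= lc /= ltNge; apply/negP => rc.
have [d0 d0c|Q0] := pickP (fun b => ~~ le b c); last first.
  move: rc; rewrite leNgt /right_end (eq_bigl predT) ?sum1 ?z1 // => b.
  by have /negbFE := Q0 b.
have [d dc dmin] := total_order_max (P := fun b => ~~ le b c) o' d0c.
have cd : le c d by have := tot c d; rewrite (negbTE dc) orbF.
suff /cmax : left_end le len d <= z by rewrite (negbTE dc).
rewrite (le_trans _ rc) // /left_end /right_end le_eqVlt; apply/orP; left.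
apply/eqP/eq_bigl => b; apply/andP/idP => [[bd bnd]|bc].
  apply: contraNT bnd => /dmin db; apply/eqP/anti; by rewrite bd db.
by split; [exact: tr bc cd | apply: contraNneq dc => <-].
Qed.

End ExchangeInverse.

Section IetInverse.
Variables (R : realType) (A : finType) (T : iet R A).

Lemma exchange_piece (le1 le2 : rel A) (a : A) (z : R) :
  total_order le1 -> total_order le2 -> z \in piece le1 (len T) a ->
  exchange le1 le2 (len T) z = z - left_end le1 (len T) a + left_end le2 (len T) a
  /\ exchange le1 le2 (len T) z \in piece le2 (len T) a.
Proof.
move=> o1 o2 za; rewrite /exchange; case: pickP => [b zb|/(_ a)]; last by rewrite za.
rewrite (piece_inj (len_gt0 T) o1 zb za); split=> //.
move: za; rewrite !in_itv /= !right_endE // => /andP[l r].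
by rewrite lerDr subr_ge0 l /= addrC ltrD2l ltrBlDl.
Qed.

Lemma exchangeK (le1 le2 : rel A) : total_order le1 -> total_order le2 ->
  {in `[0, 1[, cancel (exchange le1 le2 (len T)) (exchange le2 le1 (len T))}.
Proof.
move=> o1 o2 z /(piece_exists o1 (len_sum1 T))[a za].
have [-> h] := exchange_piece o1 o2 za.
have [+ _] := exchange_piece o2 o1 h.
by have [-> _] := exchange_piece o1 o2 za => ->; rewrite addrK subrK.
Qed.

Lemma iet_mapK : {in `[0, 1[, cancel (iet_map T) (iet_inv T)}.
Proof. exact: exchangeK (dom_le_order T) (img_le_order T). Qed.

Lemma iet_invK : {in `[0, 1[, cancel (iet_inv T) (iet_map T)}.
Proof. exact: exchangeK (img_le_order T) (dom_le_order T). Qed.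

Lemma iet_map_piece a z : z \in piece (dom_le T) (len T) a ->
  iet_map T z \in piece (img_le T) (len T) a.
Proof.
by move=> h; have [] := exchange_piece (dom_le_order T) (img_le_order T) h.
Qed.

End IetInverse.

(* The two-letter alphabet {0, 1} is bool, with 0 = false and 1 = true;
   [bool_morph w0 w1] is the morphism 0 |-> w0, 1 |-> w1. *)
Definition bool_morph (w0 w1 : seq bool) (w : seq bool) : seq bool :=
  flatten [seq (if b then w1 else w0) | b : bool <- w].

Definition L0 := bool_morph [:: false] [:: false; true].
Definition R0 := bool_morph [:: false] [:: true; false].
Definition L1 := bool_morph [:: true; false] [:: true].
Definition R1 := bool_morph [:: false; true] [:: true].

Inductive sturmian_monoid : (seq bool -> seq bool) -> Prop :=
  | sturmian_id : sturmian_monoid id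
  | sturmian_L0 : sturmian_monoid L0
  | sturmian_R0 : sturmian_monoid R0
  | sturmian_L1 : sturmian_monoid L1
  | sturmian_R1 : sturmian_monoid R1
  | sturmian_comp f g :
      sturmian_monoid f -> sturmian_monoid g -> sturmian_monoid (f \o g).

(* The letters of the source and of the target are identified with 0 and 1 in
   either way, hence the exchange 0 |-> 1, 1 |-> 0 is Sturmian too. *)
Definition sturmian (A B : finType) (s : seq A -> seq B) : Prop :=
  exists (f : A -> bool) (g : bool -> B) (t : seq bool -> seq bool),
    [/\ bijective f, bijective g, sturmian_monoid t &
        forall w, s w = map g (t (map f w))].

(* Main.v *)
(* The codings of a regular interval exchange T have two combinatorial features.  First, for every
   word w, the relation "a w b is a factor" between left letters a and right letters b is monotone
   for the order of the pieces in the image and in the domain of T respectively.  Second, orbits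
   are dense by Keane's argument, so every point T^-n d, with d a discontinuity, contributes a right
   special factor of length n, and there are at least (#|B| - 1) n + 1 factors of length n.

   Let s preserve the codings.  Counting the factors in the image of a coding dominated by one
   letter gives #|B| <= #|A|.  Up to conjugation, the images of the letters do not all start with
   the same letter, and there is a word q, a suffix of all left-infinite images, such that q is
   preceded by a letter g a that depends only on the last letter a of the source and is not
   constant; let f a be the first letter of s a.  Hence (g a) q (f b) is a factor whenever a b is.
   If #|A| >= 3, rotations provide source codings for which these factors contradict monotonicity,
   unless f and g are bijective, q is empty and all images have length 1.  If #|A| = 2, then
   #|B| = 2 and the codings are, up to exchanging the letters, the mechanical words with irrational
   slope; s factors through a generator of the Sturmian monoid because an image avoids 00 or 11, and
   the other factor preserves the codings too, since R0 and R1 act on mechanical words by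
   invertible transformations of the slope and the intercept. *)

Require Import Defs.
From mathcomp Require Import all_boot all_order all_algebra.
From mathcomp Require Import zify ring lra.
From mathcomp Require Import boolp classical_sets cardinality reals.

Set Implicit Arguments.
Unset Strict Implicit.
Unset Printing Implicit Defensive.

Import Order.TTheory GRing.Theory Num.Theory.

Local Open Scope classical_set_scope.
Local Open Scope ring_scope.

(** * Factors of bi-infinite words and morphic images *)

(** Nothing is known about the exchange that codes the image, so the necessity is drawn from its
    language alone, through the complexity bound and the monotone extensions. Keane's argument
    behind the first runs both forwards and backwards, whereas regularity speaks of the
    discontinuities of [T] only. The inverse is covered by writing each of its discontinuities as a
    positive iterate of a discontinuity of [T]. On the source side, regular exchanges with
    prescribed factors are needed. A rotation cut into labelled pieces is regular as soon as its cut
    [b c] is irrational and no two cuts differ by an element of Z + Z (b c). Each condition excludes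
    countably many values, so the cuts can be placed in any given disjoint open intervals, and a
    factor that occurs robustly can be read off approximate lengths. Conjugating a morphism only
    shifts its images, which is why a common prefix can be removed without losing preservation. In
    the binary case the induction passes to a right factor of the morphism; for this [R0] and [L0]
    must reflect codings, not only preserve them. *)

Section Factors.
Variable T : Type.
Implicit Types (y : int -> T) (m : int) (n : nat).

Definition factor y m n : seq T := [seq y (m + i%:Z) | i <- iota 0 n].

Definition occurs y (w : seq T) : Prop := exists m, factor y m (size w) = w.

Lemma size_factor y m n : size (factor y m n) = n.
Proof. by rewrite size_map size_iota. Qed.

Lemma nth_factor x0 y m n i : (i < n)%N -> nth x0 (factor y m n) i = y (m + i%:Z).
Proof. by move=> lt_in; rewrite (nth_map 0%N) ?size_iota // nth_iota. Qed.

Lemma factorD y m n1 n2 :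
  factor y m (n1 + n2) = factor y m n1 ++ factor y (m + n1%:Z) n2.
Proof.
rewrite /factor iotaD map_cat add0n; congr (_ ++ _).
rewrite -[in LHS](addn0 n1) (iotaDl n1 0) -map_comp.
by apply: eq_map => i /=; rewrite PoszD addrA.
Qed.

Lemma factor1 y m : factor y m 1 = [:: y m].
Proof. by rewrite /factor /= addr0. Qed.

Lemma factorS y m n : factor y m n.+1 = y m :: factor y (m + 1) n.
Proof. by rewrite -add1n factorD factor1. Qed.

Lemma factorSr y m n : factor y m n.+1 = rcons (factor y m n) (y (m + n%:Z)).
Proof. by rewrite -addn1 factorD factor1 cats1. Qed.

Lemma take_factor y m n k : (k <= n)%N -> take k (factor y m n) = factor y m k.
Proof.
by move=> le_kn; rewrite -(subnKC le_kn) factorD take_cat size_factor ltnn subnn take0 cats0.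
Qed.

Lemma drop_factor y m n k :
  (k <= n)%N -> drop k (factor y m n) = factor y (m + k%:Z) (n - k).
Proof.
move=> le_kn; rewrite -{1}(subnKC le_kn) factorD.
by rewrite drop_cat size_factor ltnn subnn drop0.
Qed.

Lemma factor_shift y d m n : factor (fun k => y (k + d)) m n = factor y (m + d) n.
Proof. by apply: eq_map => i; rewrite addrAC. Qed.

Lemma eq_factor y y' m m' n :
  (forall i, (i < n)%N -> y (m + i%:Z) = y' (m' + i%:Z)) ->
  factor y m n = factor y' m' n.
Proof.
move=> eq_y; apply/eq_in_map => i; rewrite mem_iota add0n; exact: eq_y.
Qed.

Lemma factor_const y a m n :
  (forall i, (i < n)%N -> y (m + i%:Z) = a) -> factor y m n = nseq n a.
Proof.
elim: n m => [//|n IH] m ya; rewrite factorS -[m in y m]addr0 ya //.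
by rewrite IH // => i i_n; rewrite -addrA -PoszD add1n ya.
Qed.

Lemma factor_cat_eq y m u v : factor y m (size (u ++ v)) = u ++ v <->
  factor y m (size u) = u /\ factor y (m + (size u)%:Z) (size v) = v.
Proof.
rewrite size_cat factorD; split=> [e|[-> ->//]].
have := congr1 (take (size u)) e; have := congr1 (drop (size u)) e.
by rewrite !take_size_cat ?drop_size_cat ?size_factor.
Qed.

Lemma occurs_infix y u v w : occurs y (u ++ v ++ w) -> occurs y v.
Proof.
by case=> m /factor_cat_eq[_ /factor_cat_eq[<- _]]; exists (m + (size u)%:Z); rewrite size_factor.
Qed.

End Factors.

Lemma factor_map (T U : Type) (f : T -> U) (y : int -> T) m n :
  factor (f \o y) m n = [seq f b | b <- factor y m n].
Proof. by rewrite /factor -map_comp. Qed.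

Section Morphisms.
Variables (A B : finType) (s : seq A -> seq B).
Hypothesis hs : morphism s.

Lemma morph_nil : s [::] = [::]. Proof. by case: hs. Qed.

Lemma morph_cat u v : s (u ++ v) = s u ++ s v. Proof. by case: hs. Qed.

Lemma morph_cons a u : s (a :: u) = s [:: a] ++ s u.
Proof. by rewrite -morph_cat. Qed.

Lemma morph_pair a b : s [:: a; b] = s [:: a] ++ s [:: b].
Proof. by rewrite -morph_cat. Qed.

Lemma morph_rcons u a : s (rcons u a) = s u ++ s [:: a].
Proof. by rewrite -cats1 morph_cat. Qed.

Lemma morphE u : s u = flatten [seq s [:: a] | a <- u].
Proof. by elim: u => [|a u IH]; [exact: morph_nil | rewrite morph_cons IH]. Qed.

Lemma leq_size_morph u : nonerasing s -> (size u <= size (s u))%N.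
Proof.
move=> hne; elim: u => // a u IH; rewrite morph_cons size_cat /= -add1n.
by rewrite leq_add // lt0n size_eq0.
Qed.

Variable x : int -> A.

Lemma block_start0 : block_start s x 0 = 0.
Proof. by rewrite /= big_ord0. Qed.

Lemma block_startD n k :
  block_start s x (n + k%:Z) = block_start s x n + (size (s (factor x n k)))%:Z.
Proof.
elim: k => [|k IH]; first by rewrite morph_nil !addr0.
rewrite -addn1 PoszD addrA block_startS IH addn1 factorSr morph_rcons.
by rewrite size_cat PoszD addrA.
Qed.

Variable y : int -> B.

Lemma factor_word_image n k : word_image s x y ->
  factor y (block_start s x n) (size (s (factor x n k))) = s (factor x n k).
Proof.
move=> yP; elim: k => [|k IH]; first by rewrite morph_nil.
rewrite factorSr morph_rcons size_cat factorD IH -block_startD.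
by congr (_ ++ _); exact: yP.
Qed.

Lemma occurs_image w : word_image s x y -> occurs x w -> occurs y (s w).
Proof.
move=> yP [m wE]; exists (block_start s x m).
by rewrite -{1}wE (factor_word_image _ _ yP) wE.
Qed.

End Morphisms.

Lemma block_start_unique (A B : finType) (s : seq A -> seq B) x (c : int -> int) :
  c 0 = 0 -> (forall n, c (n + 1) = c n + (size (s [:: x n]))%:Z) ->
  forall n, c n = block_start s x n.
Proof.
move=> c0 cS; elim/int_ind => [|n IH|n IH].
- by rewrite c0 /= big_ord0.
- by rewrite -addn1 PoszD cS IH block_startS.
- have e : - n.+1%:Z + 1 = - n%:Z by rewrite -addn1 PoszD opprD addrNK.
  have := cS (- n.+1%:Z); have := block_startS s x (- n.+1%:Z).
  by rewrite e IH => -> /addIr.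
Qed.

(** Made for block starts in closed form, such as [n + F n] for the image of a mechanical word under
    [R0]. *)
Lemma word_imageP (A B : finType) (s : seq A -> seq B) x y (c : int -> int) :
  c 0 = 0 -> (forall n, c (n + 1) = c n + (size (s [:: x n]))%:Z) ->
  (forall n, factor y (c n) (size (s [:: x n])) = s [:: x n]) ->
  word_image s x y.
Proof. by move=> c0 cS yP n; have := yP n; rewrite (block_start_unique c0 cS). Qed.

Lemma morphism_comp (A B C : finType) (s : seq A -> seq B) (t : seq B -> seq C) :
  morphism s -> morphism t -> morphism (t \o s).
Proof.
move=> hs ht; split=> [|u v|c] /=.
- by rewrite (morph_nil hs) (morph_nil ht).
- by rewrite (morph_cat hs) (morph_cat ht).
have [_ _ /(_ c)[b cb]] := ht; have [_ _ /(_ b)[a ba]] := hs.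
exists a; rewrite (morphE ht); apply/flattenP; exists (t [:: b]) => //.
exact: map_f.
Qed.

Lemma nonerasing_comp (A B C : finType) (s : seq A -> seq B) (t : seq B -> seq C) :
  morphism t -> nonerasing s -> nonerasing t -> nonerasing (t \o s).
Proof.
move=> ht sne tne a /=; case: (s [:: a]) (sne a) => // b w _.
by rewrite (morph_cons ht); case: (t [:: b]) (tne b).
Qed.

Lemma word_image_comp (A B C : finType) (s : seq A -> seq B) (t : seq B -> seq C)
    x y z : morphism t ->
  word_image s x y -> word_image t y z -> word_image (t \o s) x z.
Proof.
move=> ht yP zP.
have e n : t (s [:: x n]) = t (factor y (block_start s x n) (size (s [:: x n]))).
  by rewrite [factor _ _ _]yP.
apply: (@word_imageP _ _ _ _ _ (fun n => block_start t y (block_start s x n))).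
- by rewrite !block_start0.
- by move=> n; rewrite block_startS (block_startD ht) /= e.
- by move=> n; rewrite /= e factor_word_image.
Qed.

Lemma morphism_map (A B : finType) (f : A -> B) (g : B -> A) :
  cancel g f -> morphism (map f).
Proof.
move=> gK; split=> [//|u v|b]; first exact: map_cat.
by exists (g b); rewrite /= gK mem_head.
Qed.

Lemma word_image_map (A B : finType) (f : A -> B) x : word_image (map f) x (f \o x).
Proof.
apply: (@word_imageP _ _ _ _ _ id) => // n.
by rewrite [size _]/= factor1.
Qed.

(** * Dynamics of regular interval exchanges *)

Section Pieces.
Variables (R : realType) (A : finType) (T : iet R A).

Lemma pieceE (le : rel A) a z : total_order le ->
  (z \in piece le (len T) a) =
  (left_end le (len T) a <= z < left_end le (len T) a + len T a).
Proof. by move=> o; rewrite in_itv /= right_endE. Qed.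

Lemma left_end_piece (le : rel A) a : total_order le ->
  left_end le (len T) a \in piece le (len T) a.
Proof. by move=> o; rewrite pieceE // lexx ltrDl len_gt0. Qed.

Lemma piece_itv01 (le : rel A) a z :
  z \in piece le (len T) a -> z \in `[0, 1[.
Proof.
rewrite !in_itv /= => /andP[l r]; apply/andP; split.
  exact: le_trans (left_end_ge0 (len_gt0 T) _ _) l.
apply: (lt_le_trans r); rewrite -(len_sum1 T) /right_end.
rewrite [leRHS](bigID (le^~ a)) /= lerDl sumr_ge0 // => b _.
exact/ltW/len_gt0.
Qed.

Lemma total_order_flip (le : rel A) :
  total_order le -> total_order (fun u v => le v u).
Proof.
case=> rf anti tr tot; split=> [//|u v|v u w uv vw|u v].
- by rewrite andbC; exact: anti.
- exact: tr vw uv.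
- exact: tot.
Qed.

Lemma total_order_min (le : rel A) (P : pred A) a : total_order le -> P a ->
  exists2 c, P c & forall b, P b -> le c b.
Proof. by move=> /total_order_flip o /(total_order_max o). Qed.

Lemma left_end_min (le : rel A) m : total_order le ->
  (forall b, le m b) -> left_end le (len T) m = 0.
Proof.
case=> _ anti _ _ m_min; rewrite /left_end big_pred0 // => b.
by apply/negP => /andP[bm /eqP]; apply; apply: anti; rewrite bm m_min.
Qed.

Lemma left_end_second (le : rel A) m c : total_order le ->
  (forall b, le m b) -> c != m -> (forall b, b != m -> le c b) ->
  left_end le (len T) c = len T m.
Proof.
case=> _ anti _ _ m_min cm c_min; rewrite /left_end (big_pred1 m) // => b.
apply/andP/eqP => [[bc bNc]|->]; last by rewrite m_min eq_sym.
by apply/eqP; apply: contraNT bNc => /c_min cb; apply/eqP/anti; rewrite bc cb.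
Qed.

Lemma left_end_lt (le : rel A) a b : total_order le ->
  le a b -> a != b -> left_end le (len T) a < left_end le (len T) b.
Proof.
move=> o ab nab; apply: lt_le_trans (right_end_le_left_end (len_gt0 T) o ab nab).
by rewrite right_endE // ltrDl len_gt0.
Qed.

Lemma left_end_inj (le : rel A) : total_order le -> injective (left_end le (len T)).
Proof.
move=> o a b e; apply/eqP/negPn/negP => nab.
have [_ _ _ /(_ a b)/orP[ab|ba]] := o.
  by have := left_end_lt o ab nab; rewrite e ltxx.
by rewrite eq_sym in nab; have := left_end_lt o ba nab; rewrite e ltxx.
Qed.

End Pieces.

Section Dynamics.
Variables (R : realType) (A : finType).
Implicit Types (T : iet R A) (z d : R).

Definition iet_swap T : iet R A :=
  Iet (img_le_order T) (dom_le_order T) (len_gt0 T) (len_sum1 T).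

Definition disc T : set R :=
  [set z : R | z != 0 /\ exists a, z = left_end (dom_le T) (len T) a].

Lemma letter_exists T z : z \in `[0, 1[ -> exists a, z \in piece (dom_le T) (len T) a.
Proof. exact: piece_exists (dom_le_order T) (len_sum1 T). Qed.

Lemma iet_mapE T a z : z \in piece (dom_le T) (len T) a ->
  iet_map T z = z - left_end (dom_le T) (len T) a + left_end (img_le T) (len T) a.
Proof. by move=> za; have [] := exchange_piece (dom_le_order T) (img_le_order T) za. Qed.

Lemma iet_map_itv01 T z : z \in `[0, 1[ -> iet_map T z \in `[0, 1[.
Proof. by move=> /(letter_exists T)[a /iet_map_piece/piece_itv01]. Qed.

Lemma iet_inv_itv01 T z : z \in `[0, 1[ -> iet_inv T z \in `[0, 1[.
Proof. exact: (@iet_map_itv01 (iet_swap T)). Qed.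

Lemma iet_iter_itv01 T n z : z \in `[0, 1[ -> iet_iter T n z \in `[0, 1[.
Proof.
move=> z01; case: n => n; [|have -> : iet_iter T (Negz n) z = iter n.+1 (iet_inv T) z by []].
- by elim: n => //= n; exact: iet_map_itv01.
- by elim: n.+1 => // k IH; rewrite iterS; exact: iet_inv_itv01.
Qed.

Lemma iet_iterS T n z : z \in `[0, 1[ ->
  iet_iter T (n + 1) z = iet_map T (iet_iter T n z).
Proof.
move=> z01; case: n => [k|[|k]].
- by rewrite -PoszD addn1.
- by rewrite /= iet_invK.
have -> : Negz k.+1 + 1 = Negz k by rewrite !NegzE -[k.+2]addn1 PoszD opprD addrNK.
rewrite -[RHS]/(iet_map T (iet_inv T (iet_iter T (Negz k) z))) iet_invK //.
exact: iet_iter_itv01.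
Qed.

Lemma iet_iter_pred T n z : z \in `[0, 1[ ->
  iet_iter T (n - 1) z = iet_inv T (iet_iter T n z).
Proof.
move=> z01; rewrite -{2}(subrK 1 n) iet_iterS // iet_mapK //.
exact: iet_iter_itv01.
Qed.

Lemma iet_iterD T n m z : z \in `[0, 1[ ->
  iet_iter T (n + m) z = iet_iter T n (iet_iter T m z).
Proof.
move=> z01; have zm := iet_iter_itv01 T m z01.
elim/int_ind: n => [|n IH|n IH]; first by rewrite add0r.
  by rewrite -addn1 PoszD addrAC !iet_iterS // IH.
by rewrite -addn1 PoszD opprD addrAC !iet_iter_pred // IH.
Qed.

Lemma iet_iterNK T n z : z \in `[0, 1[ -> iet_iter T n (iet_iter T (- n) z) = z.
Proof. by move=> z01; rewrite -iet_iterD // subrr. Qed.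

Lemma iet_iterKN T n z : z \in `[0, 1[ -> iet_iter T (- n) (iet_iter T n z) = z.
Proof. by move=> z01; rewrite -iet_iterD // addNr. Qed.

Lemma iet_iter_swap T n z : z \in `[0, 1[ -> iet_iter (iet_swap T) n z = iet_iter T (- n) z.
Proof.
move=> z01; elim/int_ind: n => [|n IH|n IH]; first by rewrite oppr0.
  by rewrite -addn1 PoszD iet_iterS // IH opprD iet_iter_pred.
by rewrite -addn1 PoszD !opprD opprK iet_iter_pred // IH iet_iterS // opprK.
Qed.

Lemma coding_exists T z : z \in `[0, 1[ -> exists x, coding T z x.
Proof.
move=> z01.
have [x xP] := choice (fun n => letter_exists T (iet_iter_itv01 T n z01)).
exists x => n a; split=> [<- //|].
by move=> za; apply: (piece_inj (@len_gt0 _ _ T) (dom_le_order T) (xP n) za).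
Qed.

Lemma coding_shift T z x m : z \in `[0, 1[ -> coding T z x ->
  coding T (iet_iter T m z) (fun n => x (n + m)).
Proof. by move=> z01 xP n a; rewrite -iet_iterD. Qed.

Lemma coding_piece T z x n : coding T z x ->
  iet_iter T n z \in piece (dom_le T) (len T) (x n).
Proof. by move=> xP; apply/xP. Qed.

Lemma periodic_orbit_finite T z n : z \in `[0, 1[ ->
  iet_iter T n.+1%:Z z = z -> finite_set (iet_orbit T z).
Proof.
move=> z01 per.
have perM q : iet_iter T (q * n.+1%:Z) z = z.
  elim/int_ind: q => [|q IH|q IH]; first by rewrite mul0r.
    by rewrite -addn1 PoszD mulrDl mul1r iet_iterD // per.
  rewrite -addn1 PoszD opprD mulrDl mulN1r addrC iet_iterD // IH.
  by rewrite -{1}per iet_iterKN.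
apply: (@sub_finite_set _ _ [set iet_iter T i%:Z z | i in `I_n.+1]); last first.
  exact/finite_image/finite_II.
move=> _ [m _ <-]; exists (absz (m %% n.+1%:Z)%Z).
  by rewrite /= -ltz_nat gez0_abs ?modz_ge0 // ltz_pmod.
rewrite gez0_abs ?modz_ge0 // -[in LHS](perM (m %/ n.+1%:Z)%Z) -iet_iterD //.
by rewrite addrC -divz_eq.
Qed.

Lemma disc_itv01 T d : disc T d -> d \in `[0, 1[.
Proof. by case=> _ [a ->]; exact: piece_itv01 (left_end_piece T a (dom_le_order T)). Qed.

(** Disjointness of the orbits forces [d = d']; then [d] is periodic and its orbit finite. *)
Lemma no_connection T n d d' : regular T -> disc T d -> disc T d' ->
  iet_iter T n.+1%:Z d <> d'.
Proof.
move=> [inf disj] dd dd' e; have d01 := disc_itv01 dd.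
have ed : d = d'.
  by apply: (disj d d' dd dd'); exists d'; split; [exists n.+1%:Z | exists 0].
apply: (inf d dd); apply: (periodic_orbit_finite (n := n)) => //.
by rewrite ed in e *.
Qed.

(** The left end of the piece [m] that comes first in the image is mapped to 0. If that left end
    were 0 itself, [m] would come first in both orders, and the second piece of the image would have
    its left end mapped to the left end of the second piece of the domain: a connection. *)
Lemma disc_to_0 T : regular T -> (1 < #|A|)%N -> exists2 d, disc T d & iet_map T d = 0.
Proof.
move=> rT /card_gt1P[a1 [a2 [_ _ a12]]].
have [m _ m_min] := total_order_min (P := predT) (a := a1) (img_le_order T) isT.
have {}m_min b : img_le T m b by exact: m_min.
pose l1 := left_end (dom_le T) (len T); pose l2 := left_end (img_le T) (len T).
have map_l a : iet_map T (l1 a) = l2 a.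
  by rewrite (iet_mapE (left_end_piece T a (dom_le_order T))) subrr add0r.
have [m0|m0] := eqVneq (l1 m) 0; last first.
  exists (l1 m); first by split=> //; exists m.
  by rewrite map_l /l2 left_end_min //; exact: img_le_order.
have m_dmin b : dom_le T m b.
  have [rf _ _ tot] := dom_le_order T.
  have [->|nbm] := eqVneq b m; first exact: rf.
  have /orP[//|bm] := tot m b.
  have := left_end_lt T (dom_le_order T) bm nbm.
  by rewrite -/(l1 m) m0 ltNge left_end_ge0 //; exact: len_gt0.
have [a am] : exists a, a != m.
  by have [e|] := eqVneq a1 m; [exists a2; rewrite eq_sym -e | exists a1].
have [b bm b_min] := total_order_min (P := predC1 m) (img_le_order T) am.
have [c cm c_min] := total_order_min (P := predC1 m) (dom_le_order T) am.
have l2b : l2 b = len T m by apply: left_end_second => //; exact: img_le_order.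
have l1c : l1 c = len T m by apply: left_end_second => //; exact: dom_le_order.
exfalso; apply: (@no_connection T 0 (l1 b) (l1 c)) => //.
- split; last by exists b.
  apply/lt0r_neq0; rewrite -m0; apply: left_end_lt => //; first exact: dom_le_order.
  by rewrite eq_sym.
- by split; [rewrite l1c gt_eqF // len_gt0 | exists c].
- by rewrite [LHS]map_l l2b l1c.
Qed.

(** A left end in the image order is the image of a left end in the domain order; if the latter is
    0, [disc_to_0] supplies one more step back. *)
Lemma disc_swap T d : regular T -> (1 < #|A|)%N -> disc (iet_swap T) d ->
  exists n d0, disc T d0 /\ iet_iter T n.+1%:Z d0 = d.
Proof.
move=> rT A1 [d0 [a da]].
have map_a : iet_map T (left_end (dom_le T) (len T) a) = d.
  by rewrite (iet_mapE (left_end_piece T a (dom_le_order T))) subrr add0r da.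
have [l0|l0] := eqVneq (left_end (dom_le T) (len T) a) 0.
  have [d' dd' map_d'] := disc_to_0 rT A1.
  by exists 1%N, d'; split=> //=; rewrite map_d' -l0.
by exists 0%N, (left_end (dom_le T) (len T) a); split=> //; split=> //; exists a.
Qed.

Lemma no_connection_swap T n d d' : regular T -> (1 < #|A|)%N ->
  disc (iet_swap T) d -> disc T d' -> iet_iter T n%:Z d <> d'.
Proof.
move=> rT A1 /(disc_swap rT A1)[i [d0 [dd0 <-]]] dd'.
by rewrite -iet_iterD ?(disc_itv01 dd0) // -PoszD addnS; exact: no_connection.
Qed.

Lemma iet_map_translation T a z z' :
  z \in piece (dom_le T) (len T) a -> z' \in piece (dom_le T) (len T) a ->
  iet_map T z' = iet_map T z + (z' - z).
Proof. by move=> za z'a; rewrite (iet_mapE za) (iet_mapE z'a); ring. Qed.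

Lemma no_periodic_point T z n : regular T -> (1 < #|A|)%N -> z \in `[0, 1[ ->
  iet_iter T n.+1%:Z z <> z.
Proof.
move=> rT A1 z01 per.
have [x xP] := coding_exists T z01.
(* Moving the orbit of z to the left until it meets an endpoint of a piece,
   one obtains a periodic point that is a discontinuity or 0. *)
pose gap (i : 'I_n.+1) := iet_iter T i%:Z z - left_end (dom_le T) (len T) (x i%:Z).
have [j _ j_min] := @arg_minP _ R 'I_n.+1 ord0 predT gap isT.
have gap_ge0 i : 0 <= gap i.
  have := coding_piece i%:Z xP; rewrite pieceE; last exact: dom_le_order.
  by rewrite /gap subr_ge0 => /andP[].
have gap_piece (i : 'I_n.+1) :
    iet_iter T i%:Z z - gap j \in piece (dom_le T) (len T) (x i%:Z).
  have := j_min i isT; have := gap_ge0 j; have := coding_piece i%:Z xP.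
  rewrite !pieceE; try exact: dom_le_order.
  by rewrite {3}/gap; lra.
have z'01 : z - gap j \in `[0, 1[ by exact: piece_itv01 (gap_piece ord0).
have shift i : (i <= n.+1)%N -> iet_iter T i%:Z (z - gap j) = iet_iter T i%:Z z - gap j.
  elim: i => // i IH lt_in.
  rewrite -addn1 PoszD !iet_iterS // IH 1?ltnW //.
  have zi := coding_piece i%:Z xP.
  rewrite (iet_map_translation zi (z' := iet_iter T i%:Z z - gap j)); first by ring.
  exact: (gap_piece (Ordinal lt_in)).
set d := left_end (dom_le T) (len T) (x j%:Z).
have dE : iet_iter T j%:Z (z - gap j) = d.
  by rewrite shift 1?ltnW // /gap subKr.
have dper : iet_iter T n.+1%:Z d = d.
  rewrite -dE -iet_iterD // addrC iet_iterD // shift // per //.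
(* The point 0 does not count as a discontinuity, but its preimage does and is periodic as well. *)
have [d0|d0] := eqVneq d 0.
  have [d1 dd1 d10] := disc_to_0 rT A1.
  apply: (@no_connection T n d1 d1) => //.
  have d1E : iet_iter T (-1) d = d1.
    by rewrite d0 -d10 /= iet_mapK // (disc_itv01 dd1).
  have d01 : d \in `[0, 1[ by rewrite -dE iet_iter_itv01.
  by rewrite -d1E -iet_iterD // addrC iet_iterD // dper.
by apply: (@no_connection T n d d) => //; split=> //; exists (x j%:Z).
Qed.

End Dynamics.

(** * Density of the orbits *)

Lemma finite_lower_bound (R : realType) (A : finType) (f : A -> R) :
  (forall a, 0 < f a) -> exists2 e, 0 < e & forall a, e <= f a.
Proof.
move=> f0; exists (\big[Order.min/1]_a f a); last by move=> a; exact: bigmin_le_cond.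
by elim/big_ind: _ => // u v u0 v0; rewrite lt_min u0.
Qed.

Lemma ge_min2 (R : realType) (u v : R) : Num.min u v <= u /\ Num.min u v <= v.
Proof. by rewrite !ge_min !lexx orbT. Qed.

(** Pigeonhole: two of [N + 1] distinct points share one of [N] intervals of length [1 / N < e]. *)
Lemma close_points (R : realType) (q : nat -> R) e : 0 < e ->
  (forall n, q n \in `[0, 1[) -> injective q -> exists n m, q n < q m < q n + e.
Proof.
move=> e0 q01 q_inj; pose N := Num.bound e^-1.
have N0 : 0 < N%:R :> R.
  by apply: lt_trans (archi_boundP _); rewrite ?invr_gt0 // ltW // invr_gt0.
have Ne : N%:R^-1 < e.
  by rewrite invf_plt ?posrE //; apply: archi_boundP; rewrite ltW // invr_gt0.
have lt_N (i : 'I_N.+1) : (Num.truncn (q i * N%:R) < N)%N.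
  have := q01 i; rewrite in_itv /= => /andP[l r].
  by rewrite truncn_lt_nat ?mulr_ge0 // gtr_pMl.
pose f i := Ordinal (lt_N i).
have /injectivePn[i [j nij eij]] : ~~ injectiveb f.
  by apply/negP => /injectiveP/leq_card; rewrite !card_ord ltnn.
have {}eij : Num.truncn (q i * N%:R) = Num.truncn (q j * N%:R) by case: eij.
have near u v : Num.truncn (q u * N%:R) = Num.truncn (q v * N%:R) -> q v < q u + e.
  move=> euv; have := q01 u; have := q01 v; rewrite !in_itv /= => /andP[lv rv] /andP[lu ru].
  have /truncn_itv/andP[a1 a2] : 0 <= q u * N%:R by rewrite mulr_ge0 // ltW.
  have /truncn_itv/andP[b1 b2] : 0 <= q v * N%:R by rewrite mulr_ge0 // ltW.
  rewrite euv in a1 a2.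
  suff : q v - q u < N%:R^-1 by lra.
  rewrite -(ltr_pM2r N0) mulVf ?gt_eqF // mulrBl.
  by rewrite -natr1 in b2; lra.
have : q i != q j by apply: contra nij => /eqP/q_inj/val_inj ->.
by rewrite neq_lt => /orP[h|h]; [exists i, j | exists j, i]; rewrite h near.
Qed.

Section Density.
Variables (R : realType) (A : finType).
Implicit Types (T : iet R A) (O : set R).

Definition invariant_set T O : Prop :=
  forall t, O t -> [/\ t \in `[0, 1[, O (iet_map T t) & O (iet_inv T t)].

Definition aperiodic T : Prop :=
  forall z n, z \in `[0, 1[ -> iet_iter T n.+1%:Z z <> z.

Lemma aperiodic_swap T : aperiodic T -> aperiodic (iet_swap T).
Proof.
move=> ap z n z01; rewrite iet_iter_swap // => e; apply: (ap z n z01).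
by rewrite -{1}e iet_iterNK.
Qed.

(** [p] is the left end of a gap of [O], that is, the supremum of the points of [O] below the gap;
    it may or may not belong to [O]. *)
Definition gap_boundary O (p : R) : Prop :=
  [/\ p \in `[0, 1[, exists2 e, 0 < e & forall t, p < t < p + e -> ~ O t &
      forall e, 0 < e -> exists2 t, p - e < t <= p & O t].

Lemma invariant_swap T O : invariant_set T O -> invariant_set (iet_swap T) O.
Proof. by move=> inv t /inv[]. Qed.

Lemma invariant_map T O t : invariant_set T O -> t \in `[0, 1[ ->
  O (iet_map T t) -> O t.
Proof. by move=> inv t01 /inv[_ _]; rewrite iet_mapK. Qed.

Lemma invariant_iter T O n t : invariant_set T O -> O t -> O (iter n (iet_map T) t).
Proof. by move=> inv Ot; elim: n => //= n /inv[]. Qed.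

(** The translation on the piece of [p] carries along the beginning of the gap. On the left, [p]
    itself suffices if it is in [O]; otherwise the nearby points of [O] must share its piece, which
    fails only at a discontinuity or at 0, and 0 is excluded because [O] lies in [0, 1). *)
Lemma gap_boundary_map T O p : invariant_set T O -> gap_boundary O p ->
  O p \/ ~ disc T p -> gap_boundary O (iet_map T p).
Proof.
move=> inv [p01 [e e0 gap] acc] cond; have [a pa] := letter_exists T p01.
have pab := pa; rewrite pieceE in pab; last exact: dom_le_order.
have [l r] := andP pab.
have shift s : left_end (dom_le T) (len T) a <= s < left_end (dom_le T) (len T) a + len T a ->
    (s \in `[0, 1[) /\ iet_map T s = iet_map T p + (s - p).
  move=> sa; have sa' : s \in piece (dom_le T) (len T) a.
    by rewrite pieceE //; exact: dom_le_order.
  by split; [exact: piece_itv01 sa' | exact: iet_map_translation pa sa'].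
split; first exact: iet_map_itv01.
- exists (Num.min e (left_end (dom_le T) (len T) a + len T a - p)).
    by rewrite lt_min e0 subr_gt0.
  have [m1 m2] := ge_min2 e (left_end (dom_le T) (len T) a + len T a - p).
  move=> t ht Ot; have := gap (p + (t - iet_map T p)).
  have [|s01 Es] := shift (p + (t - iet_map T p)); first by lra.
  apply; first by lra.
  by apply: (invariant_map inv s01); rewrite Es; congr O: Ot; ring.
- case: cond => [Op|ndp] e' e'0.
    by exists (iet_map T p); [lra | have [] := inv _ Op].
  have [Op|nOp] := pselect (O p).
    by exists (iet_map T p); [lra | have [] := inv _ Op].
  have p0 : 0 < p.
    have [t tp Ot] := acc 1 ltr01; have [+ _ _] := inv _ Ot.
    rewrite in_itv /= => /andP[t0 _]; have [pt|] := eqVneq t p; last by lra.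
    by case: nOp; rewrite -pt.
  have lp : left_end (dom_le T) (len T) a < p.
    rewrite lt_neqAle l andbT; apply/eqP => ep; apply: ndp.
    by split; [rewrite gt_eqF | exists a].
  have [|t tp Ot] := acc (Num.min e' (p - left_end (dom_le T) (len T) a)).
    by rewrite lt_min e'0 subr_gt0.
  have [m1 m2] := ge_min2 e' (p - left_end (dom_le T) (len T) a).
  exists (iet_map T t); last by have [] := inv _ Ot.
  by have [|_ ->] := shift t; lra.
Qed.

(* The gaps along the orbit shrink only when they meet the right end of a piece; the left end
   of such a gap is determined by the piece, so the lengths stay bounded below, although
   infinitely many disjoint gaps do not fit in [0, 1). *)
Lemma gap_boundary_orbit T O p : aperiodic T -> invariant_set T O ->
  ~ (forall n, gap_boundary O (iter n (iet_map T) p)).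
Proof.
move=> ap inv bd; have [p01 [e1 e10 gap1] _] := bd 0%N.
pose r a := left_end (dom_le T) (len T) a + len T a.
have [e0 e0_gt0 e0P] : exists2 e0, 0 < e0 & forall a q, gap_boundary O q ->
    q < r a -> (forall t, q < t < r a -> ~ O t) -> e0 <= r a - q.
  suff /choice[f fP] : forall a, exists e, 0 < e /\ forall q, gap_boundary O q ->
      q < r a -> (forall t, q < t < r a -> ~ O t) -> e <= r a - q.
    have [e e0 ef] := finite_lower_bound (fun a => (fP a).1).
    by exists e => // a q bq qr gq; apply: le_trans (ef a) _; apply: (fP a).2.
  move=> a; have [[q [bq qr gq]]|nq] := pselect (exists q, [/\ gap_boundary O q,
      q < r a & forall t, q < t < r a -> ~ O t]); last first.
    by exists 1; split=> // q bq qr gq; case: nq; exists q.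
  exists (r a - q); split=> [|q' [q'01 _ acc] q'r gq']; first by lra.
  rewrite lerD2l lerN2 leNgt; apply/negP => qq'.
  by have [|t tq Ot] := acc (q' - q); [lra | apply: (gq t) => //; lra].
pose e := Num.min e0 e1; have e_gt0 : 0 < e by rewrite lt_min e0_gt0.
have [le_e0 le_e1] : e <= e0 /\ e <= e1 := ge_min2 e0 e1.
have gap n t : iter n (iet_map T) p < t < iter n (iet_map T) p + e -> ~ O t.
  elim: n t => [|n IH] t.
    by move=> ht; apply: gap1; move: ht => /=; lra.
  set q := iter n _ p in IH; rewrite iterS -/q => ht Ot.
  have bdq : gap_boundary O q := bd n.
  have [q01 _ _] := bdq; have [a qa] := letter_exists T q01.
  have := qa; rewrite pieceE -/(r a) => [/andP[lq qr]|]; last exact: dom_le_order.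
  have er : e <= r a - q.
    rewrite leNgt; apply/negP => er.
    have : e0 <= r a - q.
      by apply: e0P bdq qr _ => s hs; apply: IH; lra.
    by lra.
  have sa : q + (t - iet_map T q) \in piece (dom_le T) (len T) a.
    by rewrite pieceE; [rewrite /r in qr er; lra | exact: dom_le_order].
  apply: (IH (q + (t - iet_map T q))); first by lra.
  apply: (invariant_map inv (piece_itv01 sa)).
  by rewrite (iet_map_translation qa sa); congr O: Ot; ring.
have [n [m /andP[nm mn]]] : exists n m,
    iter n (iet_map T) p < iter m (iet_map T) p < iter n (iet_map T) p + e.
  apply: close_points => // [n|]; first by have [] := bd n.
  have cancel i k : iter (i + k.+1) (iet_map T) p <> iter i (iet_map T) p.
    rewrite addnC iterD; by apply: ap; have [] := bd i.
  move=> i j; case: (ltngtP i j) => // [ij|ji] eij.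
    by case: (cancel i (j - i.+1)%N); rewrite addnS -addSn subnKC.
  by case: (cancel j (i - j.+1)%N); rewrite addnS -addSn subnKC.
have [_ _ acc] := bd m.
have [|t ht Ot] := acc (iter m (iet_map T) p - iter n (iet_map T) p); first by lra.
by apply: (gap n t) => //; lra.
Qed.

(** Otherwise [gap_boundary_map] applies along the whole forward orbit, against
    [gap_boundary_orbit]. *)
Lemma gap_boundary_hits_disc T O p : aperiodic T -> invariant_set T O ->
  gap_boundary O p -> ~ O p /\ exists n, disc T (iter n (iet_map T) p).
Proof.
move=> ap inv bd; split=> [Op|].
  apply: (gap_boundary_orbit (p := p) ap inv).
  elim=> //= n IH; apply: gap_boundary_map IH _ => //; left; exact: invariant_iter.
apply: contrapT => nd; apply: (gap_boundary_orbit (p := p) ap inv).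
elim=> //= n IH; apply: gap_boundary_map IH _ => //; right=> dn.
by apply: nd; exists n.
Qed.
End Density.

Section Minimality.
Variables (R : realType) (A : finType) (T : iet R A).
Hypotheses (rT : regular T) (A1 : (1 < #|A|)%N).

Let ap : aperiodic T.
Proof. by move=> z n; exact: no_periodic_point. Qed.

(* The forward and the backward orbit of a boundary point reach a discontinuity of T and of its
   inverse respectively, which is a connection. *)
Lemma no_gap_boundary O p : invariant_set T O -> ~ gap_boundary O p.
Proof.
move=> inv bd; have p01 : p \in `[0, 1[ by case: bd.
have [_ [n dn]] := gap_boundary_hits_disc ap inv bd.
have [_ [m dm]] := gap_boundary_hits_disc (aperiodic_swap ap) (invariant_swap inv) bd.
apply: (no_connection_swap (n := (n + m)%N) rT A1 dm dn).
rewrite -[iter m _ p]/(iet_iter (iet_swap T) m%:Z p) iet_iter_swap // PoszD.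
rewrite iet_iterD ?iet_iterNK //.
exact: iet_iter_itv01.
Qed.

Section Orbit.
Variable O : set R.
Hypothesis inv : invariant_set T O.

Let free u := (u \in `[0, 1[) /\ exists2 e, 0 < e & forall t, u <= t < u + e -> ~ O t.

(** The supremum of the points of [O] up to [u] would be a gap boundary. *)
Let no_point_below u t : free u -> O t -> u < t.
Proof.
move=> [u01 [e e0 fu]] Ot; rewrite ltNge; apply/negP => tu.
pose P : set R := [set o | O o /\ o <= u].
have supP : has_sup P by split; [exists t | exists u => o []].
have pt : t <= sup P by apply: sup_upper_bound.
have pu : sup P <= u by apply: sup_le_ub; [exists t | move=> o []].
move: u01; rewrite in_itv /= => /andP[u0 u1].
have t0 : 0 <= t by have [+ _ _] := inv Ot; rewrite in_itv /= => /andP[].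
apply: (@no_gap_boundary O (sup P) inv); split.
- by rewrite in_itv /=; lra.
- exists (u + e - sup P); first by lra.
  move=> s hs Os; have [su|us] := leP s u; last by apply: (fu s) => //; lra.
  by have : s <= sup P by [apply: sup_upper_bound]; lra.
- move=> e' e'0; have [o [Oo ou] ho] := sup_adherent e'0 supP.
  by exists o => //; rewrite ho; apply: sup_upper_bound.
Qed.

Let free_map (S : iet R A) u : invariant_set S O -> free u -> free (iet_map S u).
Proof.
move=> invS [u01 [e e0 fu]]; split; first exact: iet_map_itv01.
have [a ua] := letter_exists S u01.
have := ua; rewrite pieceE; last exact: dom_le_order.
move=> /andP[l r].
have [m1 m2] := ge_min2 e (left_end (dom_le S) (len S) a + len S a - u).
exists (Num.min e (left_end (dom_le S) (len S) a + len S a - u)).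
  by rewrite lt_min e0 subr_gt0.
move=> t ht Ot.
have sa : u + (t - iet_map S u) \in piece (dom_le S) (len S) a.
  by rewrite pieceE; [lra | exact: dom_le_order].
apply: (fu (u + (t - iet_map S u))); first by lra.
apply: (invariant_map invS (piece_itv01 sa)).
by rewrite (iet_map_translation ua sa); congr O: Ot; ring.
Qed.

(* If no gap of O is preceded by a point of O, then O avoids some [0, q) stable under T and its
   inverse, and q is a discontinuity of both. *)
Lemma invariant_set_dense u e t : O t -> u \in `[0, 1[ -> 0 < e ->
  exists2 s, O s & u <= s < u + e.
Proof.
move=> Ot u01 e0; apply: contrapT => nO.
have fu : free u by split=> //; exists e => // s hs Os; apply: nO; exists s.
have infO : has_inf O.
  by split; [exists t | exists 0 => s /inv[]; rewrite in_itv /= => /andP[]].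
set q := inf O.
have below_q v : free v -> v < q.
  move=> fv; have [_ [d d0 hd]] := fv.
  suff : v + d <= q by lra.
  apply: lb_le_inf; first by exists t.
  move=> s Os; have := no_point_below fv Os => vs.
  by rewrite leNgt; apply/negP => sv; apply: (hd s) => //; lra.
have q_le s : O s -> q <= s by move=> Os; apply: ge_inf; [case: infO | ].
have q0 : 0 < q.
  by have := below_q u fu; move: u01; rewrite in_itv /= => /andP[]; lra.
have q1 : q < 1.
  by have := q_le t Ot; have [+ _ _] := inv Ot; rewrite in_itv /= => /andP[]; lra.
have q01 : q \in `[0, 1[ by rewrite in_itv /=; lra.
have freeq v : 0 <= v < q -> free v.
  move=> vq; split; first by rewrite in_itv /=; lra.
  by exists (q - v); [lra | move=> s hs /q_le; lra].
have stable (S : iet R A) v : invariant_set S O -> 0 <= v < q -> 0 <= iet_map S v < q.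
  move=> invS vq; have := below_q _ (free_map invS (freeq v vq)).
  have := iet_map_itv01 S (freeq v vq).1; rewrite in_itv /= => /andP[-> _].
  by move->.
(* If [q] were interior to a piece, it could not move: [S q < q] contradicts the stability of [0, q)
   under the inverse, and [S q > q] carries points just below [q] beyond [q]. A fixed point is
   excluded by aperiodicity. *)
have disc_q (S : iet R A) : aperiodic S -> invariant_set S O -> disc S q.
  move=> apS invS; have [a qa] := letter_exists S q01.
  have := qa; rewrite pieceE; last exact: dom_le_order.
  move=> /andP[l r]; split; first by rewrite gt_eqF.
  have [e_l|nl] := eqVneq q (left_end (dom_le S) (len S) a); first by exists a.
  have {nl}l : left_end (dom_le S) (len S) a < q by rewrite lt_neqAle eq_sym nl.
  have l0 := left_end_ge0 (@len_gt0 _ _ S) (dom_le S) a.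
  case: (apS q 0%N q01); rewrite /=.
  have := iet_map_itv01 S q01; rewrite in_itv /= => /andP[Sq0 Sq1].
  case: (ltgtP (iet_map S q) q) => // h.
    have := stable (iet_swap S) (iet_map S q) (invariant_swap invS).
    rewrite -[iet_map (iet_swap S) _]/(iet_inv S (iet_map S q)) iet_mapK //.
    by rewrite Sq0 h ltxx andbF => /(_ isT).
  have [m1 m2] := ge_min2 (q - left_end (dom_le S) (len S) a) (iet_map S q - q).
  set d := Num.min _ _ in m1 m2.
  have d0 : 0 < d by rewrite lt_min !subr_gt0 l.
  have va : q - d / 2 \in piece (dom_le S) (len S) a.
    by rewrite pieceE; [lra | exact: dom_le_order].
  have := stable S (q - d / 2) invS; rewrite (iet_map_translation qa va).
  have vq : 0 <= q - d / 2 < q by lra.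
  by move=> /(_ vq); lra.
apply: (no_connection_swap (n := 0%N) rT A1 (disc_q _ (aperiodic_swap ap) (invariant_swap inv))
  (disc_q _ ap inv)).
by [].
Qed.

End Orbit.

Lemma orbit_invariant z : z \in `[0, 1[ -> invariant_set T (iet_orbit T z).
Proof.
move=> z01 _ [n _ <-]; split; first exact: iet_iter_itv01.
- by exists (n + 1) => //; rewrite iet_iterS.
- by exists (n - 1) => //; rewrite iet_iter_pred.
Qed.

Lemma orbit_dense z u e : z \in `[0, 1[ -> u \in `[0, 1[ -> 0 < e ->
  exists n, u <= iet_iter T n z < u + e.
Proof.
move=> z01 u01 e0.
have Oz : iet_orbit T z z by exists 0.
by have [_ [n _ <-] h] := invariant_set_dense (orbit_invariant z01) Oz u01 e0; exists n.
Qed.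

(** Pieces contain their left ends, so [T] is a translation just to the right of any point. *)
Lemma right_cylinder u x k : u \in `[0, 1[ -> coding T u x ->
  exists2 e, 0 < e & forall t, 0 <= t < e -> forall i, (i < k)%N ->
    iet_iter T i%:Z (u + t) = iet_iter T i%:Z u + t /\
    iet_iter T i%:Z (u + t) \in piece (dom_le T) (len T) (x i%:Z).
Proof.
move=> u01 xP; elim: k => [|k [e e0 IH]]; first by exists 1.
have := coding_piece k%:Z xP; rewrite pieceE; last exact: dom_le_order.
set l := left_end _ _ _; set w := iet_iter _ _ _ => /andP[lw wr].
have [m1 m2] := ge_min2 e (l + len T (x k%:Z) - w).
exists (Num.min e (l + len T (x k%:Z) - w)); first by rewrite lt_min e0 subr_gt0.
move=> t ht i; rewrite ltnS leq_eqVlt => /predU1P[->|ik]; last by apply: IH => //; lra.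
have wt : iet_iter T k%:Z (u + t) = w + t.
  rewrite /w; case: (k) (IH t) => [//|j] {}IH.
  have [|e1 h1] := IH _ j (ltnSn j); first by lra.
  have ut01 : u + t \in `[0, 1[.
    by have [|_ /piece_itv01] := IH _ 0%N isT; [lra | ].
  rewrite -addn1 PoszD !iet_iterS // (iet_map_translation (coding_piece j%:Z xP) h1) e1.
  by ring.
rewrite wt; split=> //; rewrite pieceE; last exact: dom_le_order.
by rewrite -/l; lra.
Qed.

(** By density, the orbit of [z] enters the right neighbourhood of [u] on which the first [k]
    letters are constant. *)
Lemma coding_language z x u x' k : z \in `[0, 1[ -> coding T z x ->
  u \in `[0, 1[ -> coding T u x' -> exists m, factor x m k = factor x' 0 k.
Proof.
move=> z01 xP u01 x'P; have [e e0 he] := right_cylinder k u01 x'P.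
have [m hm] := orbit_dense z01 u01 e0; exists m; apply: eq_factor => i ik.
rewrite add0r; apply/xP; rewrite addrC iet_iterD //.
have [|_] := he (iet_iter T m z - u) _ i ik; first by lra.
by rewrite addrC subrK.
Qed.

End Minimality.

(** * Extensions of factors and complexity of the codings *)

(* h and k rank the letters that precede and follow a factor, in the order of their pieces in the
   image and in the domain of the exchange. *)
Definition ordered_extensions (B : eqType) (y : int -> B) (h k : B -> nat) : Prop :=
  [/\ injective h, injective k & forall w a b a' b',
      occurs y (a :: rcons w b) -> occurs y (a' :: rcons w b') ->
      (h a < h a')%N -> (k b <= k b')%N].

Definition words (B : finType) (y : int -> B) (n : nat) : {set n.-tuple B} :=
  [set t : n.-tuple B | `[< occurs y t >]]%SET.

Section Words.
Variables (B : finType) (y : int -> B).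

Lemma in_words n (t : n.-tuple B) : reflect (occurs y t) (t \in words y n).
Proof. by rewrite inE; exact: asboolP. Qed.

Lemma card_words_leq n (S : seq (seq B)) :
  (forall m, factor y m n \in S) -> (#|words y n| <= size S)%N.
Proof.
move=> inS; rewrite cardE -(size_map val); apply: uniq_leq_size.
  by rewrite map_inj_uniq ?enum_uniq //; exact: val_inj.
move=> _ /mapP[t + ->]; rewrite mem_enum => /in_words[m].
by rewrite size_tuple => e; rewrite -[val t]e.
Qed.

End Words.

Lemma rank_lt (B : finType) (le : rel B) a b : total_order le ->
  (#|[pred u | le u a]| < #|[pred u | le u b]|)%N -> le a b /\ a != b.
Proof.
case=> rf _ tr tot lt_ab; have nab : a != b by apply: contraTneq lt_ab => ->; rewrite ltnn.
split=> //; have /orP[//|ba] := tot a b; move: lt_ab; rewrite ltnNge => /negP[].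
by apply/subset_leq_card/fintype.subsetP => u; rewrite !inE => /tr; exact.
Qed.

Lemma rank_inj (B : finType) (le : rel B) : total_order le ->
  injective (fun a => #|[pred u | le u a]|).
Proof.
case=> rf anti tr tot a b e; apply: anti.
wlog ab : a b e / le a b => [H|].
  have /orP[ab|ba] := tot a b; first exact: H.
  by rewrite andbC; apply: H.
rewrite ab /=; have s : [pred u | le u a] \subset [pred u | le u b].
  by apply/fintype.subsetP => u; rewrite !inE => ua; exact: tr ua ab.
by have /(subset_cardP e)/(_ b) := s; rewrite !inE rf.
Qed.

Section RegularCodings.
Variables (R : realType) (B : finType).
Hypothesis B1 : (1 < #|B|)%N.

Lemma iet_iter_translation (T : iet R B) u u' x x' k :
  u \in `[0, 1[ -> u' \in `[0, 1[ -> coding T u x -> coding T u' x' ->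
  factor x 0 k = factor x' 0 k ->
  iet_iter T k%:Z u' = iet_iter T k%:Z u + (u' - u).
Proof.
move=> u01 u'01 xP x'P; elim: k => [|k IH] e; first by rewrite /=; ring.
have ek : factor x 0 k = factor x' 0 k.
  by move: e; rewrite !factorSr => /rcons_inj[].
have exk : x k%:Z = x' k%:Z.
  by move: e; rewrite !factorSr !add0r => /rcons_inj[].
rewrite -addn1 PoszD !iet_iterS //.
have h' := coding_piece k%:Z x'P; rewrite -exk in h'.
by rewrite (iet_map_translation (coding_piece k%:Z xP) h') IH //; ring.
Qed.

Lemma coding_img_piece (T : iet R B) z x n : z \in `[0, 1[ -> coding T z x ->
  iet_iter T (n + 1) z \in piece (img_le T) (len T) (x n).
Proof. by move=> z01 xP; rewrite iet_iterS // iet_map_piece // coding_piece. Qed.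

Lemma piece_lt (T : iet R B) (le : rel B) a b u v : total_order le ->
  le a b -> a != b -> u \in piece le (len T) a -> v \in piece le (len T) b -> u < v.
Proof.
move=> o ab nab; rewrite !in_itv /= => /andP[_ ur] /andP[vl _].
apply: (lt_le_trans ur); apply: le_trans vl.
by apply: right_end_le_left_end => //; exact: len_gt0.
Qed.

Lemma riet_coding_shift (x : int -> B) d : riet_coding R x ->
  riet_coding R (fun n => x (n + d)).
Proof.
move=> [T [z [rT z01 xP]]]; exists T, (iet_iter T d z); split=> //.
  exact: iet_iter_itv01.
exact: coding_shift.
Qed.

(** The points reached after [a] and [a'] lie in different image pieces, hence are ordered like [a]
    and [a']. Reading the common word [w] translates both by the same amount, so the pieces of [b]
    and [b'] are met in the same order. *)
Lemma riet_ordered_extensions (y : int -> B) : riet_coding R y ->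
  exists h k, ordered_extensions y h k.
Proof.
move=> [T [z [_ z01 yP]]].
have od := dom_le_order T; have oi := img_le_order T.
exists (fun a => #|[pred u | img_le T u a]|), (fun a => #|[pred u | dom_le T u a]|).
split; [exact: rank_inj | exact: rank_inj|].
have occE w a b : occurs y (a :: rcons w b) -> exists m,
    [/\ y m = a, factor y (m + 1) (size w) = w & y (m + 1 + (size w)%:Z) = b].
  move=> [m]; rewrite /= size_rcons factorS factorSr => -[ya /rcons_inj[yw yb]].
  by exists m.
move=> w a b a' b' /occE[m [ya yw yb]] /occE[m' [ya' yw' yb']] /rank_lt[//|aa' naa'].
rewrite leqNgt; apply/negP => /rank_lt[//|bb' nbb'].
have J := coding_img_piece m z01 yP; have J' := coding_img_piece m' z01 yP.
rewrite ya in J; rewrite ya' in J'.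
have lt1 := piece_lt oi aa' naa' J J'.
have I := coding_piece (m + 1 + (size w)%:Z) yP.
have I' := coding_piece (m' + 1 + (size w)%:Z) yP.
rewrite yb in I; rewrite yb' in I'.
have := piece_lt od bb' nbb' I' I.
rewrite ![_ + (size w)%:Z]addrC !(iet_iterD _ (size w)%:Z) //.
have e : factor (fun n => y (n + (m + 1))) 0 (size w) =
         factor (fun n => y (n + (m' + 1))) 0 (size w).
  by rewrite !factor_shift !add0r yw yw'.
rewrite (iet_iter_translation _ _ (coding_shift (m + 1) z01 yP)
  (coding_shift (m' + 1) z01 yP) e); try exact: iet_iter_itv01.
by lra.
Qed.

(** Just to the left of a point, [T] is the same translation only if the point is not the left end
    of its piece. The condition stops before time [k], since [right_special] lets the point reach a
    left end exactly then. *)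
Lemma left_cylinder (T : iet R B) u x k : u \in `[0, 1[ -> coding T u x ->
  (forall i, (i < k)%N -> iet_iter T i%:Z u != left_end (dom_le T) (len T) (x i%:Z)) ->
  exists2 e, 0 < e & forall t, 0 <= t < e ->
    (forall i, (i <= k)%N -> iet_iter T i%:Z (u - t) = iet_iter T i%:Z u - t) /\
    (forall i, (i < k)%N -> iet_iter T i%:Z (u - t) \in piece (dom_le T) (len T) (x i%:Z)).
Proof.
move=> u01 xP; elim: k => [|k IH] nl.
  by exists 1 => // t _; split=> // i; rewrite leqn0 => /eqP ->.
have [i ik|e e0 {}IH] := IH; first by apply: nl; exact: ltnW.
have wp := coding_piece k%:Z xP.
have := wp; rewrite pieceE; last exact: dom_le_order.
have := nl k (ltnSn k).
set l := left_end _ _ _; set w := iet_iter _ _ _ in wp * => wl /andP[lw wr].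
have {wl}lw : l < w by rewrite lt_neqAle eq_sym wl.
have [m1 m2] := ge_min2 e (w - l).
exists (Num.min e (w - l)); first by rewrite lt_min e0 subr_gt0.
move=> t ht; have [|it ip] := IH t; first by lra.
have wt : w - t \in piece (dom_le T) (len T) (x k%:Z).
  by rewrite pieceE -/l; [lra | exact: dom_le_order].
have ip' i : (i < k.+1)%N -> iet_iter T i%:Z (u - t) \in piece (dom_le T) (len T) (x i%:Z).
  by rewrite ltnS leq_eqVlt => /predU1P[->|/ip//]; rewrite it.
split=> // i; rewrite leq_eqVlt => /predU1P[->|/it//].
rewrite -addn1 PoszD !iet_iterS //; last exact: piece_itv01 (ip' 0%N isT).
by rewrite it // (iet_map_translation wp wt); ring.
Qed.

Section Complexity.
Variables (T : iet R B) (z : R) (y : int -> B).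
Hypotheses (rT : regular T) (z01 : z \in `[0, 1[) (yP : coding T z y).

Let l := left_end (dom_le T) (len T).

(* v is read from T^-n (l b), where l b is a discontinuity, and b' follows v from the points
   slightly to the left of T^-n (l b). *)
Lemma right_special n b : l b != 0 -> exists v : n.-tuple B, exists2 b', l b' < l b &
  occurs y (rcons v b) /\ occurs y (rcons v b').
Proof.
move=> lb0; have dlb : disc T (l b) by split=> //; exists b.
have lb01 := disc_itv01 dlb.
pose p := iet_iter T (- n%:Z) (l b); have p01 : p \in `[0, 1[ by exact: iet_iter_itv01.
have [x xP] := coding_exists T p01.
have pn : iet_iter T n%:Z p = l b by rewrite iet_iterNK.
(* A left end met before time [n] would start a connection to [l b]; if it is 0, the connection
   starts at the discontinuity that is mapped to 0. *)
have [i ilt|e e0 he] := left_cylinder (k := n) p01 xP.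
  apply/eqP => ei.
  have reach : iet_iter T (n - i)%N%:Z (l (x i%:Z)) = l b.
    by rewrite -[l _]ei -iet_iterD // -PoszD subnK // ltnW.
  have [l0|l0] := eqVneq (l (x i%:Z)) 0; last first.
    apply: (@no_connection _ _ T (n - i).-1 (l (x i%:Z)) (l b)) => //.
      by split=> //; exists (x i%:Z).
    by rewrite prednK ?subn_gt0 // reach.
  have [d dd d0] := disc_to_0 rT B1.
  apply: (@no_connection _ _ T (n - i) d (l b)) => //.
  rewrite -addn1 PoszD iet_iterD ?(disc_itv01 dd) //.
  by rewrite [iet_iter T 1 d]d0 -l0 reach.
have lb_gt0 : 0 < l b by rewrite lt_neqAle eq_sym lb0 left_end_ge0 //; exact: len_gt0.
have [m1 m2] := ge_min2 e (l b).
pose t := Num.min e (l b) / 2.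
have t0 : 0 < t by rewrite divr_gt0 // lt_min e0.
have te : t < e by rewrite /t; lra.
have tl : t < l b by rewrite /t; lra.
have [|pt pieces] := he t; first by lra.
have lbt01 : l b - t \in `[0, 1[ by move: lb01; rewrite !in_itv /=; lra.
have pt01 : p - t \in `[0, 1[.
  case: (n) pieces pt pn => [_ _ /= -> //|k pieces _ _].
  exact: piece_itv01 (pieces 0%N isT).
have [x' x'P] := coding_exists T pt01.
have ptn : iet_iter T n%:Z (p - t) = l b - t by rewrite pt // pn.
have xx' : factor x' 0 n = factor x 0 n.
  by apply: eq_factor => i ik; rewrite !add0r; apply/x'P; exact: pieces.
have xb : x n%:Z = b by apply/xP; rewrite pn; exact: left_end_piece (dom_le_order T).
exists (Tuple (introT eqP (size_factor x 0 n))), (x' n%:Z).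
  have := coding_piece n%:Z x'P; rewrite ptn pieceE; last exact: dom_le_order.
  by rewrite -/(l _); lra.
have occ u x0 : u \in `[0, 1[ -> coding T u x0 -> occurs y (factor x0 0 n.+1).
  move=> u01 x0P; have [m mE] := coding_language rT B1 n.+1 z01 yP u01 x0P.
  by exists m; rewrite size_factor mE.
have := occ _ _ p01 xP; have := occ _ _ pt01 x'P.
by rewrite !factorSr !add0r xx' xb.
Qed.

(** Every word of length [n] is extended by its least possible letter (the set [F]), and the word
    [v b] by [b] for each [b != m] (the set [G]). The two sets are disjoint because [v b] also has
    an extension smaller than [b]. *)
Lemma card_words_step n : (#|words y n| + #|B|.-1 <= #|words y n.+1|)%N.
Proof.
have l_inj : injective l by apply: left_end_inj; exact: dom_le_order.
have [b0 _] : exists b : B, true by have /card_gt0P[b] := ltnW B1; exists b.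
have [m _ m_min] := total_order_min (P := predT) (a := b0) (dom_le_order T) isT.
have lm : l m = 0 by apply: left_end_min => [|b]; [exact: dom_le_order | exact: m_min].
have l_neq0 b : b != m -> l b != 0 by apply: contra => /eqP; rewrite -lm => /l_inj ->.
pose ext (w : n.-tuple B) : {set B} := [set b | [tuple of rcons w b] \in words y n.+1]%SET.
have inext (w : n.-tuple B) b : occurs y (rcons w b) -> b \in ext w.
  by move=> h; rewrite inE; apply/in_words.
have ext_neq0 w : w \in words y n -> exists b, b \in ext w.
  move=> /in_words[k]; rewrite size_tuple => e; exists (y (k + n%:Z)); apply: inext.
  by exists k; rewrite size_rcons size_tuple factorSr e.
have /choice[first firstP] : forall w, exists b, w \in words y n ->
    b \in ext w /\ forall c, c \in ext w -> l b <= l c.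
  move=> w; have [/ext_neq0[b bw]|_] := boolP (w \in words y n); last by exists m.
  have [c cw c_min] := @arg_minP _ R B b (mem (ext w)) l bw.
  by exists c => _; split.
have /choice[v vP] : forall b, exists v : n.-tuple B, b != m ->
    exists2 b', l b' < l b & b \in ext v /\ b' \in ext v.
  move=> b; have [->|/l_neq0/(right_special n)[v [b' lb [o1 o2]]]] := eqVneq b m.
    by exists (nseq_tuple n m).
  by exists v => _; exists b'; rewrite ?inext.
pose app (w : n.-tuple B) b := [tuple of rcons w b].
have app_inj w w' b b' : app w b = app w' b' -> w = w' /\ b = b'.
  by move=> /(congr1 val) /= /rcons_inj[/val_inj -> ->].
pose F := [set app w (first w) | w in words y n]%SET.
pose G := [set app (v b) b | b in [set~ m]]%SET.
have cF : #|F| = #|words y n| by apply: card_in_imset => w w' _ _ /app_inj[].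
have cG : #|G| = #|B|.-1.
  rewrite card_in_imset; first by rewrite cardsC1.
  by move=> b b' _ _ /app_inj[].
have dFG : F :&: G = finset.set0.
  apply/setP => t; rewrite !inE; apply/negP => /andP[/imsetP[w wy ->] /imsetP[b bm]].
  move=> /app_inj[ew eb]; rewrite !inE in bm.
  have [b' lb' [_ b'v]] := vP b bm; have [_ /(_ b')] := firstP w wy.
  by rewrite ew => /(_ b'v); rewrite -ew eb leNgt lb'.
rewrite -cF -cG -[leqLHS]subn0 -(cards0 (n.+1.-tuple B)) -dFG -cardsU.
apply: subset_leq_card; apply/fintype.subsetP => t; rewrite inE => /orP[] /imsetP.
  by move=> [w wy ->]; have [+ _] := firstP w wy; rewrite inE.
by move=> [b bm ->]; rewrite !inE in bm; have [b' _ []] := vP b bm; rewrite inE.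
Qed.

Lemma card_words n : (#|B|.-1 * n + 1 <= #|words y n|)%N.
Proof.
elim: n => [|n IH].
  rewrite muln0 add0n card_gt0; apply/set0Pn; exists [tuple]; apply/in_words.
  by exists 0.
by apply: leq_trans (card_words_step n); rewrite mulnS; lia.
Qed.

End Complexity.

Lemma riet_card_words (y : int -> B) n : riet_coding R y ->
  (#|B|.-1 * n + 1 <= #|words y n|)%N.
Proof. by move=> [T [z [rT z01 yP]]]; exact: card_words rT z01 yP n. Qed.

Lemma riet_language (T : iet R B) z y u x k : regular T -> z \in `[0, 1[ ->
  coding T z y -> u \in `[0, 1[ -> coding T u x -> occurs y (factor x 0 k).
Proof.
move=> rT z01 yP u01 xP; have [m mE] := coding_language rT B1 k z01 yP u01 xP.
by exists m; rewrite size_factor.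
Qed.

End RegularCodings.

Lemma riet_letters (R : realType) (A : finType) (x : int -> A) a :
  (1 < #|A|)%N -> riet_coding R x -> exists m, x m = a.
Proof.
move=> A1 [T [z [rT z01 xP]]].
have ap := left_end_piece T a (dom_le_order T).
have [x' x'P] := coding_exists T (piece_itv01 ap).
have [m] := riet_language A1 1 rT z01 xP (piece_itv01 ap) x'P.
rewrite !factor1 => -[mE]; exists m; rewrite mE.
by apply/x'P.
Qed.

(** * Regular rotations with prescribed factors *)

Section GenericPoints.
Variable R : realType.

Lemma avoid_sequence (f : nat -> R) l u : l < u ->
  exists2 t, l < t < u & forall n, t != f n.
Proof.
move=> lu; pose mid (I : R * R) := (I.1 + I.2) / 2.
(* Nested closed intervals, each missing one more value. The left one stops short of the midpoint,
   because [y] may be the midpoint. *)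
pose step (I : R * R) (y : R) := if y < mid I then (mid I, I.2) else (I.1, (I.1 + mid I) / 2).
(* Starting from the middle third keeps the limit strictly between [l] and [u]. *)
pose I := fix I n := if n is n'.+1 then step (I n') (f n') else ((2 * l + u) / 3, (l + 2 * u) / 3).
have I_lt n : (I n).1 < (I n).2.
  elim: n => [|n IH] /=; first by lra.
  by rewrite /step; case: ifP => _; rewrite /mid /=; lra.
have I_step n : (I n).1 <= (I n.+1).1 /\ (I n.+1).2 <= (I n).2.
  by have := I_lt n; rewrite /= /step; case: ifP => _; rewrite /mid /=; lra.
have I_mono n k : (I n).1 <= (I (n + k)%N).1 /\ (I (n + k)%N).2 <= (I n).2.
  elim: k => [|k]; first by rewrite addn0.
  by rewrite addnS; have := I_step (n + k)%N; lra.
have I_le n k : (I n).1 <= (I k).2.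
  have [h1 _] := I_mono n k; have [_ h2] := I_mono k n.
  by rewrite addnC in h2; have := I_lt (n + k)%N; lra.
pose P : set R := range (fun n => (I n).1).
have P_ub n : ubound P (I n).2 by move=> _ [k _ <-]; exact: I_le.
have supP : has_sup P by split; [exists (I 0%N).1; exists 0%N | exists (I 0%N).2].
have le_t n : (I n).1 <= sup P by apply: sup_upper_bound => //; exists n.
have t_le n : sup P <= (I n).2 by apply: sup_le_ub; [case: supP | exact: P_ub].
exists (sup P); first by have := le_t 0%N; have := t_le 0%N; rewrite /=; lra.
move=> n; apply/eqP => e; have := le_t n.+1; have := t_le n.+1; have := I_lt n.
rewrite /= /step -e /mid; case: ifP => [|/negbT]; rewrite -?leNgt /=; lra.
Qed.

Lemma avoid_countable (C : countType) (f : C -> R) l u : l < u ->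
  exists2 t, l < t < u & forall c, t != f c.
Proof.
move=> /(avoid_sequence (fun n => oapp f 0 (unpickle n)))[t lt_u nf].
by exists t => // c; have := nf (pickle c); rewrite pickleK.
Qed.

(** The value [b c] is chosen first, since it determines what the others must avoid: each further
    value misses the countable set of all [b j + p + q * b c] for the values already chosen. *)
Lemma generic_points (l u : nat -> R) c k : (forall i, l i < u i) -> exists b : nat -> R,
  [/\ forall i, (i <= k)%N -> l i < b i < u i, 
      forall p q : int, q != 0 -> q%:~R * b c != p%:~R &
      forall i j, (i <= k)%N -> (j <= k)%N -> i != j ->
        forall p q : int, b i - b j != p%:~R + q%:~R * b c].
Proof.
move=> lu.
have [bc bc_lu bc_irr] := avoid_countable (fun pq : int * int => pq.1%:~R / pq.2%:~R) (lu c).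
pose dom k i := (i < k)%N || (i == c).
suff: exists b, [/\ b c = bc, forall i, dom k.+1 i -> l i < b i < u i &
    forall i j, dom k.+1 i -> dom k.+1 j -> i != j ->
      forall p q : int, b i - b j != p%:~R + q%:~R * bc].
  move=> [b [bcE b_lu b_ind]]; exists b; split=> [i ik|p q q0|i j ik jk ij p q].
  - by apply: b_lu; rewrite /dom ltnS ik.
  - rewrite bcE; apply: contra (bc_irr (p, q)) => /eqP <- /=.
    by rewrite mulrC mulKf // intr_eq0.
  - by rewrite bcE; apply: b_ind; rewrite // /dom ltnS ?ik ?jk.
elim: k.+1 => [|n [b [bcE b_lu b_ind]]].
  exists (fun=> bc); split=> // [i /eqP -> //|i j /eqP -> /eqP ->].
  by rewrite eqxx.
have domS i : dom n.+1 i -> i != n -> dom n i.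
  by rewrite /dom ltnS leq_eqVlt => /orP[/orP[/eqP ->|->]|->]; rewrite ?eqxx ?orbT.
have [nc|nc] := eqVneq n c.
  have domE i : dom n.+1 i -> dom n i.
    by have [-> _|ni] := eqVneq i n; [rewrite /dom nc eqxx orbT | move/domS; apply].
  exists b; split=> // [i /domE|i j /domE di /domE dj]; [exact: b_lu | exact: b_ind].
have [t t_lu t_new] :=
  avoid_countable (fun d : nat * int * int => b d.1.1 + d.1.2%:~R + d.2%:~R * bc) (lu n).
exists (fun i => if i == n then t else b i); split.
- by rewrite eq_sym (negbTE nc).
- by move=> i di; case: eqP => [->//|/eqP ni]; apply/b_lu/domS.
move=> i j di dj ij p q; have [ei|ni] := eqVneq i n; have [ej|nj] := eqVneq j n.
- by rewrite ei ej eqxx in ij.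
- apply: contra (t_new (j, p, q)) => /eqP e /=; apply/eqP.
  by rewrite -addrA -e; ring.
- apply: contra (t_new (i, - p, - q)) => /eqP e /=; apply/eqP.
  by rewrite !mulrNz mulNr -addrA -opprD -e; ring.
- by apply: b_ind => //; exact: domS.
Qed.

End GenericPoints.

Section Rotations.
Variables (R : realType) (A : finType).

Definition seq_le (s : seq A) : rel A := fun a b => (index a s <= index b s)%N.

Lemma seq_le_order s : (forall a, a \in s) -> total_order (seq_le s).
Proof.
move=> full; split=> [a|a b ab|b a c|a b]; rewrite /seq_le.
- exact: leqnn.
- by apply: (index_inj a (full a) (full b)); apply/eqP; rewrite eqn_leq.
- exact: leq_trans.
- exact: leq_total.
Qed.

Lemma left_end_seq (s : seq A) (w : A -> R) a : uniq s -> (forall a, a \in s) ->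
  left_end (seq_le s) w a = \sum_(b <- take (index a s) s) w b.
Proof.
move=> us full; rewrite /left_end -big_filter; apply: perm_big.
apply: uniq_perm; rewrite ?filter_uniq ?index_enum_uniq ?take_uniq // => b.
rewrite mem_filter mem_index_enum andbT in_take // /seq_le ltn_neqAle andbC.
by congr (~~ _ && _); apply/eqP/eqP => [->//|]; exact: index_inj.
Qed.

Variables (s : seq A) (w : A -> R) (c : nat).
Hypotheses (us : uniq s) (full : forall a, a \in s).
Hypotheses (w_gt0 : forall a, 0 < w a) (w_sum : \sum_a w a = 1).

Lemma full_rot a : a \in rot c s. Proof. by rewrite mem_rot. Qed.

(** A cyclic shift of the order of the pieces makes the map a rotation of the circle; the cuts other
    than the one at [c] only separate labels. *)
Definition rotation : iet R A :=
  Iet (seq_le_order full) (seq_le_order full_rot) w_gt0 w_sum.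

Local Notation pt i := (\sum_(b <- take i s) w b).

Lemma rotation_dom_left a : left_end (dom_le rotation) (len rotation) a = pt (index a s).
Proof. exact: left_end_seq. Qed.

Let sum_s : \sum_(b <- s) w b = 1.
Proof.
rewrite -w_sum; apply: perm_big; apply: uniq_perm => //; first exact: index_enum_uniq.
by move=> a; rewrite full mem_index_enum.
Qed.

Lemma rotation_img_left a : left_end (img_le rotation) (len rotation) a =
  pt (index a s) + (1 - pt c) - (if (index a s < c)%N then 0 else 1).
Proof.
rewrite left_end_seq ?rot_uniq //; last exact: full_rot.
have := sum_s; rewrite -{1}(cat_take_drop c s) big_cat /= -/(pt c) => sumE.
rewrite /rot index_cat.
have := full a; rewrite -{1}(cat_take_drop c s) mem_cat.
have [ad|nad] := boolP (a \in drop c s).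
  have nat_ : a \notin take c s.
    move: us; rewrite -{1}(cat_take_drop c s) cat_uniq => /and3P[_ /hasPn/(_ a ad) //].
  move=> _.
  have ia : index a s = (minn c (size s) + index a (drop c s))%N.
    by rewrite -{1}(cat_take_drop c s) index_cat (negbTE nat_) size_take_min.
  have cs : (c < size s)%N.
    by rewrite ltnNge; apply: contraL ad => h; rewrite drop_oversize.
  rewrite (minn_idPl (ltnW cs)) in ia; rewrite ia ltnNge leq_addr /=.
  have -> : pt (c + index a (drop c s)) =
      pt c + \sum_(b <- take (index a (drop c s)) (drop c s)) w b.
    by rewrite takeD big_cat.
  rewrite take_cat index_mem ad; lra.
rewrite orbF => atk; have ia : index a s = index a (take c s).
  by rewrite -{1}(cat_take_drop c s) index_cat atk.
rewrite take_cat ltnNge leq_addr /= addKn big_cat /= ia.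
have lt_c : (index a (take c s) < c)%N.
  by apply: leq_trans (_ : size (take c s) <= c)%N; rewrite ?index_mem // size_take_min geq_minl.
rewrite lt_c take_takel ?(ltnW lt_c) // -/(pt _); lra.
Qed.

End Rotations.

(** Each step adds [1 - t] up to an integer and stays in [0, 1), so the iterate is a fractional
    part. *)
Lemma iet_iter_rotation (R : realType) (A : finType) (T : iet R A) (t : R) :
  (forall z, z \in `[0, 1[ -> iet_map T z = z + (1 - t) - (if z < t then 0 else 1)) ->
  forall n z, z \in `[0, 1[ ->
  iet_iter T n z = z + n%:~R * (1 - t) - (Num.floor (z + n%:~R * (1 - t)))%:~R.
Proof.
move=> mapT n z z01.
suff [m e] : exists m : int, iet_iter T n z = z + n%:~R * (1 - t) - m%:~R.
  have := iet_iter_itv01 T n z01; rewrite in_itv /= e => h.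
  by rewrite (@floor_def _ _ m) // intrD; lra.
elim/int_ind: n => [|n [m IH]|n [m IH]].
- by exists 0; rewrite /= mul0r subr0 addr0.
- have n01 := iet_iter_itv01 T n%:Z z01.
  rewrite -addn1 PoszD iet_iterS // mapT // IH.
  exists (m + (if z + n%:~R * (1 - t) - m%:~R < t then 0 else 1)).
  by rewrite !intrD /=; case: ifP => _ /=; ring.
- have n01 := iet_iter_itv01 T (- n.+1%:Z) z01.
  have := mapT _ n01; rewrite -iet_iterS //.
  have -> : - n.+1%:Z + 1 = - n%:Z by rewrite -addn1 PoszD opprD addrNK.
  rewrite IH => e.
  exists (m - (if iet_iter T (- n.+1%:Z) z < t then 0 else 1)).
  move: e; rewrite -[n.+1]addn1 PoszD opprD !intrD.
  by case: ifP => _ /= e; lra.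
Qed.

Section RotationBreakpoints.
Variables (R : realType) (A : finType) (s : seq A) (b : nat -> R) (c : nat).
Hypotheses (us : uniq s) (full : forall a, a \in s).
Hypotheses (b0 : b 0%N = 0) (b1 : b (size s) = 1).
Hypothesis b_lt : forall i, (i < size s)%N -> b i < b i.+1.
Hypothesis cs : (0 < c < size s)%N.
Hypothesis irr : forall p q : int, q != 0 -> q%:~R * b c != p%:~R.
Hypothesis indep : forall i j, (0 < i < size s)%N -> (0 < j < size s)%N -> i != j ->
  forall p q : int, b i - b j != p%:~R + q%:~R * b c.

Let w a := b (index a s).+1 - b (index a s).

Let ltn_index a : (index a s < size s)%N. Proof. by rewrite index_mem. Qed.

Let w_gt0 a : 0 < w a. Proof. by rewrite subr_gt0 b_lt. Qed.

Let sum_take i : (i <= size s)%N -> \sum_(a <- take i s) w a = b i.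
Proof.
elim: i => [|i IH] lt_i; first by rewrite take0 big_nil b0.
have [a0 _] : exists a0 : A, true by case: (s) lt_i => // a; exists a.
rewrite (take_nth a0) // -cats1 big_cat /= IH 1?ltnW // big_seq1 /w index_uniq //.
by rewrite addrC subrK.
Qed.

Let w_sum : \sum_a w a = 1.
Proof.
rewrite -b1 -(sum_take (leqnn _)) take_size; apply: perm_big; apply: uniq_perm => //.
  exact: index_enum_uniq.
by move=> a; rewrite full mem_index_enum.
Qed.

Let T := @rotation R A s w c full w_gt0 w_sum.

Let dom_left a : left_end (dom_le T) (len T) a = b (index a s).
Proof. by rewrite rotation_dom_left // sum_take // ltnW. Qed.

Let piece_index z a :
  (z \in piece (dom_le T) (len T) a) = (b (index a s) <= z < b (index a s).+1).
Proof. by rewrite pieceE; [rewrite dom_left /= /w addrC subrK | exact: dom_le_order]. Qed.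

Let b_mono i j : (i <= j)%N -> (j <= size s)%N -> b i <= b j.
Proof.
move=> /subnKC <-; elim: (j - i)%N => [|k IH]; first by rewrite addn0.
by rewrite addnS => h; apply: le_trans (IH (ltnW h)) (ltW (b_lt h)).
Qed.

Let map_rotation z : z \in `[0, 1[ ->
  iet_map T z = z + (1 - b c) - (if z < b c then 0 else 1).
Proof.
move=> /(letter_exists T)[a za]; rewrite (iet_mapE za) rotation_img_left // dom_left.
rewrite !sum_take ?(ltnW (ltn_index a)) //; last by case/andP: cs => _ /ltnW.
move: za; rewrite piece_index => /andP[l r].
have -> : (index a s < c)%N = (z < b c); last by case: ifP => _; lra.
have [ac|ca] := ltnP (index a s) c.
  apply/esym/(lt_le_trans r)/b_mono => //; by case/andP: cs => _ /ltnW.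
by apply/esym/negbTE; rewrite -leNgt; apply: le_trans l; exact/b_mono/ltnW.
Qed.

Let iter_rotation n z : z \in `[0, 1[ ->
  exists m : int, iet_iter T n z = z + n%:~R * (1 - b c) - m%:~R.
Proof. by move=> z01; eexists; exact: iet_iter_rotation map_rotation n z z01. Qed.

Let disc_index d : disc T d -> exists i, (0 < i < size s)%N /\ d = b i.
Proof.
move=> [d0 [a e]]; rewrite dom_left in e; exists (index a s); split=> //.
by rewrite ltn_index andbT lt0n; apply: contra d0 => /eqP i0; rewrite e i0 b0.
Qed.

(** A repetition in an orbit would make [b c] rational, and two cuts on a common orbit would differ
    by an element of Z + Z (b c). *)
Let rotation_regular : regular T.
Proof.
split=> [z dz|z z' dz dz' [_ [[n _ <-] [n' _ e]]]].
  have z01 := disc_itv01 dz => fin_orbit.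
  apply: infinite_nat.
  pose f (n : nat) := iet_iter T n%:Z z.
  have -> : [set: nat] = f @^-1` iet_orbit T z.
    by apply/seteqP; split=> // n _; exists n%:Z.
  apply: finite_preimage fin_orbit => n n' _ _.
  have [m e] := iter_rotation n%:Z z01; have [m' e'] := iter_rotation n'%:Z z01.
  rewrite /f e e' => enn; apply/eqP/negPn/negP => nn.
  have nn0 : n%:Z - n'%:Z != 0 by rewrite subr_eq0.
  have /eqP[] := irr (n%:Z - n'%:Z + m' - m) nn0.
  by rewrite !intrD !rmorphN /=; lra.
have [i [i_in zi]] := disc_index dz; have [j [j_in zj]] := disc_index dz'.
rewrite zi zj; congr b; apply/eqP/negPn/negP => ij.
have [m em] := iter_rotation n (disc_itv01 dz).
have [m' em'] := iter_rotation n' (disc_itv01 dz').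
have /eqP[] := indep i_in j_in ij (n' - n + m - m') (n - n').
by move: e; rewrite em em' zi zj !intrD !rmorphN /=; lra.
Qed.

Lemma rotation_exists : exists T : iet R A, [/\ regular T,
  forall z a, (z \in piece (dom_le T) (len T) a) = (b (index a s) <= z < b (index a s).+1) &
  forall z, z \in `[0, 1[ -> iet_map T z = z + (1 - b c) - (if z < b c then 0 else 1)].
Proof. by exists T; split=> [|z a|z z01]; [| exact: piece_index | exact: map_rotation]. Qed.

End RotationBreakpoints.

Section SourceCodings.
Variables (R : realType) (A : finType).

(** Regularity being generic, the inner cuts can be prescribed up to disjoint open intervals. *)
Lemma rotation_intervals (s : seq A) (l u : nat -> R) c :
  uniq s -> (forall a, a \in s) -> (0 < c < size s)%N ->
  (forall i, l i < u i) -> (forall i, u i <= l i.+1) -> 0 <= l 1%N -> (forall i, u i <= 1) ->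
  exists (T : iet R A) (b : nat -> R), [/\ regular T,
    [/\ b 0%N = 0, b (size s) = 1 & forall i, (0 < i < size s)%N -> l i < b i < u i],
    forall z a, (z \in piece (dom_le T) (len T) a) = (b (index a s) <= z < b (index a s).+1) &
    forall z, z \in `[0, 1[ -> iet_map T z = z + (1 - b c) - (if z < b c then 0 else 1)].
Proof.
move=> us full cs lu ul l1 u1.
have [b' [b'_lu irr indep]] := generic_points c (size s) lu.
pose b i := if i == 0%N then 0 else if (i < size s)%N then b' i else 1.
have bE i : (0 < i < size s)%N -> b i = b' i by rewrite /b; case: i => //= i ->.
have b0 : b 0%N = 0 by [].
have b1 : b (size s) = 1 by rewrite /b ltnn; case: (size s) cs => //; case: (c).
have b_lu i : (0 < i < size s)%N -> l i < b i < u i.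
  by move=> i_in; rewrite bE // b'_lu // ltnW //; case/andP: i_in.
have [|||T [rT pT mT]] := @rotation_exists R A s b c us full b0 b1 _ cs.
- move=> i i_s; have [->|i0] := posnP i.
    have [s1|s1] := ltnP 1 (size s); last by move: cs; lia.
    by rewrite b0; have := b_lu 1%N s1; lra.
  have /andP[_ lt_u] : l i < b i < u i by apply: b_lu; rewrite i0.
  have [lt_s|ge_s] := ltnP i.+1 (size s).
    by have := b_lu i.+1 lt_s; have := ul i; lra.
  have -> : i.+1 = size s by lia.
  by rewrite b1; have := u1 i; lra.
- by move=> p q q0; rewrite bE // irr.
- move=> i j i_in j_in ij p q; rewrite !bE //; apply: indep => //.
    by case/andP: i_in => _ /ltnW.
  by case/andP: j_in => _ /ltnW.
by exists T, b.
Qed.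

Hypothesis A1 : (1 < #|A|)%N.

(** Rotate by the small angle [1 - b 1], with [a] read on [0, b 1). After another letter the orbit
    re-enters below [1 - b 1], and it climbs too slowly to reach [b 1] within [N] steps. *)
Lemma riet_dominant (a : A) N : exists2 x : int -> A, riet_coding R x &
  forall m j, (j < N)%N -> x m != a -> x (m + j.+1%:Z) = a.
Proof.
pose s := a :: rem a (enum A).
have us : uniq s.
  by have u := enum_uniq A; rewrite /= mem_rem_uniq // rem_uniq // inE /= eqxx.
have full b : b \in s.
  by rewrite inE mem_rem_uniq ?enum_uniq // inE /= mem_enum; case: (b == a).
have sz : size s = #|A|.
  by rewrite /= size_rem ?mem_enum // -cardE prednK // ltnW.
have [e [e0 e1 eN]] : exists e : R, [/\ 0 < e, e <= 1 & N.+2%:R * e = 1].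
  exists N.+2%:R^-1; rewrite invr_gt0 ltr0n invf_le1 ?ltr0n // ler1n.
  by rewrite mulfV // pnatr_eq0.
(* All inner cuts, however many letters there are, are packed into the last [e / 2] before 1. *)
pose l i : R := 1 - e / i.+1%:R.
pose u i : R := 1 - e / i.+2%:R.
have lu i : l i < u i.
  by rewrite /l /u ltrD2l ltrN2 ltr_pM2l // ltf_pV2 ?posrE ?ltr0n // ltr_nat.
have l1 : 0 <= l 1%N by rewrite /l; lra.
have u1 i : u i <= 1 by rewrite /u gerBl divr_ge0 // ltW.
have [|T [b [rT [b0 b1 b_lu] pT mT]]] :=
  rotation_intervals (c := 1) us full _ lu (fun i => lexx _) l1 u1.
  by rewrite sz.
have /b_lu : (0 < 1 < size s)%N by rewrite sz.
rewrite /l /u => /andP[b1l b1u].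
have z01 : (0 : R) \in `[0, 1[ by rewrite in_itv /= lexx ltr01.
have [x xP] := coding_exists T z01; exists x; first by exists T, 0.
move=> m j jN xm.
have xa n : x n = a <-> iet_iter T n 0 < b 1%N.
  have n01 := iet_iter_itv01 T n z01; move: (n01); rewrite in_itv /= => /andP[n0 _].
  rewrite (xP n a) pT /= eqxx b0 n0 //.
have m01 := iet_iter_itv01 T m z01; move: (m01); rewrite in_itv /= => /andP[_ m1].
have bm : (iet_iter T m 0 < b 1%N) = false.
  by apply/negP => /xa /eqP; rewrite (negbTE xm).
have up i : iet_iter T (m + i.+1%:Z) 0 < i.+1%:R * (1 - b 1%N).
  elim: i => [|i IH]; first by rewrite iet_iterS // mT // bm mul1r; lra.
  have i01 := iet_iter_itv01 T (m + i.+1%:Z) z01.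
  rewrite -[i.+2]addn1 PoszD addrA iet_iterS // mT // natrD mulrDl mul1r.
  by case: ifP => _; lra.
apply/xa; apply: (lt_le_trans (up j)).
have : j.+1%:R * (1 - b 1%N) <= N%:R * (1 - b 1%N).
  by rewrite ler_wpM2r ?ler_nat //; lra.
have : N%:R * (1 - b 1%N) <= N%:R * (e / 2) by rewrite ler_wpM2l //; lra.
by move: eN; rewrite -addn2 natrD mulrDl; lra.
Qed.

Lemma riet_pair (T : iet R A) z x a b t : regular T -> z \in `[0, 1[ -> coding T z x ->
  t \in piece (dom_le T) (len T) a -> iet_map T t \in piece (dom_le T) (len T) b ->
  occurs x [:: a; b].
Proof.
move=> rT z01 xP ta tb; have t01 := piece_itv01 ta.
have [x' x'P] := coding_exists T t01.
have := riet_language A1 2 rT z01 xP t01 x'P.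
have -> : factor x' 0 2 = [:: a; b]; last by [].
by rewrite !factorS /=; congr [:: _; _]; apply/x'P.
Qed.

(** The letters other than [u], [v], [w] are squeezed into the end of [0, 1), so that a letter set
    of any size behaves like three pieces. The rotation is cut between [v] and [w]. *)
Lemma rotation_three (u v w : A) (lo1 hi1 lo2 hi2 : R) : uniq [:: u; v; w] ->
  0 < lo1 < hi1 -> hi1 <= lo2 < hi2 -> hi2 <= 19 / 20 ->
  exists (T : iet R A) (b1 b2 b3 : R), regular T /\
  [/\ lo1 < b1 < hi1, lo2 < b2 < hi2 & 19 / 20 < b3 <= 1] /\
  [/\ forall z, (z \in piece (dom_le T) (len T) u) = (0 <= z < b1),
      forall z, (z \in piece (dom_le T) (len T) v) = (b1 <= z < b2),
      forall z, (z \in piece (dom_le T) (len T) w) = (b2 <= z < b3),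
      forall z, 0 <= z < b2 -> iet_map T z = z + (1 - b2) &
      forall z, b2 <= z < 1 -> iet_map T z = z - b2].
Proof.
move=> uvw h1 h2 h3.
pose s := [:: u; v; w] ++ [seq a <- enum A | a \notin [:: u; v; w]].
have us : uniq s.
  rewrite cat_uniq uvw filter_uniq ?enum_uniq // andbT /=.
  by apply/hasPn => a; rewrite mem_filter => /andP[].
have full a : a \in s by rewrite mem_cat mem_filter mem_enum andbT orbN.
have sz : (2 < size s)%N by [].
have iu : index u s = 0%N by rewrite /= eqxx.
have [iv iw] : index v s = 1%N /\ index w s = 2%N.
  move: uvw; rewrite /= !inE !negb_or => /andP[/andP[uv uw] /andP[vw _]].
  by rewrite (negbTE uv) (negbTE uw) (negbTE vw) !eqxx.
pose tail (i : nat) : R := 1 - 1 / 100 / i%:R.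
pose lo i := if i is j.+3 then tail i else nth 0 [:: 0; lo1; lo2] i.
pose hi i := if i is j.+3 then tail i.+1 else nth 0 [:: lo1; hi1; hi2] i.
have tail_lt i : (0 < i)%N -> tail i < tail i.+1.
  move=> i0; rewrite /tail ltrD2l ltrN2 ltr_pM2l; last by lra.
  by rewrite ltf_pV2 ?posrE ?ltr0n // ltr_nat.
have tail1 i : tail i <= 1 by rewrite /tail gerBl divr_ge0 //; lra.
have tail3 : tail 3%N > 19 / 20 by rewrite /tail; lra.
have [|i|i||i|T [b [rT [b0 b1 b_lu] pT mT]]] :=
  rotation_intervals (l := lo) (u := hi) (c := 2) us full.
- by rewrite sz.
- by case: i => [|[|[|i]]] /=; try lra; exact: tail_lt.
- by case: i => [|[|[|i]]] /=; lra.
- by rewrite /=; lra.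
- by case: i => [|[|[|i]]] /=; try lra; exact: tail1.
have b_1 := b_lu 1%N (ltnW sz); have b_2 := b_lu 2%N sz.
have b_3 : 19 / 20 < b 3%N <= 1.
  have [s3|s3] := ltnP 3 (size s).
    have /andP[l3 r3] := b_lu 3%N s3; have := tail1 4%N.
    by move: l3 r3 => /=; lra.
  have -> : b 3%N = 1 by rewrite -b1; congr b; apply/eqP; rewrite eqn_leq sz.
  by lra.
exists T, (b 1%N), (b 2%N), (b 3%N); do 2!split=> //; last split=> z.
- by rewrite pT iu b0.
- by rewrite pT iv.
- by rewrite pT iw.
- by move=> h; rewrite mT ?in_itv /=; [case/andP: h => _ ->; rewrite subr0 | move: b_2 => /=; lra].
- move=> h; rewrite mT ?in_itv /=; last by move: b_1 b_2 => /=; lra.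
  by rewrite ltNge; case/andP: h => -> _ /=; ring.
Qed.

(* Pieces u, v, w of lengths about .3, .3, .4 are rotated by about .4. *)
Lemma riet_pairs1 (u v w : A) : uniq [:: u; v; w] -> exists x : int -> A,
  riet_coding R x /\
  forall p, p \in [:: (w, u); (w, v); (u, v); (u, w); (v, w)] -> occurs x [:: p.1; p.2].
Proof.
move=> uvw.
have [||| T [b1 [b2 [b3 [rT [[h1 h2 h3] [pu pv pw mL mR]]]]]]] :=
  @rotation_three u v w (29 / 100) (31 / 100) (59 / 100) (61 / 100) uvw; try lra.
have z01 : (0 : R) \in `[0, 1[ by rewrite in_itv /= lexx ltr01.
have [x xP] := coding_exists T z01; exists x; split; first by exists T, 0.
have occ t p q : t \in piece (dom_le T) (len T) p ->
    iet_map T t \in piece (dom_le T) (len T) q -> occurs x [:: p; q].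
  exact: riet_pair rT z01 xP.
move=> p; rewrite !inE => /or4P[/eqP ->|/eqP ->|/eqP ->|/orP[/eqP ->|/eqP ->]].
(* Each test point is the left end of a piece or is mapped to one. *)
- by apply: (occ b2); rewrite ?mR ?pu ?pw; lra.
- by apply: (occ (b1 + b2)); rewrite ?mR ?pv ?pw; lra.
- by apply: (occ 0); rewrite ?mL ?pu ?pv; lra.
- by apply: (occ (b2 - (1 - b2))); rewrite ?mL ?pu ?pw; lra.
- by apply: (occ b1); rewrite ?mL ?pv ?pw; lra.
Qed.

(* Pieces u, v, w of lengths about .4, .4, .2 are rotated by about .2. *)
Lemma riet_pairs2 (u v w : A) : uniq [:: u; v; w] -> exists x : int -> A,
  riet_coding R x /\
  forall p, p \in [:: (w, u); (u, u); (u, v); (v, v); (v, w)] -> occurs x [:: p.1; p.2].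
Proof.
move=> uvw.
have [||| T [b1 [b2 [b3 [rT [[h1 h2 h3] [pu pv pw mL mR]]]]]]] :=
  @rotation_three u v w (39 / 100) (41 / 100) (79 / 100) (81 / 100) uvw; try lra.
have z01 : (0 : R) \in `[0, 1[ by rewrite in_itv /= lexx ltr01.
have [x xP] := coding_exists T z01; exists x; split; first by exists T, 0.
have occ t p q : t \in piece (dom_le T) (len T) p ->
    iet_map T t \in piece (dom_le T) (len T) q -> occurs x [:: p; q].
  exact: riet_pair rT z01 xP.
move=> p; rewrite !inE => /or4P[/eqP ->|/eqP ->|/eqP ->|/orP[/eqP ->|/eqP ->]].
- by apply: (occ b2); rewrite ?mR ?pu ?pw; lra.
- by apply: (occ 0); rewrite ?mL ?pu; lra.
- by apply: (occ (b1 - (1 - b2))); rewrite ?mL ?pu ?pv; lra.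
- by apply: (occ b1); rewrite ?mL ?pv; lra.
- by apply: (occ (b2 - (1 - b2))); rewrite ?mL ?pv ?pw; lra.
Qed.

End SourceCodings.

(** * Conjugates and images of codings *)

Section Conjugation.
Variables (A B : finType).
Implicit Types (s : seq A -> seq B).

Lemma morphism_conj s s0 p : morphism s -> morphism s0 ->
  (forall a, s [:: a] ++ p = p ++ s0 [:: a]) -> forall w, s w ++ p = p ++ s0 w.
Proof.
move=> hs hs0 conj; elim=> [|a w IH]; first by rewrite (morph_nil hs) (morph_nil hs0) cats0.
by rewrite (morph_cons hs) (morph_cons hs0) -catA IH !catA conj.
Qed.

(** In [y], every block start is preceded by [p]: since [s w ++ p = p ++ s0 w], the word [p] ends
    [s0 w] as soon as [s0 w] is at least as long, which non-erasure ensures for [size p] letters.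
    Moving the start back by [size p] then turns the blocks of [s0] into those of [s]. *)
Lemma word_image_conj s s0 p x y : morphism s -> morphism s0 -> nonerasing s ->
  (forall a, s [:: a] ++ p = p ++ s0 [:: a]) ->
  word_image s0 x y -> word_image s x (fun k => y (k - (size p)%:Z)).
Proof.
move=> hs hs0 sne conj yP.
have conjw := morphism_conj hs hs0 conj.
have sz w : size (s w) = size (s0 w).
  by have := congr1 size (conjw w); rewrite !size_cat addnC => /addnI.
apply: (@word_imageP _ _ _ _ _ (block_start s0 x)) => [|n|n].
- exact: block_start0.
- by rewrite block_startS sz.
rewrite factor_shift; set w := factor x (n - (size p)%:Z) (size p).
have p_w : (size p <= size (s0 w))%N.
  by rewrite -sz -{1}(size_factor x (n - (size p)%:Z) (size p)) leq_size_morph.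
have start_n : block_start s0 x n =
    block_start s0 x (n - (size p)%:Z) + (size (s0 w))%:Z.
  by rewrite -(block_startD hs0) subrK.
have suffix : factor y (block_start s0 x n - (size p)%:Z) (size p) = p.
  have := congr1 (drop (size (s w))) (conjw w).
  rewrite drop_size_cat // sz drop_cat ltnNge p_w /= => e.
  rewrite [RHS]e -(factor_word_image hs0 (n - (size p)%:Z) (size p) yP) -/w.
  rewrite size_factor drop_factor ?leq_subr // subKn //.
  by rewrite start_n -subzn // addrA.
have e : factor y (block_start s0 x n - (size p)%:Z) (size p + size (s0 [:: x n])) =
    s [:: x n] ++ p.
  by rewrite factorD suffix subrK conj; congr (_ ++ _); exact: yP.
have := congr1 (take (size (s [:: x n]))) e.
by rewrite take_size_cat // take_factor // sz leq_addl.
Qed.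

Lemma preserves_conj (R : realType) s s0 p : morphism s -> morphism s0 -> nonerasing s ->
  (forall a, s [:: a] ++ p = p ++ s0 [:: a]) ->
  preserves_riet_codings R s -> preserves_riet_codings R s0.
Proof.
move=> hs hs0 sne conj pres x xP y yP.
have := riet_coding_shift (size p)%:Z (pres x xP _ (word_image_conj hs hs0 sne conj yP)).
by congr riet_coding; apply/funext => n; rewrite addrK.
Qed.

(** While all images start with the same letter, that letter is moved to their ends. This brings the
    first difference between [s [:: a; b]] and [s [:: b; a]] one position closer to the beginning,
    so the process stops. *)
Lemma left_conjugate s : morphism s -> nonerasing s ->
  (exists a b, s [:: a; b] <> s [:: b; a]) ->
  exists p s0 f, [/\ morphism s0, nonerasing s0,
    forall a, s [:: a] ++ p = p ++ s0 [:: a],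
    forall a, ohead (s0 [:: a]) = Some (f a) & exists a b, f a <> f b].
Proof.
move=> hs sne [a [b nab]].
have {nab}: take (size (s [:: a; b])) (s [:: a; b]) <> take (size (s [:: a; b])) (s [:: b; a]).
  by rewrite take_size take_oversize // !(morph_pair hs) !size_cat addnC.
move: (size _) => n; elim: n s hs sne => [|n IH] s hs sne nab; first by rewrite !take0 in nab.
have hd c : exists d, ohead (s [:: c]) = Some d.
  by case: (s [:: c]) (sne c) => // d w _; exists d.
have /choice[f fP] := hd.
have [nconst|const] := pselect (exists a b, f a <> f b).
  by exists [::], s, f; split=> // c; rewrite cats0.
set t := f a; have ft c : f c = t.
  by apply: contrapT => nct; apply: const; exists c, a.
pose s' (u : seq A) := flatten [seq rcons (behead (s [:: c])) t | c <- u].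
have s'1 c : s' [:: c] = rcons (behead (s [:: c])) t by rewrite /s' /= cats0.
have st c : s [:: c] = t :: behead (s [:: c]).
  by have := fP c; rewrite ft; case: (s [:: c]) => //= d w [->].
have hs' : morphism s'.
  split=> // [u v|d]; first by rewrite /s' map_cat flatten_cat.
  have [_ _ /(_ d)[c dc]] := hs; exists c.
  by rewrite s'1 mem_rcons -st.
have s'ne : nonerasing s' by move=> c; rewrite s'1; case: behead.
have conj1 c : s [:: c] ++ [:: t] = [:: t] ++ s' [:: c] by rewrite s'1 st /= cats1.
have conjw := morphism_conj hs hs' conj1.
have [|p [s0 [f0 [hs0 s0ne conj0 f0P nconst0]]]] := IH s' hs' s'ne.
  move=> e; apply: nab.
  have sz : size (s [:: a; b]) = size (s [:: b; a]).
    by rewrite !(morph_pair hs) !size_cat addnC.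
  have e1 : take n.+1 (s [:: a; b] ++ [:: t]) = take n.+1 (s [:: b; a] ++ [:: t]).
    by rewrite !conjw /= e.
  have := congr1 (take (size (s [:: a; b]))) e1.
  by rewrite -!take_min minnC !take_min take_size_cat // sz take_size_cat.
exists (t :: p), s0, f0; split=> // c.
by rewrite -cat_rcons -cats1 conj1 -catA conj0.
Qed.

(** [left_conjugate] for the mirror morphism [r]. *)
Lemma right_conjugate s : morphism s -> nonerasing s ->
  (exists a b, s [:: a; b] <> s [:: b; a]) ->
  exists q v (g : A -> B), (forall a, q ++ s [:: a] = rcons (v a) (g a) ++ q) /\
    exists a b, g a <> g b.
Proof.
move=> hs sne [a [b nab]]; pose r u := rev (s (rev u)).
have hr : morphism r.
  split=> [|u v|d]; first by rewrite /r (morph_nil hs).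
    by rewrite /r rev_cat (morph_cat hs) rev_cat.
  by have [_ _ /(_ d)[c dc]] := hs; exists c; rewrite mem_rev.
have rne : nonerasing r by move=> c; rewrite -size_eq0 size_rev size_eq0 sne.
have [|p [s0 [f [_ _ conj fP nconst]]]] := left_conjugate hr rne.
  by exists b, a => /(inv_inj revK).
exists (rev p), (fun c => rev (behead (s0 [:: c]))), f; split=> // c.
apply: (inv_inj revK); rewrite !rev_cat rev_rcons !revK.
rewrite -[rev (s _)]/(r [:: c]) conj; congr (_ ++ _).
by have := fP c; case: (s0 [:: c]) => //= d w [->].
Qed.

End Conjugation.

Section ImageCounting.
Variables (R : realType) (A B : finType).
Hypotheses (A1 : (1 < #|A|)%N) (B1 : (1 < #|B|)%N).
Variable s : seq A -> seq B.
Hypotheses (hs : morphism s) (sne : nonerasing s) (pres : preserves_riet_codings R s).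

Lemma factor_image x y j k o n : word_image s x y ->
  (o + n <= size (s (factor x j k)))%N ->
  factor y (block_start s x j + o%:Z) n = take n (drop o (s (factor x j k))).
Proof.
move=> yP le; have o_le : (o <= size (s (factor x j k)))%N by lia.
rewrite -[in RHS](factor_word_image hs j k yP) drop_factor // take_factor //.
by rewrite leq_subRL.
Qed.

(** If the images commuted, the image of a coding would have period [size u], hence at most [size u]
    factors of that length, one fewer than the complexity bound requires. *)
Lemma preserves_not_commutative : exists a b, s [:: a; b] <> s [:: b; a].
Proof.
apply: contrapT => com.
have [a0 _] : exists a : A, true by have /card_gt0P[a] := ltnW A1; exists a.
have [x xP _] := riet_dominant R A1 a0 0.
have [y yP] := word_image_exists x sne.
set u := s [:: a0].
have u0 : (0 < size u)%N by rewrite lt0n size_eq0; exact: sne.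
have comw w : s w ++ u = u ++ s w.
  elim: w => [|b w IH]; first by rewrite (morph_nil hs) cats0.
  rewrite (morph_cons hs) -catA IH !catA; congr (_ ++ _).
  rewrite -!(morph_cat hs) /=; apply: contrapT => e; apply: com; by exists b, a0.
have per m : y (m + (size u)%:Z) = y m.
  have [j /andP[l r]] := block_exists x sne m.
  (* By non-erasure this window is long enough for its image to reach beyond [o + size u]. *)
  pose w := factor x j (size (s [:: x j]) + size u).
  pose o := absz (m - block_start s x j).
  have mE : m = block_start s x j + o%:Z by rewrite /o gez0_abs ?subr_ge0 //; lia.
  have o_lt : (o < size (s [:: x j]))%N.
    by move: r; rewrite block_startS mE; lia.
  have sz : (o + size u < size (s w))%N.
    apply: leq_trans (leq_size_morph hs w sne); rewrite size_factor; lia.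
  have b0 := y 0.
  have yo i : (i < size (s w))%N -> y (block_start s x j + i%:Z) = nth b0 (s w) i.
    by move=> i_lt; rewrite -(factor_word_image hs j _ yP) nth_factor.
  rewrite mE -addrA -PoszD !yo //; last by lia.
  have := congr1 (fun v => nth b0 v (o + size u)) (comw w).
  by rewrite !nth_cat sz ltnNge leq_addl /= addnK.
have perM m (q : int) : y (m + q * (size u)%:Z) = y m.
  elim/int_ind: q => [|q IH|q IH]; first by rewrite mul0r addr0.
    by rewrite -addn1 PoszD mulrDl mul1r addrA per.
  by rewrite -per -addn1 PoszD opprD mulrDl mulN1r addrA subrK.
pose S := [seq factor y i%:Z (size u) | i <- iota 0 (size u)].
have inS m : factor y m (size u) \in S.
  apply/mapP; have u0' : (size u)%:Z != 0 by lia.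
  exists (absz (m %% (size u)%:Z)%Z).
    by rewrite mem_iota /= add0n -ltz_nat gez0_abs ?modz_ge0 // ltz_pmod.
  rewrite gez0_abs ?modz_ge0 //; apply: eq_factor => i _.
  rewrite -[RHS](perM _ (m %/ (size u)%:Z)%Z); congr y.
  by have := divz_eq m (size u)%:Z; lia.
have := card_words_leq inS; rewrite size_map size_iota.
have := riet_card_words B1 (size u) (pres xP yP).
have : (size u <= #|B|.-1 * size u)%N by rewrite leq_pmull //; lia.
lia.
Qed.

(* Take a coding in which the letters other than a0 are isolated: a factor of length n of its
   image meets at most one block of such a letter, so it is determined by that letter and the
   position of the block, up to boundedly many exceptions. *)
Lemma preserves_card : (#|B| <= #|A|)%N.
Proof.
have [a0 _] : exists a : A, true by have /card_gt0P[a] := ltnW A1; exists a.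
(* The list [S] below has [C + (#|A| - 1) * n] entries. With [n = C] this is [#|A| * n], and
   comparison with [(#|B| - 1) * n + 1] gives the claim. *)
pose C := (\sum_a size (s [:: a]))%N; pose n := C.
have [x xP dom] := riet_dominant R A1 a0 n.*2.+2.
have [y yP] := word_image_exists x sne.
set u := s [:: a0]; have u0 : (0 < size u)%N by rewrite lt0n size_eq0; exact: sne.
pose pure k := nseq k a0.
have s_pure k : size (s (pure k)) = (k * size u)%N.
  elim: k => [|k IH]; first by rewrite (morph_nil hs).
  by rewrite /pure /= (morph_cons hs) size_cat IH mulSn.
pose W a := pure n ++ a :: pure n.
pose S1 := [seq take n (drop o (s (pure n.+1))) | o <- iota 0 (size u)].
(* The factors that start inside the block of [a] or at most [n] letters before it. *)
pose S2 a := [seq take n (drop (n * size u - n + o) (s (W a))) |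
  o <- iota 0 (n + size (s [:: a]))].
pose S := S1 ++ flatten [seq S2 a | a <- enum (predC1 a0)].
have C_E : C = (size u + \sum_(a | a != a0) size (s [:: a]))%N by rewrite /C (bigD1 a0).
have n0 : (0 < n)%N by rewrite /n C_E; lia.
have nu : (n <= n * size u)%N by rewrite leq_pmulr.
have pure_factor m k : (forall i, (i < k)%N -> x (m + i%:Z) = a0) -> factor x m k = pure k.
  exact: factor_const.
have inS m : factor y m n \in S.
  have [j /andP[l r]] := block_exists x sne m.
  pose o := absz (m - block_start s x j).
  have mE : m = block_start s x j + o%:Z by rewrite /o gez0_abs ?subr_ge0 //; lia.
  have o_lt : (o < size (s [:: x j]))%N by move: r; rewrite block_startS mE; lia.
  (* The search for the first letter other than [a0] is capped at [n.+1], because [n.+1] blocks of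
     [a0] already cover the factor. *)
  pose good i := (x (j + i%:Z) != a0) || (i == n.+1).
  have ex : exists i, good i by exists n.+1; rewrite /good eqxx orbT.
  have [i gi i_min] := ex_minnP ex.
  have i_le : (i <= n.+1)%N by apply: i_min; rewrite /good eqxx orbT.
  have x_pure k : (k < i)%N -> x (j + k%:Z) = a0.
    move=> ki; apply/eqP/negPn/negP => xk; have := i_min k; rewrite /good xk => /(_ isT).
    by rewrite leqNgt ki.
  have pre_i : factor x j i = pure i by exact: pure_factor.
  have o_u : (0 < i)%N -> (o < size u)%N.
    by move=> /x_pure; rewrite addr0 => xj; rewrite /u -xj.
  rewrite mem_cat; apply/orP.
  have [in_pure|not_pure] := leqP (o + n) (i * size u).
    have i0 : (0 < i)%N by case: (i) in_pure => //; lia.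
    left; apply/mapP; exists o; first by rewrite mem_iota /= add0n o_u.
    rewrite mE (factor_image (k := i)) // ?pre_i ?s_pure //.
    rewrite -(subnKC i_le) /pure nseqD (morph_cat hs) -!/(pure _).
    rewrite drop_cat s_pure (_ : (o < i * size u)%N); last by lia.
    by rewrite takel_cat // size_drop s_pure; lia.
  have xi : x (j + i%:Z) != a0.
    case/orP: gi => // /eqP ei; have o_u' : (o < size u)%N by apply: o_u; rewrite ei.
    by move: not_pure; rewrite ei mulSn; lia.
  set a := x (j + i%:Z) in xi.
  right; apply/flattenP; exists (S2 a).
    by apply: map_f; rewrite mem_enum.
  have WE : factor x (j + i%:Z - n%:Z) (n + n.+1) = W a.
    rewrite factorD subrK factorS -/a; congr (_ ++ _ :: _); apply: pure_factor => k kn.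
      apply: contrapT => /eqP xk; move/eqP: xi; apply.
      have := dom (j + i%:Z - n%:Z + k%:Z) (n - k.+1)%N _ xk.
      rewrite (_ : _ + _ = j + i%:Z); last by lia.
      by apply; lia.
    by rewrite -addrA -PoszD add1n dom //; lia.
  have sW : size (s (W a)) = (n * size u + (size (s [:: a]) + n * size u))%N.
    by rewrite /W (morph_cat hs) (morph_cons hs) !size_cat s_pure.
  have bJ := block_startD hs x j i; rewrite pre_i s_pure in bJ.
  have bJ' := block_startD hs x (j + i%:Z - n%:Z) n.
  rewrite subrK bJ (_ : factor _ _ _ = pure n) in bJ'; last first.
    have := congr1 (take n) WE.
    by rewrite take_factor ?leq_addr // /W takel_cat ?size_nseq // take_oversize ?size_nseq.
  rewrite s_pure in bJ'.
  have o'_lt : (o + n - i * size u < n + size (s [:: a]))%N.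
    have [i0|i0] := posnP i; last by have := o_u i0; have := leq_pmull (size u) i0; lia.
    by move: o_lt; rewrite /a i0 addr0; lia.
  apply/mapP; exists (o + n - i * size u)%N; first by rewrite mem_iota /= add0n.
  rewrite -WE -(factor_image (y := y)) //; last by rewrite WE sW; lia.
  by congr factor; rewrite mE; lia.
have := card_words_leq inS; rewrite size_cat size_flatten /shape -map_comp.
rewrite size_map size_iota sumnE big_map big_enum /=.
rewrite (eq_bigr (fun a => n + size (s [:: a]))%N); last first.
  by move=> a _; rewrite size_map size_iota.
rewrite big_split /= sum_nat_const cardC1 addnCA -C_E -/n => le1.
have := leq_trans (riet_card_words B1 n (pres xP yP)) le1.
rewrite addn1 addnC -mulSn prednK ?(ltnW A1) // ltn_pmul2r //.
by rewrite -[X in _ -> (X <= _)%N](ltn_predK B1).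
Qed.

End ImageCounting.

(** * Source alphabets of at least three letters *)

(** Once [a] and [a'] are ordered, the two crossed pairs of extensions put [b] both before and after
    [b']. *)
Lemma ordered_no_cycle (B : eqType) (y : int -> B) h k w a a' b b' :
  ordered_extensions y h k -> a <> a' -> b <> b' ->
  occurs y (a :: rcons w b) -> occurs y (a :: rcons w b') ->
  occurs y (a' :: rcons w b) -> occurs y (a' :: rcons w b') -> False.
Proof.
move=> [h_inj k_inj mono] naa nbb ab ab' a'b a'b'.
have nh : h a <> h a' by move/h_inj.
have nk : k b <> k b' by move/k_inj.
have := mono _ _ _ _ _ ab a'b'; have := mono _ _ _ _ _ ab' a'b.
have := mono _ _ _ _ _ a'b ab'; have := mono _ _ _ _ _ a'b' ab.
lia.
Qed.

Lemma third_letter (A : finType) (u v : A) : (2 < #|A|)%N -> exists2 w, w != u & w != v.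
Proof.
move=> A2; have /card_gt0P[w] : (0 < #|predC (pred2 u v)|)%N.
  rewrite -(ltn_add2l #|pred2 u v|) cardC addn0 card2.
  by apply: leq_trans A2; case: (u != v).
by rewrite !inE negb_or => /andP[wu wv]; exists w.
Qed.

Lemma uniq3 (A : eqType) (u v w : A) : uniq [:: u; v; w] = [&& u != v, u != w & v != w].
Proof. by rewrite /= !inE negb_or andbT andbA. Qed.

(** Without such a triple, [g] takes equal values on two letters that [f] identifies and on every
    letter that [f] separates from them, so it is constant. The two alternatives correspond to the
    two source codings [riet_pairs1] and [riet_pairs2]. *)
Lemma splitting_triple (A B : eqType) (f g : A -> B) (b1 b2 : A) :
  b1 <> b2 -> f b1 = f b2 -> (exists a b, f a <> f b) -> (exists a b, g a <> g b) ->
  exists b b' c, [/\ uniq [:: b; b'; c], f b = f b', f c <> f b &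
    g b <> g b' \/ g b = g b' /\ g b <> g c].
Proof.
move=> n12 f12 nf [a [a' ng]]; apply: contrapT => none; apply: ng.
have same b b' c : b <> b' -> f b = f b' -> f c <> f b -> g b = g b' /\ g b = g c.
  move=> nbb fbb fc; have ubc : uniq [:: b; b'; c].
    rewrite uniq3; apply/and3P; split; apply/eqP => // e.
      by apply: fc; rewrite e.
    by apply: fc; rewrite -e.
  have [gb|ngb] := pselect (g b = g b'); last first.
    by exfalso; apply: none; exists b, b', c; split=> //; left.
  have [gc|ngc] := pselect (g b = g c); first by split.
  by exfalso; apply: none; exists b, b', c; split=> //; right.
have [c fc] : exists c, f c <> f b1.
  apply: contrapT => fconst; case: nf => d [d' []].
  have eq1 e : f e = f b1 by apply: contrapT => ne; apply: fconst; exists e.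
  by rewrite !eq1.
suff g1 e : g e = g b1 by rewrite !g1.
have [fe|fe] := pselect (f e = f b1); last by have [_ ->] := same b1 b2 e n12 f12 fe.
have [->//|/eqP ne] := eqVneq e b1.
by have [] := same e b1 c ne fe; rewrite ?fe.
Qed.

Section ThreeLetters.
Variables (R : realType) (A B : finType).
Hypotheses (A2 : (2 < #|A|)%N) (B1 : (1 < #|B|)%N).

Let A1 : (1 < #|A|)%N. Proof. exact: ltnW. Qed.

Section LeftNormalized.
Variables (s : seq A -> seq B) (f g : A -> B) (q : seq B) (v : A -> seq B).
Hypotheses (hs : morphism s) (sne : nonerasing s) (pres : preserves_riet_codings R s).
Hypothesis sf : forall a, ohead (s [:: a]) = Some (f a).
Hypothesis sg : forall a, q ++ s [:: a] = rcons (v a) (g a) ++ q.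
Hypotheses (nf : exists a b, f a <> f b) (ng : exists a b, g a <> g b).

Let s_head a : s [:: a] = f a :: behead (s [:: a]).
Proof. by have := sf a; case: (s [:: a]) => //= d w [->]. Qed.

(** Iterating [sg] gives [q ++ s w = V ++ q], so [q] ends [s w] when [w] has [size q] letters. Then
    [q ++ s [:: a]] ends with [g a] followed by [q], and [s [:: b]] starts with [f b]. *)
Lemma image_extension x y a b : word_image s x y -> occurs x [:: a; b] ->
  occurs y (g a :: rcons q (f b)).
Proof.
move=> yP [m]; rewrite !factorS /= => -[xa xb].
have suffix w : exists V, q ++ s w = V ++ q.
  elim/last_ind: w => [|w c [V IH]]; first by exists [::]; rewrite (morph_nil hs) cats0.
  by exists (V ++ rcons (v c) (g c)); rewrite (morph_rcons hs) catA IH -catA sg catA.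
pose w := factor x (m - (size q)%:Z) (size q); have [V VE] := suffix w.
have q_V : (size q <= size V)%N.
  have := congr1 size VE; rewrite !size_cat addnC => /addIn <-.
  by rewrite -{1}(size_factor x (m - (size q)%:Z) (size q)) leq_size_morph.
have Vq : V = q ++ drop (size q) V.
  rewrite -{1}(cat_take_drop (size q) V); congr (_ ++ _).
  by have := congr1 (take (size q)) VE; rewrite take_size_cat // takel_cat // => <-.
have swE : s w = drop (size q) V ++ q.
  have := congr1 (drop (size q)) VE; rewrite drop_size_cat // {1}Vq -catA.
  by rewrite drop_size_cat.
have := occurs_image hs yP (w := w ++ [:: a; b]).
have -> : s (w ++ [:: a; b]) = (drop (size q) V ++ v a) ++
    (g a :: rcons q (f b)) ++ behead (s [:: b]).
  rewrite (morph_cat hs) (morph_pair hs) swE -!catA; congr (_ ++ _).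
  by rewrite catA sg (s_head b) -cats1 -!catA /= cat_rcons.
move=> H; apply: occurs_infix; apply: H; exists (m - (size q)%:Z).
by rewrite size_cat size_factor factorD -/w subrK !factorS /= xa xb.
Qed.

Let extensions (x : int -> A) : riet_coding R x ->
  exists y h k, [/\ word_image s x y, ordered_extensions y h k &
    forall a b, occurs x [:: a; b] -> occurs y (g a :: rcons q (f b))].
Proof.
move=> xP; have [y yP] := word_image_exists x sne.
have [h [k hk]] := riet_ordered_extensions (pres xP yP).
by exists y, h, k; split=> // a b; exact: image_extension.
Qed.

Let pair1 u v' w : uniq [:: u; v'; w] -> exists x y h k,
  [/\ riet_coding R x, word_image s x y, ordered_extensions y h k &
   forall p, p \in [:: (w, u); (w, v'); (u, v'); (u, w); (v', w)] ->
    occurs y (g p.1 :: rcons q (f p.2))].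
Proof.
move=> /(riet_pairs1 R A1)[x [xP xpairs]].
have [y [h [k [yP hk ext]]]] := extensions xP.
by exists x, y, h, k; split=> // p /xpairs; exact: ext.
Qed.

Let pair2 u v' w : uniq [:: u; v'; w] -> exists x y h k,
  [/\ riet_coding R x, word_image s x y, ordered_extensions y h k &
   forall p, p \in [:: (w, u); (u, u); (u, v'); (v', v'); (v', w)] ->
    occurs y (g p.1 :: rcons q (f p.2))].
Proof.
move=> /(riet_pairs2 R A1)[x [xP xpairs]].
have [y [h [k [yP hk ext]]]] := extensions xP.
by exists x, y, h, k; split=> // p /xpairs; exact: ext.
Qed.

(** With [f b = f b'], the pairs [b c], [b b'], [b' c], [b' b] if [g b <> g b'], and [b c], [b b],
    [c c], [c b'] if [g b <> g c], fill the rectangle that [ordered_no_cycle] excludes. *)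
Lemma first_letter_inj : injective f.
Proof.
move=> b1 b2 f12; apply: contrapT => n12.
have [b [b' [c [ubc fbb fc gbc]]]] := splitting_triple n12 f12 nf ng.
move: ubc; rewrite uniq3 => /and3P[bb' bc b'c].
case: gbc => [gbb|[gbb gbc]].
- have [|x [y [h [k [_ _ hk occ]]]]] := @pair1 b c b'.
    by rewrite uniq3 bc bb' eq_sym b'c.
  apply: (ordered_no_cycle (w := q) hk gbb fc).
  + by apply: (occ (b, c)); rewrite !inE eqxx ?orbT.
  + by rewrite fbb; apply: (occ (b, b')); rewrite !inE eqxx ?orbT.
  + by apply: (occ (b', c)); rewrite !inE eqxx ?orbT.
  + by apply: (occ (b', b)); rewrite !inE eqxx ?orbT.
- have [|x [y [h [k [_ _ hk occ]]]]] := @pair2 b c b'.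
    by rewrite uniq3 bc bb' eq_sym b'c.
  apply: (ordered_no_cycle (w := q) hk gbc fc).
  + by apply: (occ (b, c)); rewrite !inE eqxx ?orbT.
  + by apply: (occ (b, b)); rewrite !inE eqxx ?orbT.
  + by apply: (occ (c, c)); rewrite !inE eqxx ?orbT.
  + by rewrite fbb; apply: (occ (c, b')); rewrite !inE eqxx ?orbT.
Qed.

Lemma last_letter_inj : injective g.
Proof.
move=> b1 b2 g12; apply: contrapT => n12.
have [b [b' [c [ubc gbb gc fbc]]]] := splitting_triple n12 g12 ng nf.
move: ubc; rewrite uniq3 => /and3P[bb' bc b'c].
case: fbc => [fbb|[fbb fbc]].
- have [|x [y [h [k [_ _ hk occ]]]]] := @pair1 c b b'.
    by rewrite uniq3 bb' !(eq_sym c) bc b'c.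
  apply: (ordered_no_cycle (w := q) hk gc fbb).
  + by apply: (occ (c, b)); rewrite !inE eqxx ?orbT.
  + by apply: (occ (c, b')); rewrite !inE eqxx ?orbT.
  + by rewrite gbb; apply: (occ (b', b)); rewrite !inE eqxx ?orbT.
  + by apply: (occ (b, b')); rewrite !inE eqxx ?orbT.
- have [|x [y [h [k [_ _ hk occ]]]]] := @pair2 c b b'.
    by rewrite uniq3 bb' !(eq_sym c) bc b'c.
  apply: (ordered_no_cycle (w := q) hk gc fbc).
  + by apply: (occ (c, b)); rewrite !inE eqxx ?orbT.
  + by apply: (occ (c, c)); rewrite !inE eqxx ?orbT.
  + by apply: (occ (b, b)); rewrite !inE eqxx ?orbT.
  + by rewrite gbb; apply: (occ (b', c)); rewrite !inE eqxx ?orbT.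
Qed.

Let surj (e : A -> B) : injective e -> forall b, exists a, e a = b.
Proof.
move=> e_inj b; have [eK _ ee] := inj_card_bij e_inj (preserves_card A1 B1 hs sne pres).
by exists (eK b).
Qed.

Let third (u v' : A) : u != v' -> exists w, uniq [:: u; v'; w].
Proof.
by move=> uv; have [w wu wv] := third_letter u v' A2; exists w; rewrite uniq3 uv !(eq_sym _ w) wu.
Qed.

Let other (u : A) : exists u', u' != u.
Proof. by have [w wu _] := third_letter u u A2; exists w. Qed.

(** If [q] ends with [t], so do all images, and [t] precedes every [f b]. Take [a] with [f a <> t]:
    its image has a second letter [f c], and comparing [f a], [f c] with all the [t], [f b] makes
    [f c] extremal for [k]. But in the coding of [pair1] with [c] in the middle, [f c] lies strictly
    between [f u] and [f w]. *)
Lemma no_common_suffix : q = [::].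
Proof.
have [->//|q0] := eqVneq q [::].
have [t q'E] : exists t, q = rcons (rev (behead (rev q))) t.
  have : rev q != [::] by rewrite -size_eq0 size_rev size_eq0.
  case e : (rev q) => [//|t r] _; exists t.
  by rewrite -[LHS]revK e rev_cons.
have s_last a : exists r, s [:: a] = rcons r t.
  have := sg a; have := sne a; case/lastP: (s [:: a]) => [//|r d] _.
  by rewrite [in X in _ = X -> _]q'E -rcons_cat -rcons_cat => /rcons_inj[_ ->]; exists r.
have [a fat] : exists a, f a <> t.
  apply: contrapT => none; case: nf => a [b []].
  have ft e : f e = t by apply: contrapT => ne; apply: none; exists e.
  by rewrite !ft.
have [r [c saE]] : exists r c, s [:: a] = [:: f a; f c] ++ r.
  have [r] := s_last a; rewrite s_head; case: (behead _) => [|d r'] /=.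
    by case: (r) => [[/fat]|? []].
  by have [c <-] := surj first_letter_inj d; exists r', c.
have [u uc] := other c; have [w ucw] := third uc.
have [x [y [h [k [xP yP hk occ]]]]] := pair1 ucw.
have occt b : occurs y [:: t; f b].
  have [m xm] := riet_letters b A1 xP; have [r' rE] := s_last (x (m - 1)).
  apply: (@occurs_infix _ _ r' _ (behead (s [:: b]))).
  have : occurs x [:: x (m - 1); b] by exists (m - 1); rewrite !factorS /= subrK xm.
  by move=> /(occurs_image hs yP); rewrite (morph_pair hs) rE (s_head b) -cats1 -catA.
have occa : occurs y [:: f a; f c].
  have [m xm] := riet_letters a A1 xP.
  apply: (@occurs_infix _ _ [::] _ r); rewrite /= -[_ :: _]/([:: f a; f c] ++ r) -saE.
  by apply: (occurs_image hs yP); exists m; rewrite factor1 xm.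
have [h_inj k_inj mono] := hk.
have e1 := mono [::] _ _ _ _ (occt u) occa; have e2 := mono [::] _ _ _ _ (occt w) occa.
have e3 := mono [::] _ _ _ _ occa (occt u); have e4 := mono [::] _ _ _ _ occa (occt w).
have owu : occurs y (g w :: rcons q (f u)) by apply: (occ (w, u)); rewrite !inE eqxx ?orbT.
have owc : occurs y (g w :: rcons q (f c)) by apply: (occ (w, c)); rewrite !inE eqxx ?orbT.
have ouc : occurs y (g u :: rcons q (f c)) by apply: (occ (u, c)); rewrite !inE eqxx ?orbT.
have ouw : occurs y (g u :: rcons q (f w)) by apply: (occ (u, w)); rewrite !inE eqxx ?orbT.
have e5 := mono _ _ _ _ _ owu ouc; have e6 := mono _ _ _ _ _ owc ouw.
have e7 := mono _ _ _ _ _ ouc owu; have e8 := mono _ _ _ _ _ ouw owc.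
move: ucw; rewrite uniq3 => /and3P[/eqP ucN /eqP uwN /eqP cwN].
have ht : h (f a) <> h t by move/h_inj.
have hg : h (g u) <> h (g w) by move=> /h_inj/last_letter_inj.
have k1 : k (f u) <> k (f c) by move=> /k_inj/first_letter_inj.
have k2 : k (f u) <> k (f w) by move=> /k_inj/first_letter_inj.
have k3 : k (f c) <> k (f w) by move=> /k_inj/first_letter_inj.
by exfalso; lia.
Qed.

(** As [q] is empty, the first two letters of a longer image read [g a'], [f b'], so [a' b'] acts as
    an extra pair next to the five of [pair1]. If [a' = b'], a full rectangle appears; otherwise all
    six ordered pairs of three distinct letters occur, which no two orders allow. *)
Lemma image_letter a : s [:: a] = [:: f a].
Proof.
have q0 := no_common_suffix; rewrite s_head.
case bE : (behead _) => [//|r w]; exfalso.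
have saE : s [:: a] = [:: f a; r] ++ w by rewrite s_head bE.
have [a' ga'] := surj last_letter_inj (f a); have [b' fb'] := surj first_letter_inj r.
have occa x y : riet_coding R x -> word_image s x y -> occurs y [:: g a'; f b'].
  move=> xP yP; have [m xm] := riet_letters a A1 xP.
  apply: (@occurs_infix _ _ [::] _ w); rewrite /= ga' fb' -[_ :: _]/([:: f a; r] ++ w) -saE.
  by apply: (occurs_image hs yP); exists m; rewrite factor1 xm.
have [ab|ab] := eqVneq a' b'.
  have [v' va] := other a'; rewrite eq_sym in va; have [w' ucw] := third va.
  have [x [y [h [k [xP yP hk occ]]]]] := pair1 ucw.
  move: ucw; rewrite uniq3 => /and3P[/eqP av /eqP aw /eqP vw].
  apply: (@ordered_no_cycle _ y h k [::] (g a') (g w') (f a') (f v') hk).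
  - by move/last_letter_inj.
  - by move/first_letter_inj.
  - by have := occa _ _ xP yP; rewrite -ab.
  - by have := occ (a', v'); rewrite q0; apply; rewrite !inE eqxx ?orbT.
  - by have := occ (w', a'); rewrite q0; apply; rewrite !inE eqxx ?orbT.
  - by have := occ (w', v'); rewrite q0; apply; rewrite !inE eqxx ?orbT.
rewrite eq_sym in ab; have [w' ucw] := third ab.
have [x [y [h [k [xP yP hk occ]]]]] := pair1 ucw.
have oab := occa _ _ xP yP.
have owb : occurs y [:: g w'; f b'].
  by have := occ (w', b'); rewrite q0; apply; rewrite !inE eqxx ?orbT.
have owa : occurs y [:: g w'; f a'].
  by have := occ (w', a'); rewrite q0; apply; rewrite !inE eqxx ?orbT.
have oba : occurs y [:: g b'; f a'].
  by have := occ (b', a'); rewrite q0; apply; rewrite !inE eqxx ?orbT.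
have obw : occurs y [:: g b'; f w'].
  by have := occ (b', w'); rewrite q0; apply; rewrite !inE eqxx ?orbT.
have oaw : occurs y [:: g a'; f w'].
  by have := occ (a', w'); rewrite q0; apply; rewrite !inE eqxx ?orbT.
have [h_inj k_inj mono] := hk.
have e1 := mono [::] _ _ _ _ owb oba; have e2 := mono [::] _ _ _ _ owa obw.
have e3 := mono [::] _ _ _ _ oba owb; have e4 := mono [::] _ _ _ _ obw owa.
have e5 := mono [::] _ _ _ _ oaw owb; have e6 := mono [::] _ _ _ _ owb oaw.
have e7 := mono [::] _ _ _ _ oab owa; have e8 := mono [::] _ _ _ _ owa oab.
move: ucw; rewrite uniq3 => /and3P[/eqP baN /eqP bwN /eqP awN].
have hg : h (g b') <> h (g w') by move=> /h_inj/last_letter_inj.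
have hg' : h (g a') <> h (g w') by move=> /h_inj/last_letter_inj.
have k1 : k (f b') <> k (f a') by move=> /k_inj/first_letter_inj.
have k2 : k (f b') <> k (f w') by move=> /k_inj/first_letter_inj.
have k3 : k (f a') <> k (f w') by move=> /k_inj/first_letter_inj.
by lia.
Qed.

End LeftNormalized.

Lemma preserves_bijective_coding (s : seq A -> seq B) : morphism s -> nonerasing s ->
  preserves_riet_codings R s -> bijective_coding s.
Proof.
move=> hs sne pres.
have [a1 [b1 nab]] := preserves_not_commutative A1 B1 hs sne pres.
have [|p [s0 [f [hs0 s0ne conj s0f nf]]]] := left_conjugate hs sne.
  by exists a1, b1.
have pres0 := preserves_conj hs hs0 sne conj pres.
have nc0 := preserves_not_commutative A1 B1 hs0 s0ne pres0.
have [q [v [g [s0g ng]]]] := right_conjugate hs0 s0ne nc0.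
have f_inj := first_letter_inj hs0 s0ne pres0 s0f s0g nf ng.
have s0E := image_letter hs0 s0ne pres0 s0f s0g nf ng.
(* If [p] were nonempty, all images under [s] would be its first letter and would commute. *)
case: p conj => [|t p] conj; first by exists f => // a; have := conj a; rewrite cats0 s0E.
case: nab; have sE c : s [:: c] = [:: t].
  have := congr1 size (conj c); rewrite s0E !size_cat addnC => /addnI.
  by have := conj c; case: (s [:: c]) => [|d [|]] //= [->].
by rewrite !(morph_pair hs) !sE.
Qed.

End ThreeLetters.

(** * Preservation under relabelling, composition and conjugation *)

Section Relabelling.
Variables (R : realType) (A B : finType) (f : A -> B) (g : B -> A).
Hypotheses (fK : cancel f g) (gK : cancel g f).

Lemma riet_coding_map x : riet_coding R x -> riet_coding R (f \o x).
Proof.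
move=> [T [z [[inf disj] z01 xP]]].
pose pull (le : rel A) : rel B := fun u v => le (g u) (g v).
have pull_order le : total_order le -> total_order (pull le).
  case=> rf anti tr tot; split=> [u|u v /anti|v u w|u v]; rewrite /pull //.
    exact: (can_inj gK).
  exact: tr.
have reindex_g (P : pred A) (F : A -> R) : \sum_(b | P (g b)) F (g b) = \sum_(a | P a) F a.
  by rewrite [RHS](reindex g) //; exists f => ? _.
have len_sum : \sum_b len T (g b) = 1 by rewrite (reindex_g predT) len_sum1.
pose T' := Iet (pull_order _ (dom_le_order T)) (pull_order _ (img_le_order T))
  (fun b => len_gt0 T (g b)) len_sum.
have leftE le b : left_end (pull le) (len T') b = left_end le (len T) (g b).
  rewrite /left_end -reindex_g; apply: eq_bigl => c.
  by rewrite (can_eq gK).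
have pieceE' le b : piece (pull le) (len T') b = piece le (len T) (g b).
  by rewrite /piece leftE; congr Interval; congr BSide; rewrite /right_end -reindex_g.
have mapE t : t \in `[0, 1[ -> iet_map T' t = iet_map T t.
  move=> /(letter_exists T)[a ta]; rewrite (iet_mapE ta).
  have ta' : t \in piece (dom_le T') (len T') (f a) by rewrite pieceE' fK.
  by rewrite (iet_mapE ta') !leftE fK.
have invE t : t \in `[0, 1[ -> iet_inv T' t = iet_inv T t.
  move=> t01; rewrite -{1}(iet_invK T t01) -mapE ?iet_mapK //; exact: iet_inv_itv01.
have iterE n t : t \in `[0, 1[ -> iet_iter T' n t = iet_iter T n t.
  move=> t01; elim/int_ind: n => [//|n IH|n IH].
    by rewrite -addn1 PoszD !iet_iterS // IH mapE // iet_iter_itv01.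
  by rewrite -addn1 PoszD opprD !iet_iter_pred // IH invE // iet_iter_itv01.
have discE d : disc T' d -> disc T d.
  by move=> [d0 [b db]]; split=> //; exists (g b); rewrite db leftE.
have orbitE d : disc T d -> iet_orbit T' d = iet_orbit T d.
  move=> /disc_itv01 d01; apply/seteqP; split=> _ [n _ <-]; exists n => //; rewrite iterE //.
exists T', z; split=> //; last first.
  move=> n b; rewrite iterE // pieceE' -xP /=.
  by split=> [<-|->]; [rewrite fK | rewrite gK].
split=> [d /discE dd|d d' /discE dd /discE dd']; rewrite !orbitE //; [exact: inf | exact: disj].
Qed.

End Relabelling.

Section Preservation.
Variable R : realType.

Lemma preserves_comp (A B C : finType) (s : seq A -> seq B) (t : seq B -> seq C) :
  morphism t -> nonerasing s -> nonerasing t ->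
  preserves_riet_codings R s -> preserves_riet_codings R t ->
  preserves_riet_codings R (t \o s).
Proof.
move=> ht sne tne ps pt x xP z zP.
have [y yP] := word_image_exists x sne.
have [z' z'P] := word_image_exists y tne.
have -> : z = z'.
  apply: (word_image_unique _ zP (word_image_comp ht yP z'P)).
  exact: (nonerasing_comp ht sne tne).
exact: pt (ps x xP y yP) _ z'P.
Qed.

Lemma preserves_map (A B : finType) (f : A -> B) (g : B -> A) :
  cancel f g -> cancel g f -> preserves_riet_codings R (map f).
Proof.
move=> fK gK x xP y yP.
have -> : y = f \o x by apply: (word_image_unique _ yP (word_image_map f x)) => a.
exact: riet_coding_map fK gK x xP.
Qed.

Lemma preserves_bijective (A B : finType) (s : seq A -> seq B) :
  morphism s -> bijective_coding s -> preserves_riet_codings R s.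
Proof.
move=> hs [f f_inj sE].
have surj b : exists a, f a == b.
  by have [_ _ /(_ b)[a]] := hs; rewrite sE inE => /eqP ->; exists a.
have /choice[g gP] := surj.
have gK : cancel g f by move=> b; apply/eqP.
have fK : cancel f g by move=> a; apply: f_inj; rewrite gK.
have -> : s = map f; last exact: preserves_map fK gK.
by apply/funext => w; rewrite (morphE hs); elim: w => //= a w ->; rewrite sE.
Qed.

Lemma preserves_conj_inv (A B : finType) (s s0 : seq A -> seq B) p :
  morphism s -> morphism s0 -> nonerasing s -> nonerasing s0 ->
  (forall a, s [:: a] ++ p = p ++ s0 [:: a]) ->
  preserves_riet_codings R s0 -> preserves_riet_codings R s.
Proof.
move=> hs hs0 sne s0ne conj pres x xP y yP.
have [y0 y0P] := word_image_exists x s0ne.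
have -> := word_image_unique sne yP (word_image_conj hs hs0 sne conj y0P).
exact/riet_coding_shift/pres/y0P.
Qed.

End Preservation.

(** * Binary alphabets and mechanical words *)

Section Mechanical.
Variable R : realType.
Implicit Types (al rho : R) (x y : int -> bool).

(** The lower mechanical word of slope [al] and intercept [rho]: for [0 < al < 1] consecutive floors
    differ by 0 or 1. *)
Definition mechanical al rho (n : int) : bool :=
  Num.floor (rho + (n + 1)%:~R * al) != Num.floor (rho + n%:~R * al).

Definition irrational al : Prop := forall p q : int, q != 0 -> q%:~R * al != p%:~R.

Definition is_mechanical x : Prop :=
  exists al rho, [/\ 0 < al < 1, irrational al, 0 <= rho < 1 & x = mechanical al rho].

Lemma floorP (t : R) : (Num.floor t)%:~R <= t < (Num.floor t)%:~R + 1.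
Proof. by have := floor_itv t; rewrite intrD. Qed.

Lemma floor_eq (t : R) (m : int) : m%:~R <= t < m%:~R + 1 -> Num.floor t = m.
Proof. by move=> h; apply: floor_def; rewrite intrD. Qed.

Lemma floorS_mechanical al rho n : 0 < al < 1 ->
  Num.floor (rho + (n + 1)%:~R * al) =
  Num.floor (rho + n%:~R * al) + (if mechanical al rho n then 1 else 0).
Proof.
move=> al01; rewrite /mechanical; have := floorP (rho + n%:~R * al).
have := floorP (rho + (n + 1)%:~R * al); rewrite intrD mulrDl mul1r.
set u := Num.floor _; set v := Num.floor _ => hu hv.
have vu : v - 1 < u by rewrite -(ltr_int R) intrD /=; lra.
have uv : u < v + 2 by rewrite -(ltr_int R) intrD /=; lra.
by case: eqP => /=; lia.
Qed.

Lemma mechanical_gap al rho n : 0 < al < 1 ->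
  mechanical al rho n =
  (1 - al <= rho + n%:~R * al - (Num.floor (rho + n%:~R * al))%:~R).
Proof.
move=> al01; have := floorS_mechanical rho n al01.
have := floorP (rho + n%:~R * al); have := floorP (rho + (n + 1)%:~R * al).
move=> + + e; rewrite e !intrD mulrDl mul1r.
by case: ifP => _ /= h h'; apply/esym; [ | apply/negbTE; rewrite -ltNge]; lra.
Qed.

Lemma mechanical_riet x : is_mechanical x -> riet_coding R x.
Proof.
move=> [al [rho [al01 irr rho01 ->]]].
pose b (i : nat) : R := nth 0 [:: 0; 1 - al; 1] i.
have [||||||||T [rT pT mT]] := @rotation_exists R bool [:: false; true] b 1.
- by [].
- by case.
- by [].
- by [].
- by case=> [|[|]] // _; rewrite /b /=; lra.
- by [].
- move=> p q q0; apply: contra (irr (q - p) q q0) => /eqP; rewrite /b /= => e.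
  by rewrite intrD rmorphN /= -e; apply/eqP; ring.
- by case=> [|[|]] // [|[|]].
have r01 : rho \in `[0, 1[ by rewrite in_itv.
exists T, rho; split=> // n c.
have itE := iet_iter_rotation mT n r01.
rewrite /b /= subKr in itE; rewrite pT itE mechanical_gap // /b.
have := floorP (rho + n%:~R * al); set u := (Num.floor _)%:~R.
by case: c => /= h; split; case: leP => //; lra.
Qed.

End Mechanical.

Section SturmianPreservation.
Variable R : realType.
Implicit Types (al rho : R) (x y : int -> bool).

Let bool1 : (1 < #|{: bool}|)%N. Proof. by rewrite card_bool. Qed.

(** If the same letter came first in both orders, 0 would be fixed. So the two pieces are swapped,
    which is a rotation, and a rational angle would make [z] periodic. The negation covers the case
    where [true] labels the first piece of the domain. *)
Lemma riet_mechanical x : riet_coding R x ->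
  is_mechanical R x \/ is_mechanical R (negb \o x).
Proof.
move=> [T [z [rT z01 xP]]]; have od := dom_le_order T; have oi := img_le_order T.
have [a _ a_min] := total_order_min (P := predT) (a := true) od isT.
have [c _ c_min] := total_order_min (P := predT) (a := true) oi isT.
have dom_a : left_end (dom_le T) (len T) a = 0 by apply: left_end_min => // b; exact: a_min.
have nca : c != a.
  apply/eqP => ac; rewrite {}ac in c_min.
  have a0 : (0 : R) \in piece (dom_le T) (len T) a.
    by rewrite -dom_a left_end_piece.
  apply: (@no_periodic_point _ _ T 0 0 rT bool1 (piece_itv01 a0)).
  rewrite /= (iet_mapE a0) dom_a left_end_min //; first by rewrite subr0 addr0.
  by move=> b; exact: c_min.
have ca : c = ~~ a by move: nca; case: (c); case: (a).
have neq_a b : b != a -> b = ~~ a by case: b; case: (a).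
have dom_c : left_end (dom_le T) (len T) c = len T a.
  apply: left_end_second => // b; first exact: a_min.
  by move=> /neq_a ->; rewrite -ca; case: od.
have img_c : left_end (img_le T) (len T) c = 0 by apply: left_end_min => // b; exact: c_min.
have img_a : left_end (img_le T) (len T) a = len T c.
  apply: left_end_second; rewrite // 1?eq_sym // => b; first exact: c_min.
  by rewrite ca => nb; rewrite (_ : b = a); [case: oi | move: nb; case: (b); case: (a)].
have len_ac : len T a + len T c = 1.
  by rewrite -(len_sum1 T) big_bool /= ca; case: (a); rewrite // addrC.
have [la lc] := (len_gt0 T a, len_gt0 T c).
have pa t : (t \in piece (dom_le T) (len T) a) = (0 <= t < len T a).
  by rewrite pieceE // dom_a add0r.
have pc t : (t \in piece (dom_le T) (len T) c) = (len T a <= t < 1).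
  by rewrite pieceE // dom_c len_ac.
have mapT t : t \in `[0, 1[ ->
    iet_map T t = t + (1 - len T a) - (if t < len T a then 0 else 1).
  rewrite in_itv /= => /andP[t0 t1]; case: ltP => ta.
    rewrite (@iet_mapE _ _ _ a) ?pa ?t0 // dom_a img_a; lra.
  by rewrite (@iet_mapE _ _ _ c) ?pc ?ta // dom_c img_c; lra.
have iterT := iet_iter_rotation mapT.
have irr : irrational (1 - len T a).
  move=> p q q0; apply/negP => /eqP e.
  have per : iet_iter T q z = z.
    rewrite iterT // e (@floor_eq _ _ p); first by rewrite addrK.
    by move: z01; rewrite in_itv /=; lra.
  case: q q0 e per => [[|n]|n] // _ _ per.
    exact: no_periodic_point rT bool1 z01 per.
  apply: (@no_periodic_point _ _ T z n rT bool1 z01).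
  by rewrite -{1}per -iet_iterD // NegzE subrr.
have xc n : (x n == c) = mechanical (1 - len T a) z n.
  rewrite mechanical_gap; last by lra.
  rewrite subKr -iterT //; apply/eqP/idP.
    by move/xP; rewrite pc => /andP[].
  move=> h; apply/xP; rewrite pc h.
  by have := iet_iter_itv01 T n z01; rewrite in_itv /= => /andP[].
have z01' : 0 <= z < 1 by move: z01; rewrite in_itv.
have [ct|cf] : c = true \/ c = false by case: (c); [left|right].
  left; exists (1 - len T a), z; split=> //; first by lra.
  by apply/funext => n; rewrite -xc ct eqb_id.
right; exists (1 - len T a), z; split=> //; first by lra.
by apply/funext => n; rewrite -xc cf eqbF_neg.
Qed.

Lemma mechanicalP x : riet_coding R x <-> is_mechanical R x \/ is_mechanical R (negb \o x).
Proof.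
split=> [|[/mechanical_riet//|/mechanical_riet xP]]; first exact: riet_mechanical.
have -> : x = negb \o (negb \o x) by apply/funext => n /=; rewrite negbK.
exact: riet_coding_map negbK negbK _ xP.
Qed.

Lemma bool_morph_morphism w0 w1 : (forall b, b \in w0 ++ w1) -> morphism (bool_morph w0 w1).
Proof.
move=> full; split=> [//|u v|b]; first by rewrite /bool_morph map_cat flatten_cat.
have := full b; rewrite mem_cat => /orP[bw|bw]; [exists false | exists true];
  by rewrite /bool_morph /= cats0.
Qed.

Lemma bool_morph1 w0 w1 b : bool_morph w0 w1 [:: b] = if b then w1 else w0.
Proof. by rewrite /bool_morph /= cats0. Qed.

Lemma bool_morph_nonerasing w0 w1 : w0 != [::] -> w1 != [::] -> nonerasing (bool_morph w0 w1).
Proof. by move=> h0 h1 b; rewrite bool_morph1; case: b. Qed.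

Lemma R0_morphism : morphism R0. Proof. by apply: bool_morph_morphism => -[]. Qed.
Lemma R1_morphism : morphism R1. Proof. by apply: bool_morph_morphism => -[]. Qed.
Lemma L0_morphism : morphism L0. Proof. by apply: bool_morph_morphism => -[]. Qed.
Lemma L1_morphism : morphism L1. Proof. by apply: bool_morph_morphism => -[]. Qed.
Lemma R0_nonerasing : nonerasing R0. Proof. exact: bool_morph_nonerasing. Qed.
Lemma R1_nonerasing : nonerasing R1. Proof. exact: bool_morph_nonerasing. Qed.
Lemma L0_nonerasing : nonerasing L0. Proof. exact: bool_morph_nonerasing. Qed.
Lemma L1_nonerasing : nonerasing L1. Proof. exact: bool_morph_nonerasing. Qed.

Lemma R0_letter b : R0 [:: b] = if b then [:: true; false] else [:: false].
Proof. by case: b. Qed.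

Lemma R1_letter b : R1 [:: b] = if b then [:: true] else [:: false; true].
Proof. by case: b. Qed.

Lemma L0_conj b : L0 [:: b] ++ [:: false] = [:: false] ++ R0 [:: b].
Proof. by case: b. Qed.

Lemma L1_conj b : L1 [:: b] ++ [:: true] = [:: true] ++ R1 [:: b].
Proof. by case: b. Qed.

Lemma R1_negb w : R1 (map negb w) = map negb (R0 w).
Proof.
by elim: w => [//|b w IH]; rewrite /= (morph_cons R1_morphism) (morph_cons R0_morphism)
  map_cat IH; case: b.
Qed.

Lemma L1_negb w : L1 (map negb w) = map negb (L0 w).
Proof.
by elim: w => [//|b w IH]; rewrite /= (morph_cons L1_morphism) (morph_cons L0_morphism)
  map_cat IH; case: b.
Qed.

(* With F n = floor (rho + n al) and G m = floor (rho' + m al') for the parameters of the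
   image, the n-th block starts at c n = n + F n and G (c n) = F n: the ones of the image
   are counted by the blocks. *)
Lemma mechanical_R0 al rho : 0 < al < 1 -> 0 <= rho < 1 ->
  word_image R0 (mechanical al rho) (mechanical (al / (1 + al)) ((rho + al) / (1 + al))).
Proof.
move=> al01 rho01; pose F n := Num.floor (rho + n%:~R * al).
pose G m := Num.floor ((rho + al) / (1 + al) + m%:~R * (al / (1 + al))).
pose c n := n + F n; pose x := mechanical al rho.
have FS n : F (n + 1) = F n + (if x n then 1 else 0) := floorS_mechanical rho n al01.
have a1 : 0 < 1 + al by lra.
have GE m : G m = Num.floor ((rho + al + m%:~R * al) / (1 + al)).
  by rewrite /G; congr Num.floor; field; rewrite gt_eqF.
have Geq m k : k%:~R * (1 + al) <= rho + al + m%:~R * al < (k%:~R + 1) * (1 + al) -> G m = k.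
  by move=> h; rewrite GE; apply: floor_eq; rewrite ler_pdivlMr // ltr_pdivrMr.
have Gc n : G (c n) = F n.
  apply: Geq; have := floorP (rho + n%:~R * al); rewrite -/(F n) /c intrD; nra.
have Gc1 n : x n -> G (c n + 1) = F n + 1.
  move=> xn; apply: Geq; have := floorP (rho + (n + 1)%:~R * al); rewrite -/(F (n + 1)) FS xn.
  rewrite /c !intrD /=; nra.
apply: (@word_imageP _ _ _ _ _ c) => [|n|n].
- by rewrite /c /F mul0r addr0 add0r; apply: floor_eq; rewrite add0r.
- by rewrite /c FS R0_letter -/(x n); case: (x n) => /=; lia.
have yE m : mechanical (al / (1 + al)) ((rho + al) / (1 + al)) m = (G (m + 1) != G m) by [].
have cS : c (n + 1) = c n + 1 + (if x n then 1 else 0) by rewrite /c FS; lia.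
rewrite R0_letter -/(x n); case xn : (x n) cS => cS.
  rewrite !factorS !yE Gc1 // Gc -cS Gc FS xn eqxx.
  by congr [:: _; _]; apply/eqP; lia.
by rewrite factor1 yE Gc -[c n + 1]addr0 -cS Gc FS xn addr0 eqxx.
Qed.

(** Every block of [R1] contains exactly one 1, so with [F] and [G] as for [R0] the floor [G] counts
    blocks: [G (c n) = n], where [c n = 2 * n - F n]. *)
Lemma mechanical_R1 al rho : 0 < al < 1 -> 0 <= rho < 1 ->
  word_image R1 (mechanical al rho) (mechanical (2 - al)^-1 (rho / (2 - al))).
Proof.
move=> al01 rho01; pose F n := Num.floor (rho + n%:~R * al).
pose G m := Num.floor (rho / (2 - al) + m%:~R * (2 - al)^-1).
pose c n := 2 * n - F n; pose x := mechanical al rho.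
have FS n : F (n + 1) = F n + (if x n then 1 else 0) := floorS_mechanical rho n al01.
have a1 : 0 < 2 - al by lra.
have GE m : G m = Num.floor ((rho + m%:~R) / (2 - al)).
  by rewrite /G; congr Num.floor; field; rewrite gt_eqF.
have Geq m k : k%:~R * (2 - al) <= rho + m%:~R < (k%:~R + 1) * (2 - al) -> G m = k.
  by move=> h; rewrite GE; apply: floor_eq; rewrite ler_pdivlMr // ltr_pdivrMr.
have Gc n : G (c n) = n.
  by apply: Geq; have := floorP (rho + n%:~R * al); rewrite -/(F n) /c rmorphB rmorphM /=; nra.
have Gc1 n : x n = false -> G (c n + 1) = n.
  move=> xn; apply: Geq; have := floorP (rho + (n + 1)%:~R * al); rewrite -/(F (n + 1)) FS xn.
  by rewrite /c !intrD rmorphN rmorphM /=; nra.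
apply: (@word_imageP _ _ _ _ _ c) => [|n|n].
- by rewrite /c /F mul0r addr0 mulr0 add0r (@floor_eq _ _ 0) // add0r.
- by rewrite /c FS R1_letter -/(x n); case: (x n) => /=; lia.
have yE m : mechanical (2 - al)^-1 (rho / (2 - al)) m = (G (m + 1) != G m) by [].
have cS : c (n + 1) = c n + 1 + (if x n then 0 else 1) by rewrite /c FS; case: ifP; lia.
rewrite R1_letter -/(x n); case xn : (x n) cS => cS.
  by rewrite factor1 yE Gc -[c n + 1]addr0 -cS Gc; congr [:: _]; apply/eqP; lia.
rewrite !factorS !yE Gc1 // Gc -cS Gc eqxx.
by congr [:: _; _]; apply/eqP; lia.
Qed.

Lemma is_mechanical_R0 x y : is_mechanical R x -> word_image R0 x y -> is_mechanical R y.
Proof.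
move=> [al [rho [al01 irr rho01 ->]]] yP.
have -> := word_image_unique R0_nonerasing yP (mechanical_R0 al01 rho01).
have a1 : 0 < 1 + al by lra.
exists (al / (1 + al)), ((rho + al) / (1 + al)); split=> //.
- by rewrite divr_gt0 ?ltr_pdivrMr //; lra.
- move=> p q q0; apply/eqP => e.
  have e' : (q - p)%:~R * al = p%:~R.
    have : q%:~R * al = p%:~R * (1 + al) by rewrite -e; field; rewrite gt_eqF.
    by rewrite rmorphB /=; lra.
  have [qp|qp] := eqVneq (q - p) 0; last by case/negP: (irr p _ qp); apply/eqP.
  move: e'; rewrite qp mul0r => /esym/eqP; rewrite intr_eq0 => /eqP p0.
  by move: q0; rewrite p0 subr0 in qp; rewrite qp.
- by rewrite divr_ge0 ?ltr_pdivrMr //; lra.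
Qed.

Lemma is_mechanical_R1 x y : is_mechanical R x -> word_image R1 x y -> is_mechanical R y.
Proof.
move=> [al [rho [al01 irr rho01 ->]]] yP.
have -> := word_image_unique R1_nonerasing yP (mechanical_R1 al01 rho01).
have a1 : 0 < 2 - al by lra.
exists (2 - al)^-1, (rho / (2 - al)); split=> //.
- by rewrite invr_gt0 a1 invf_lt1 //; lra.
- move=> p q q0; apply/eqP => e.
  have e' : p%:~R * al = (2 * p - q)%:~R.
    have : q%:~R = p%:~R * (2 - al) by rewrite -e; field; rewrite gt_eqF.
    by rewrite rmorphB rmorphM /=; lra.
  have [p0|p0] := eqVneq p 0; last by case/negP: (irr (2 * p - q) _ p0); apply/eqP.
  move: q0; have := e'; rewrite p0 mul0r mulr0 add0r => /esym/eqP.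
  by rewrite intr_eq0 oppr_eq0 => ->.
- by rewrite divr_ge0 ?ltr_pdivrMr //; lra.
Qed.

Lemma word_image_negb (s s' : seq bool -> seq bool) x y :
  (forall w, s' (map negb w) = map negb (s w)) ->
  word_image s x y -> word_image s' (negb \o x) (negb \o y).
Proof.
move=> ss' yP.
have e n : s' [:: (negb \o x) n] = map negb (s [:: x n]) by exact: (ss' [:: x n]).
apply: (@word_imageP _ _ _ _ _ (block_start s x)) => [|n|n].
- exact: block_start0.
- by rewrite block_startS e size_map.
- by rewrite e size_map factor_map; congr map; exact: yP.
Qed.

Lemma R0_negb w : R0 (map negb w) = map negb (R1 w).
Proof.
by rewrite -{2}[w](mapK negbK) R1_negb (mapK negbK).
Qed.

Lemma preserves_R0 : preserves_riet_codings R R0.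
Proof.
move=> x /mechanicalP[xP|xP] y yP; apply/mechanicalP; first by left; exact: is_mechanical_R0 xP yP.
by right; exact: is_mechanical_R1 xP (word_image_negb R1_negb yP).
Qed.

Lemma preserves_R1 : preserves_riet_codings R R1.
Proof.
move=> x /mechanicalP[xP|xP] y yP; apply/mechanicalP; first by left; exact: is_mechanical_R1 xP yP.
by right; exact: is_mechanical_R0 xP (word_image_negb R0_negb yP).
Qed.

Lemma preserves_L0 : preserves_riet_codings R L0.
Proof.
exact: preserves_conj_inv L0_morphism R0_morphism L0_nonerasing R0_nonerasing L0_conj preserves_R0.
Qed.

Lemma preserves_L1 : preserves_riet_codings R L1.
Proof.
exact: preserves_conj_inv L1_morphism R1_morphism L1_nonerasing R1_nonerasing L1_conj preserves_R1.
Qed.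

Lemma sturmian_monoid_preserves t : sturmian_monoid t ->
  [/\ morphism t, nonerasing t & preserves_riet_codings R t].
Proof.
elim=> [|||||f g _ [hf fne pf] _ [hg gne pg]].
- split=> [||x xP y yP]; [by split=> // b; exists b; rewrite inE | by [] |].
  have <- : x = y by apply: (word_image_unique _ _ yP) => // n; rewrite -[RHS]/([:: x n]);
    rewrite -[LHS]/(factor x _ 1) factor1 -(block_start_unique (c := id)).
  by [].
- by split; [exact: L0_morphism | exact: L0_nonerasing | exact: preserves_L0].
- by split; [exact: R0_morphism | exact: R0_nonerasing | exact: preserves_R0].
- by split; [exact: L1_morphism | exact: L1_nonerasing | exact: preserves_L1].
- by split; [exact: R1_morphism | exact: R1_nonerasing | exact: preserves_R1].
- by split; [exact: morphism_comp | exact: nonerasing_comp | exact: preserves_comp].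
Qed.

Lemma sturmian_preserves (A B : finType) (s : seq A -> seq B) :
  sturmian s -> preserves_riet_codings R s.
Proof.
move=> [f [g [t [[f' fK f'K] [g' gK g'K] /sturmian_monoid_preserves[ht tne pt] sE]]]].
have -> : s = map g \o (t \o map f) by apply/funext.
have mf := morphism_map f'K; have mg := morphism_map g'K.
apply: preserves_comp => //; first exact: nonerasing_comp.
  by apply: preserves_comp => //; exact: preserves_map fK f'K.
exact: preserves_map gK g'K.
Qed.

End SturmianPreservation.

(** * Balance, and recovering a coding from its image *)

Section Desubstitution.
Variable R : realType.
Implicit Types (al rho : R) (x y : int -> bool).

Lemma count_mechanical al rho m n : 0 < al < 1 ->
  (count id (factor (mechanical al rho) m n))%:Z =
  Num.floor (rho + (m + n%:Z)%:~R * al) - Num.floor (rho + m%:~R * al).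
Proof.
move=> al01; elim: n => [|n IH]; first by rewrite addr0 subrr.
rewrite factorSr -cats1 count_cat /= PoszD IH (_ : m + n.+1%:Z = m + n%:Z + 1); last by lia.
rewrite floorS_mechanical //.
by case: ifP => _ /=; lia.
Qed.

(** The numbers of ones in two windows of equal length differ by at most 1. *)
Lemma mechanical_balanced y w : is_mechanical R y ->
  occurs y (false :: rcons w false) -> ~ occurs y (true :: rcons w true).
Proof.
move=> [al [rho [al01 _ _ ->]]] [m mE] [m' m'E].
have cE b : (count id (b :: rcons w b) = count id w + b * 2)%N.
  by rewrite /= -cats1 count_cat /=; lia.
have := count_mechanical rho m (size (false :: rcons w false)) al01; rewrite mE cE.
have := count_mechanical rho m' (size (true :: rcons w true)) al01; rewrite m'E cE.
rewrite /= !size_rcons; set n := (size w).+2 => e' e.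
have h1 := floorP (rho + (m + n%:Z)%:~R * al); have h2 := floorP (rho + m%:~R * al).
have h3 := floorP (rho + (m' + n%:Z)%:~R * al); have h4 := floorP (rho + m'%:~R * al).
move: e e' h1 h2 h3 h4; rewrite !intrD !mulrDl.
set f1 := Num.floor _; set f2 := Num.floor _; set f3 := Num.floor _; set f4 := Num.floor _.
move=> e e' h1 h2 h3 h4.
have : f3 - f4 - 2 = f1 - f2 by lia.
by move=> /(congr1 (fun i : int => i%:~R : R)); rewrite !rmorphB /=; lra.
Qed.

Lemma occurs_map (T U : Type) (f : T -> U) (y : int -> T) w :
  occurs y w -> occurs (f \o y) (map f w).
Proof. by move=> [m mE]; exists m; rewrite size_map factor_map mE. Qed.

Lemma riet_balanced y w : riet_coding R y ->
  occurs y (false :: rcons w false) -> ~ occurs y (true :: rcons w true).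
Proof.
move=> /mechanicalP[yP|yP]; first exact: mechanical_balanced.
move=> /(occurs_map negb) + /(occurs_map negb); rewrite /= !map_rcons => o1 o2.
exact: mechanical_balanced yP o2 o1.
Qed.

(** Forwards, the first letter of a block is its source. Backwards, the letter two places before the
    next block start is the source: either it begins a block of length 2, or the block is [b] and
    the letter is the last one, again [b], of the preceding block. *)
Lemma word_image_source (s : seq bool -> seq bool) b x x' y :
  (forall a, s [:: a] = if a == b then [:: b] else [:: a; b]) ->
  word_image s x y -> word_image s x' y -> x = x'.
Proof.
move=> sE yP y'P.
have head_ (z : int -> bool) n : word_image s z y -> y (block_start s z n) = z n.
  move=> zP; have := zP n; rewrite -/(factor _ _ _) sE.
  by case: eqP => [->|_]; rewrite ?factor1 ?factorS => -[].
have last_ (z : int -> bool) n : word_image s z y -> y (block_start s z (n + 1) - 1) = b.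
  move=> zP; have := zP n; rewrite -/(factor _ _ _) block_startS sE.
  case: eqP => _ /=; first by rewrite factor1 addrK => -[].
  by rewrite !factorS /= (_ : 2%:Z = 1 + 1) // addrA addrK => -[].
have prev (z : int -> bool) n : word_image s z y ->
    y (block_start s z (n + 1) - 2) = z n.
  move=> zP; have := head_ z n zP; rewrite block_startS sE; case: eqP => [zn _|zn <-] /=.
    rewrite zn -(last_ z (n - 1) zP) subrK; congr y; lia.
  by congr y; lia.
have start n : block_start s x n = block_start s x' n.
  elim/int_ind: n => [|n IH|n IH]; first by rewrite !block_start0.
    by rewrite -addn1 PoszD !block_startS -(head_ x _ yP) -(head_ x' _ y'P) IH.
  have e : - n%:Z = - n.+1%:Z + 1 by rewrite -addn1 PoszD opprD addrNK.
  have xx' : x (- n.+1%:Z) = x' (- n.+1%:Z).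
    by rewrite -(prev x _ yP) -(prev x' _ y'P) -e IH.
  by move: IH; rewrite e !block_startS xx' => /addIr.
by apply/funext => n; rewrite -(head_ x _ yP) -(head_ x' _ y'P) start.
Qed.

Lemma R0_sep x y m : word_image R0 x y -> y m -> y (m + 1) = false.
Proof.
move=> yP ym; have [n /andP[l r]] := block_exists x R0_nonerasing m.
have := yP n; rewrite -/(factor _ _ _); move: r; rewrite block_startS !R0_letter.
case: (x n) => /= r.
  rewrite !factorS /= => -[y1 y2]; have [e|e] : m = block_start R0 x n \/
    m = block_start R0 x n + 1 by lia.
    by rewrite e.
  by move: ym; rewrite e y2.
rewrite factor1 => -[y1]; have e : m = block_start R0 x n by lia.
by move: ym; rewrite e y1.
Qed.

Lemma R1_sep x y m : word_image R1 x y -> ~~ y m -> y (m + 1) = true.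
Proof.
move=> yP; have := word_image_negb R0_negb yP => y'P ym.
by have := R0_sep y'P (m := m) ym; rewrite /= => /negbFE.
Qed.

Lemma half_bound (t : R) : (forall k : nat, k%:R * t < 1) -> t <= 0.
Proof.
move=> ht; rewrite leNgt; apply/negP => t0.
have := ht (Num.bound t^-1); apply/negP; rewrite -leNgt -ler_pdivrMr // mul1r.
by apply/ltW/archi_boundP; rewrite invr_ge0 ltW.
Qed.

(** The parameters of [mechanical_R0] are inverted. They are admissible because the absence of 11
    gives [al < 1 / 2], and the letter before the block start 0, being the end of a block, is 0,
    which gives [al <= rho]. *)
Lemma is_mechanical_R0_inv x y : word_image R0 x y -> is_mechanical R y -> is_mechanical R x.
Proof.
move=> yP [al [rho [al01 irr rho01 yE]]].
pose F n := Num.floor (rho + n%:~R * al).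
have FS n : F (n + 1) = F n + (if y n then 1 else 0).
  by rewrite yE; exact: floorS_mechanical.
have F0 : F 0 = 0 by apply: floor_eq; rewrite mul0r addr0 add0r.
have al2 : al < 1 / 2.
  have : 2 * al - 1 <= 0.
    apply: half_bound => k.
    have Fk : F (k%:Z + k%:Z) <= k%:Z.
      elim: k => [|k IH]; first by rewrite F0.
      have -> : k.+1%:Z + k.+1%:Z = k%:Z + k%:Z + 1 + 1 by lia.
      rewrite !FS; case yk : (y _); last by case: ifP => _; lia.
      by rewrite (R0_sep yP yk); lia.
    have := floorP (rho + (k%:Z + k%:Z)%:~R * al); rewrite -/(F _).
    have : (F (k%:Z + k%:Z))%:~R <= k%:R :> R by rewrite -(ler_int R) in Fk.
    by rewrite intrD; lra.
  rewrite le_eqVlt => /predU1P[e|]; last by lra.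
  by case/negP: (irr 1 2 isT); apply/eqP; rewrite /= -[1%:~R]/(1 : R); lra.
have rho_al : al <= rho.
  have y1 : y (-1) = false.
    have := yP (-1); rewrite -/(factor _ _ _).
    have := block_startS R0 x (-1); rewrite addNr block_start0.
    rewrite R0_letter; case: (x (-1)) => /= e.
      rewrite !factorS /= => -[_ <-]; congr y; lia.
    by rewrite factor1 => -[<-]; congr y; lia.
  have := FS (-1); rewrite addNr F0 y1 addr0 => F1.
  by have := floorP (rho + (-1)%:~R * al); rewrite -/(F (-1)) -F1 mulN1r; lra.
have a1 : 0 < 1 - al by lra.
have a1' : 1 - al != 0 by rewrite gt_eqF.
have al'01 : 0 < al / (1 - al) < 1 by rewrite divr_gt0 ?ltr_pdivrMr //; lra.
have rho'01 : 0 <= (rho - al) / (1 - al) < 1.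
  by rewrite divr_ge0 ?ltr_pdivrMr //; lra.
have := mechanical_R0 al'01 rho'01.
have e1 : 1 + al / (1 - al) = (1 - al)^-1 by field.
rewrite e1 (_ : al / (1 - al) / (1 - al)^-1 = al); last by field.
rewrite (_ : ((rho - al) / (1 - al) + al / (1 - al)) / (1 - al)^-1 = rho); last by field.
rewrite -yE => y'P.
exists (al / (1 - al)), ((rho - al) / (1 - al)); split=> //.
  move=> p q q0; apply/eqP => e.
  have e' : (q + p)%:~R * al = p%:~R.
    have : q%:~R * al = p%:~R * (1 - al) by rewrite -e; field.
    by rewrite intrD; lra.
  have [qp|qp] := eqVneq (q + p) 0; last by case/negP: (irr p _ qp); apply/eqP.
  move: e'; rewrite qp mul0r => /esym/eqP; rewrite intr_eq0 => /eqP p0.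
  by move: q0; rewrite p0 addr0 in qp; rewrite qp.
by apply: (word_image_source (b := false)) yP y'P => -[].
Qed.

(** As for [R0]: the absence of 00 gives [1 / 2 < be], and a 1 at position -1 gives [rho < be]. *)
Lemma is_mechanical_R1_inv x y : word_image R1 x y -> is_mechanical R y -> is_mechanical R x.
Proof.
move=> yP [be [rho [be01 irr rho01 yE]]].
pose F n := Num.floor (rho + n%:~R * be).
have FS n : F (n + 1) = F n + (if y n then 1 else 0).
  by rewrite yE; exact: floorS_mechanical.
have F0 : F 0 = 0 by apply: floor_eq; rewrite mul0r addr0 add0r.
have be2 : 1 / 2 < be.
  have : 1 - 2 * be <= 0.
    apply: half_bound => k.
    have Fk : k%:Z <= F (k%:Z + k%:Z).
      elim: k => [|k IH]; first by rewrite F0.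
      have -> : k.+1%:Z + k.+1%:Z = k%:Z + k%:Z + 1 + 1 by lia.
      rewrite !FS; case yk : (y (k%:Z + k%:Z)); first by case: ifP => _; lia.
      by rewrite (R1_sep yP (negbT yk)); lia.
    have := floorP (rho + (k%:Z + k%:Z)%:~R * be); rewrite -/(F _).
    have : k%:R <= (F (k%:Z + k%:Z))%:~R :> R by rewrite -(ler_int R) in Fk.
    by rewrite intrD; lra.
  rewrite le_eqVlt => /predU1P[e|]; last by lra.
  by case/negP: (irr 1 2 isT); apply/eqP; rewrite /= -[1%:~R]/(1 : R); lra.
have rho_be : rho < be.
  have y1 : y (-1) = true.
    have := yP (-1); rewrite -/(factor _ _ _).
    have := block_startS R1 x (-1); rewrite addNr block_start0.
    rewrite R1_letter; case: (x (-1)) => /= e.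
      by rewrite factor1 => -[<-]; congr y; lia.
    rewrite !factorS /= => -[_ <-]; congr y; lia.
  have := FS (-1); rewrite addNr F0 y1 => F1.
  have F1' : F (-1) = -1 by lia.
  by have := floorP (rho + (-1)%:~R * be); rewrite -/(F (-1)) F1' mulN1r rmorphN /=; lra.
have b0 : be != 0 by rewrite gt_eqF //; lra.
have al01 : 0 < 2 - be^-1 < 1.
  have : be^-1 < 2 by rewrite invf_plt ?posrE; lra.
  by have : 1 < be^-1 by [rewrite invf_gt1; lra]; lra.
have rho'01 : 0 <= rho / be < 1 by rewrite divr_ge0 ?ltr_pdivrMr //; lra.
have := mechanical_R1 al01 rho'01.
rewrite subKr invrK mulfVK // -yE => y'P.
exists (2 - be^-1), (rho / be); split=> //.
  move=> p q q0; apply/eqP => e.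
  have e' : (2 * q - p)%:~R * be = q%:~R.
    by rewrite rmorphB rmorphM /= -e; field.
  have [qp|qp] := eqVneq (2 * q - p) 0; last by case/negP: (irr q _ qp); apply/eqP.
  by move: e'; rewrite qp mul0r => /esym/eqP; rewrite intr_eq0 (negbTE q0).
by apply: (word_image_source (b := true)) yP y'P => -[].
Qed.

Lemma riet_R0_inv x y : word_image R0 x y -> riet_coding R y -> riet_coding R x.
Proof.
move=> yP /mechanicalP[h|h]; apply/mechanicalP; first by left; exact: is_mechanical_R0_inv yP h.
by right; exact: is_mechanical_R1_inv (word_image_negb R1_negb yP) h.
Qed.

Lemma riet_L0_inv x y : word_image L0 x y -> riet_coding R y -> riet_coding R x.
Proof.
move=> yP riet_y; have [y0 y0P] := word_image_exists x R0_nonerasing.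
have := word_image_conj L0_morphism R0_morphism L0_nonerasing L0_conj y0P.
move=> /(word_image_unique L0_nonerasing yP) yE; apply: (riet_R0_inv y0P).
have := riet_coding_shift (size [:: false])%:Z riet_y.
by congr riet_coding; apply/funext => n; rewrite yE addrK.
Qed.

End Desubstitution.

(** * Factoring the binary morphisms that preserve codings *)

Section BinaryMorphisms.
Variable R : realType.

Let bool1 : (1 < #|{: bool}|)%N. Proof. by rewrite card_bool. Qed.

Definition no_square (b : bool) : rel bool := fun u v => ~~ ((u == b) && (v == b)).

Lemma not_sorted (T : Type) (e : rel T) w : ~~ sorted e w ->
  exists p a b r, w = p ++ [:: a; b] ++ r /\ ~~ e a b.
Proof.
elim: w => [//|a [//|b w] IH] /=; rewrite negb_and => /orP[nab|/IH].
  by exists [::], a, b, w.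
by move=> [p [c [d [r [-> ncd]]]]]; exists (a :: p), c, d, r.
Qed.

Lemma occurs_square y w b : occurs y w -> ~~ sorted (no_square b) w -> occurs y [:: b; b].
Proof.
move=> yw /not_sorted[p [c [d [r [wE]]]]]; rewrite negbK => /andP[/eqP cb /eqP db].
by rewrite wE cb db in yw; exact: occurs_infix yw.
Qed.

(** Every 1 is preceded by its own 0. The default of [head] lets the empty word through. *)
Lemma decompose_L0 w : sorted (no_square true) w -> head false w = false -> exists w', w = L0 w'.
Proof.
have [n] := ubnP (size w); elim: n w => // n IH [_ _ _|[] // w]; first by exists [::].
case: w => [_ _ _|[] w]; first by exists [:: false].
  case: w => [_ _ _|[] w] //; first by exists [:: true].
  move=> sz srt _; have [|||w' ->] := IH (false :: w); first by move: sz => /=; lia.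
  - exact: path_sorted (path_sorted srt).
  - by [].
  by exists (true :: w').
move=> sz srt _; have [|||w' ->] := IH (false :: w); first by move: sz => /=; lia.
- exact: path_sorted srt.
- by [].
by exists (false :: w').
Qed.

Lemma decompose_R0 w : sorted (no_square true) w -> last false w = false -> exists w', w = R0 w'.
Proof.
have [n] := ubnP (size w); elim: n w => // n IH [_ _ _|[] w]; first by exists [::].
  case: w => [|[] w] // sz srt lst.
  have [|||w' ->] := IH w; first by move: sz => /=; lia.
  - exact: path_sorted (path_sorted srt).
  - by move: lst => /=; case: (w).
  by exists (true :: w').
move=> sz srt lst; have [|||w' ->] := IH w; first by move: sz => /=; lia.
- exact: path_sorted srt.
- by move: lst => /=; case: (w).
by exists (false :: w').
Qed.

Definition alternating p n : seq bool := mkseq (fun i => p (+) odd i) n.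

Lemma alternatingD p m n :
  alternating p (m + n) = alternating p m ++ alternating (p (+) odd m) n.
Proof.
rewrite /alternating /mkseq iotaD map_cat add0n; congr (_ ++ _).
rewrite -[in LHS](addn0 m) (iotaDl m 0) -map_comp.
by apply: eq_map => i /=; rewrite oddD addbA.
Qed.

Lemma alternatingS p n : alternating p n.+1 = p :: alternating (~~ p) n.
Proof. by rewrite -add1n alternatingD /= addbT /alternating /mkseq /= addbF. Qed.

Lemma sorted_alternating w : sorted (no_square true) w -> sorted (no_square false) w ->
  w = alternating (head false w) (size w).
Proof.
elim: w => [//|a [|b w] IH] /=; first by rewrite alternatingS.
move=> /andP[n1 /IH {}IH] /andP[n0 /IH {}IH]; rewrite alternatingS {1}IH /=.
by move: n1 n0 {IH}; rewrite /no_square; case: a; case: b.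
Qed.

Lemma alternating_sorted p n b : sorted (no_square b) (alternating p n).
Proof.
elim: n p => [//|n IH] p; rewrite alternatingS; case: n IH => [//|n] IH.
have := IH (~~ p); rewrite !alternatingS /= => ->.
by rewrite /no_square andbT; case: (p); case: (b).
Qed.

(** The exchange of letters conjugates [L0] to [L1] and [R0] to [R1], so it can be moved to the
    output of a composition. *)
Definition monoid_up_to_negb (s : seq bool -> seq bool) : Prop :=
  exists2 t, sturmian_monoid t & (forall w, s w = t w) \/ (forall w, s w = map negb (t w)).

Lemma monoid_up_to_negb_sym (s s' : seq bool -> seq bool) :
  (forall w, s' w = map negb (s w)) -> monoid_up_to_negb s' -> monoid_up_to_negb s.
Proof.
move=> ss' [t ht [st|st]]; exists t => //; [right|left] => w.
  by rewrite -st ss' (mapK negbK).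
by rewrite -[LHS](mapK negbK) -ss' st (mapK negbK).
Qed.

Lemma L0_negb w : L0 (map negb w) = map negb (L1 w).
Proof. by rewrite -{2}[w](mapK negbK) L1_negb (mapK negbK). Qed.

Lemma monoid_up_to_negb_L0 s : monoid_up_to_negb s -> monoid_up_to_negb (L0 \o s).
Proof.
move=> [t ht [st|st]].
  by exists (L0 \o t); [exact: sturmian_comp sturmian_L0 ht | left=> w /=; rewrite st].
exists (L1 \o t); [exact: sturmian_comp sturmian_L1 ht | right=> w /=].
by rewrite st L0_negb.
Qed.

Lemma monoid_up_to_negb_R0 s : monoid_up_to_negb s -> monoid_up_to_negb (R0 \o s).
Proof.
move=> [t ht [st|st]].
  by exists (R0 \o t); [exact: sturmian_comp sturmian_R0 ht | left=> w /=; rewrite st].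
exists (R1 \o t); [exact: sturmian_comp sturmian_R1 ht | right=> w /=].
by rewrite st R0_negb.
Qed.

Lemma size_L0 w : size (L0 w) = (size w + count id w)%N /\ count id (L0 w) = count id w.
Proof.
elim: w => [//|b w [IH1 IH2]]; rewrite (morph_cons L0_morphism) size_cat count_cat IH1 IH2.
by case: b => /=; lia.
Qed.

Lemma size_R0 w : size (R0 w) = (size w + count id w)%N /\ count id (R0 w) = count id w.
Proof.
elim: w => [//|b w [IH1 IH2]]; rewrite (morph_cons R0_morphism) size_cat count_cat IH1 IH2.
by case: b => /=; lia.
Qed.

Lemma bool_morph_cons w0 w1 b w :
  bool_morph w0 w1 (b :: w) = (if b then w1 else w0) ++ bool_morph w0 w1 w.
Proof. by []. Qed.

Lemma comp_bool_morph (S : seq bool -> seq bool) w0 w1 : morphism S ->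
  forall w, bool_morph (S w0) (S w1) w = (S \o bool_morph w0 w1) w.
Proof.
move=> hS; elim=> [|b w IH]; first by rewrite /= (morph_nil hS).
by rewrite bool_morph_cons IH /= bool_morph_cons (morph_cat hS); case: b.
Qed.

(** What has to be shown is that both letters appear in the images; they do because the image of a
    coding is again a coding. *)
Lemma preserves_bool_morph w0 w1 : w0 != [::] -> w1 != [::] ->
  preserves_riet_codings R (bool_morph w0 w1) -> morphism (bool_morph w0 w1).
Proof.
move=> h0 h1 pres; apply: bool_morph_morphism => b.
have [x xP _] := riet_dominant R bool1 true 0.
have sne := bool_morph_nonerasing h0 h1.
have [y yP] := word_image_exists x sne.
have [m ym] := riet_letters b bool1 (pres x xP y yP).
have [n /andP[l r]] := block_exists x sne m.
have : b \in bool_morph w0 w1 [:: x n].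
  rewrite -[bool_morph _ _ _]yP; apply/mapP; exists (absz (m - block_start (bool_morph w0 w1) x n)).
    rewrite mem_iota leq0n add0n; move: r; rewrite block_startS; lia.
  by rewrite -ym; congr y; lia.
by rewrite bool_morph1 mem_cat; case: (x n) => ->; rewrite ?orbT.
Qed.

Lemma preserves_left_factor (S s : seq bool -> seq bool) :
  (forall x y, word_image S x y -> riet_coding R y -> riet_coding R x) ->
  morphism S -> nonerasing S ->
  preserves_riet_codings R (S \o s) -> preserves_riet_codings R s.
Proof.
move=> Sinv hS Sne pres x xP y yP; have [z zP] := word_image_exists y Sne.
exact: Sinv zP (pres x xP z (word_image_comp hS yP zP)).
Qed.

Definition square_free_pairs b w0 w1 : bool :=
  [&& sorted (no_square b) (w0 ++ w0), sorted (no_square b) (w0 ++ w1),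
      sorted (no_square b) (w1 ++ w0) & sorted (no_square b) (w1 ++ w1)].

Lemma no_square_junction b u v c d : sorted (no_square b) (rcons u c ++ d :: v) ->
  no_square b c d.
Proof. by case: u => [|a u] /=; [case/andP | rewrite cat_path last_rcons => /and3P[]]. Qed.

(** If neither image starts with 1, [L0] factors out. Otherwise some image starts with 1, so no
    image may end with 1, and [R0] factors out. The sizes decrease because [L0] and [R0] lengthen a
    word by its number of ones, and some image contains a 1. *)
Lemma factor_no_square n :
  (forall w0 w1, (size w0 + size w1 < n)%N -> w0 != [::] -> w1 != [::] ->
    preserves_riet_codings R (bool_morph w0 w1) -> monoid_up_to_negb (bool_morph w0 w1)) ->
  forall w0 w1, (size w0 + size w1 <= n)%N -> w0 != [::] -> w1 != [::] ->
    preserves_riet_codings R (bool_morph w0 w1) ->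
    square_free_pairs true w0 w1 -> monoid_up_to_negb (bool_morph w0 w1).
Proof.
move=> IH w0 w1 sz n0 n1 pres /and4P[s00 s01 s10 s11].
have hs := preserves_bool_morph n0 n1 pres.
have cnt : (0 < count id w0 + count id w1)%N.
  have [_ _ /(_ true)[b]] := hs; rewrite bool_morph1 => tb.
  rewrite -count_cat -has_count; apply/hasP; exists true => //.
  by rewrite mem_cat; case: b tb => ->; rewrite ?orbT.
have [S [hS Sne Sinv SG Ssz] [[w0' e0] [w1' e1]]] : exists2 S : seq bool -> seq bool,
    [/\ morphism S, nonerasing S,
      forall x y, word_image S x y -> riet_coding R y -> riet_coding R x,
      forall s, monoid_up_to_negb s -> monoid_up_to_negb (S \o s) &
      forall w, size (S w) = (size w + count id w)%N /\ count id (S w) = count id w] &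
    (exists w', w0 = S w') /\ (exists w', w1 = S w').
  have [srt0 _] := cat_sorted2 s00; have [srt1 _] := cat_sorted2 s11.
  have [/andP[/eqP h0 /eqP h1]|heads] :=
    boolP ((head false w0 == false) && (head false w1 == false)).
    exists L0; last by split; exact: decompose_L0.
    split; [exact: L0_morphism | exact: L0_nonerasing | exact: riet_L0_inv |
      exact: monoid_up_to_negb_L0 | exact: size_L0].
  have [d [v [dE dv]]] : exists d v, d = true :: v /\ (d = w0 \/ d = w1).
    case/nandP: heads => h; [exists w0, (behead w0) | exists w1, (behead w1)]; split.
    - by case: (w0) h => [|[]].
    - by left.
    - by case: (w1) h => [|[]].
    - by right.
  have lastE w : sorted (no_square true) (w ++ d) -> last false w = false.
    rewrite dE; case/lastP: w => [//|u c]; rewrite last_rcons => /no_square_junction.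
    by rewrite /no_square andbT; case: c.
  exists R0; last by split; apply: decompose_R0 => //; apply: lastE; case: dv => ->.
  split; [exact: R0_morphism | exact: R0_nonerasing | exact: riet_R0_inv |
    exact: monoid_up_to_negb_R0 | exact: size_R0].
have SG' : monoid_up_to_negb (S \o bool_morph w0' w1').
  apply: SG; apply: IH.
  - have [a0 c0] := Ssz w0'; have [a1 c1] := Ssz w1'.
    move: sz cnt; rewrite e0 e1 a0 a1 c0 c1.
    move: (size _) (size _) (count _ _) (count _ _) => k0 k1 k2 k3; clear; lia.
  - by apply: contraNneq n0 => w00; rewrite e0 w00 (morph_nil hS).
  - by apply: contraNneq n1 => w10; rewrite e1 w10 (morph_nil hS).
  - apply: (preserves_left_factor Sinv hS Sne).
    have -> : S \o bool_morph w0' w1' = bool_morph w0 w1; last by [].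
    by apply/funext => w; rewrite e0 e1 comp_bool_morph.
have -> : bool_morph w0 w1 = S \o bool_morph w0' w1'; last by [].
by apply/funext => w; rewrite e0 e1 comp_bool_morph.
Qed.

Lemma bool_morph_negb w0 w1 w :
  bool_morph (map negb w0) (map negb w1) w = map negb (bool_morph w0 w1 w).
Proof.
by elim: w => [//|b w IH]; rewrite !bool_morph_cons IH map_cat; case: b.
Qed.

Lemma sorted_map_negb b w :
  sorted (no_square (~~ b)) (map negb w) = sorted (no_square b) w.
Proof.
rewrite sorted_map; apply: eq_sorted => u v; rewrite /relpre /= /no_square.
by case: u; case: v; case: b.
Qed.

Lemma square_free_pairs_negb b w0 w1 :
  square_free_pairs (~~ b) (map negb w0) (map negb w1) = square_free_pairs b w0 w1.
Proof. by rewrite /square_free_pairs -!map_cat !sorted_map_negb. Qed.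

Lemma dominant_image a w0 w1 : w0 != [::] -> w1 != [::] ->
  preserves_riet_codings R (bool_morph w0 w1) -> exists2 y, riet_coding R y &
  occurs y (bool_morph w0 w1 [:: a; a; a; ~~ a; a; a; a]).
Proof.
move=> n0 n1 pres; have hs := preserves_bool_morph n0 n1 pres.
have [x xP dom] := riet_dominant R bool1 a 4.
have [y yP] := word_image_exists x (bool_morph_nonerasing n0 n1).
exists y; first exact: pres yP.
apply: (occurs_image hs yP); have [m xm] := riet_letters (~~ a) bool1 xP.
have xma : x m != a by rewrite xm; case: (a).
have left k : (k < 3)%N -> x (m - 3%:Z + k%:Z) = a.
  move=> k3; apply/eqP/negPn/negP => xk; have := dom (m - 3%:Z + k%:Z) (2 - k)%N _ xk.
  rewrite (_ : _ + _ = m); last by lia.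
  by move=> xa; move: xma; rewrite xa ?eqxx //; lia.
exists (m - 3%:Z); rewrite -[size _]/(3 + 4)%N factorD subrK (factorS _ m 3) xm.
rewrite !(@factor_const _ _ a) // => k k3.
by rewrite -addrA -PoszD add1n dom // ltnW.
Qed.

(** If each square of a letter occurred in one of these products, 00 and 11 would both be factors of
    one coding. Since [~~ a] is isolated in the source, its own square is out of reach; hence the
    lemma is applied with either letter dominant. *)
Lemma one_square_free a w0 w1 : w0 != [::] -> w1 != [::] ->
  preserves_riet_codings R (bool_morph w0 w1) ->
  let w c := if c then w1 else w0 in
  exists b, [&& sorted (no_square b) (w a ++ w a), sorted (no_square b) (w a ++ w (~~ a)) &
    sorted (no_square b) (w (~~ a) ++ w a)].
Proof.
move=> n0 n1 pres w; have [y yP occ] := dominant_image a n0 n1 pres.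
have {}occ : occurs y (w a ++ w a ++ w a ++ w (~~ a) ++ w a ++ w a ++ w a ++ [::]) by [].
have square b : ~~ [&& sorted (no_square b) (w a ++ w a),
    sorted (no_square b) (w a ++ w (~~ a)) & sorted (no_square b) (w (~~ a) ++ w a)] ->
    occurs y [:: b; b].
  rewrite !negb_and => /or3P[] h; apply: (occurs_square _ h).
  - apply: (@occurs_infix _ _ [::] _ (w a ++ w (~~ a) ++ w a ++ w a ++ w a ++ [::])).
    by rewrite /= -!catA.
  - apply: (@occurs_infix _ _ (w a ++ w a) _ (w a ++ w a ++ w a ++ [::])).
    by rewrite -!catA.
  - apply: (@occurs_infix _ _ (w a ++ w a ++ w a) _ (w a ++ w a ++ [::])).
    by rewrite -!catA.
apply: contrapT => none; apply: (@riet_balanced R y [::] yP); apply: square;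
  by apply/negP => h; apply: none; eexists; exact: h.
Qed.

Lemma alternating_pair p q m n : alternating p (m + n) = alternating p m ++ alternating q n ->
  (0 < n)%N -> q = p (+) odd m.
Proof.
rewrite alternatingD => /eqP; rewrite eqseq_cat // => /andP[_ /eqP]; case: n => // n.
by rewrite !alternatingS => -[].
Qed.

(* Either some square of a letter is avoided and a letter of the monoid factors out, or w0 and w1
   are alternating words of odd lengths with distinct first letters, say p and q; unless both
   have length 1, p w0 p and q w0 q both occur in the image of a coding that contains 000 and
   010. *)
Lemma monoid_up_to_negb_bool_morph w0 w1 : w0 != [::] -> w1 != [::] ->
  preserves_riet_codings R (bool_morph w0 w1) -> monoid_up_to_negb (bool_morph w0 w1).
Proof.
have [n] := ubnP (size w0 + size w1); elim: n w0 w1 => // n IH w0 w1 sz n0 n1 pres.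
have {IH} factor1 u0 u1 : (size u0 + size u1 <= n)%N -> u0 != [::] -> u1 != [::] ->
    preserves_riet_codings R (bool_morph u0 u1) -> square_free_pairs true u0 u1 ->
    monoid_up_to_negb (bool_morph u0 u1).
  by apply: factor_no_square => v0 v1 lt; apply: IH.
have [[b free]|not_free] := pselect (exists b, square_free_pairs b w0 w1).
  case: b free => free; first exact: factor1.
  apply: (@monoid_up_to_negb_sym _ (bool_morph (map negb w0) (map negb w1))).
    exact: bool_morph_negb.
  apply: factor1; rewrite ?size_map //.
  - by rewrite -size_eq0 size_map size_eq0.
  - by rewrite -size_eq0 size_map size_eq0.
  - have -> : bool_morph (map negb w0) (map negb w1) = map negb \o bool_morph w0 w1.
      by apply/funext => w; exact: bool_morph_negb.
    apply: preserves_comp => //; first exact: morphism_map negbK.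
      exact: bool_morph_nonerasing.
    exact: preserves_map negbK negbK.
  - exact: etrans (square_free_pairs_negb false w0 w1) free.
have [b /and3P[/= s00 s01 s10]] := one_square_free false n0 n1 pres.
have [c /and3P[/= s11 t10 t01]] := one_square_free true n0 n1 pres.
have cb : c = ~~ b.
  have [cb|] := eqVneq c b; last by case: (c); case: (b).
  by case: not_free; exists b; rewrite /square_free_pairs s00 s01 s10 -cb s11.
have both (w : seq bool) : sorted (no_square b) w -> sorted (no_square c) w ->
    w = alternating (head false w) (size w).
  by rewrite cb; case: (b) => /= h h'; exact: sorted_alternating.
have e01 := both _ s01 t01; have e10 := both _ s10 t10.
have [m0 m1] : (0 < size w0)%N /\ (0 < size w1)%N by rewrite !lt0n !size_eq0.
have [w0E w1E] : w0 = alternating (head false w0) (size w0) /\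
    w1 = alternating (head false w1) (size w1).
  by split; apply: both; [case/cat_sorted2: s01 | case/cat_sorted2: t01 |
    case/cat_sorted2: s10 | case/cat_sorted2: t10].
set p := head false w0 in w0E; set q := head false w1 in w1E.
have headE u v : (0 < size u)%N -> head false (u ++ v) = head false u by case: u.
have qE : q = p (+) odd (size w0).
  apply: (@alternating_pair _ _ (size w0) (size w1)) => //.
  by rewrite -w0E -w1E -size_cat [RHS]e01 headE.
have pE : p = q (+) odd (size w1).
  apply: (@alternating_pair _ _ (size w1) (size w0)) => //.
  by rewrite -w0E -w1E -size_cat [RHS]e10 headE.
(* If [w0] has even length, then [q = p] and [w1] has even length too, so all products alternate and
   avoid both squares. *)
have [odd0|even0] := boolP (odd (size w0)); last first.
  have qp : q = p by rewrite qE (negbTE even0) addbF.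
  have even1 : ~~ odd (size w1) by move: pE; rewrite qp; case: odd => //; case: (p).
  case: not_free; exists true; rewrite /square_free_pairs w0E w1E qp.
  have catE m k : ~~ odd m -> alternating p m ++ alternating p k = alternating p (m + k).
    by move=> /negbTE em; rewrite alternatingD em addbF.
  by rewrite !catE // !alternating_sorted.
have {}qE : q = ~~ p by rewrite qE odd0 addbT.
have odd1 : odd (size w1) by move: pE; rewrite qE; case: odd => //; case: (p).
have [le2|gt2] := leqP (size w0 + size w1) 2.
  have [sz0 sz1] : size w0 = 1%N /\ size w1 = 1%N.
    by move: le2 m0 m1; move: (size w0) (size w1) => k0 k1; clear; lia.
  rewrite w0E w1E sz0 sz1 qE !alternatingS.
  exists id; first exact: sturmian_id.
  case: (p); [right | left];
    by elim=> [//|d w IHw]; rewrite bool_morph_cons IHw; case: d.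
exfalso; have [y yP occ] := dominant_image false n0 n1 pres.
have {}occ : occurs y (w0 ++ w0 ++ w0 ++ w1 ++ w0 ++ w0 ++ w0 ++ [::]) by [].
have occ1 : occurs y (p :: rcons w0 p).
  have [u uE] : exists u, w0 = rcons u p.
    have sz0 : size w0 = ((size w0).-1 + 1)%N by rewrite addn1 prednK.
    exists (alternating p (size w0).-1); rewrite {1}w0E {1}sz0 alternatingD alternatingS cats1.
    by move: odd0; rewrite sz0 addn1 /= => /negbTE ->; rewrite addbF.
  have [v vE] : exists v, w0 = p :: v.
    by exists (alternating (~~ p) (size w0).-1); rewrite {1}w0E -(prednK m0) alternatingS.
  apply: (@occurs_infix _ _ u _ (v ++ w1 ++ w0 ++ w0 ++ w0 ++ [::])).
  by move: occ; rewrite {1}uE {2}vE cat_rcons -cats1 /= -!catA /=.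
(* [w0 ++ w1 ++ w0] alternates throughout and has length at least [size w0 + 3], so it contains this
   word from its second letter on. *)
have occ2 : occurs y (~~ p :: rcons w0 (~~ p)).
  have E : w0 ++ w1 ++ w0 = alternating p (size w0 + (size w1 + size w0)).
    by rewrite !alternatingD odd0 odd1 !addbT negbK -qE -w0E -w1E.
  have wE : ~~ p :: rcons w0 (~~ p) = alternating (~~ p) (size w0).+2.
    rewrite alternatingS negbK -addn1 alternatingD odd0 addbT -w0E -cats1.
    by rewrite alternatingS.
  apply: (@occurs_infix _ _ [:: p] _ (alternating (~~ p (+) odd (size w0).+2)
      (size w0 + (size w1 + size w0) - (size w0).+3))).
  rewrite wE -alternatingD /= -alternatingS.
  apply: (@occurs_infix _ _ (w0 ++ w0) _ (w0 ++ w0 ++ [::])).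
  rewrite (_ : _.+1 = size w0 + (size w1 + size w0))%N; last first.
    by move: gt2 m0 m1; move: (size w0) (size w1) => k0 k1; clear; lia.
  by rewrite -E -!catA.
move: occ1 occ2; case: (p) => o1 o2; first exact: riet_balanced yP o2 o1.
exact: riet_balanced yP o1 o2.
Qed.

Lemma card2_bool (A : finType) : #|A| = 2%N ->
  exists (f : A -> bool) (g : bool -> A), cancel f g /\ cancel g f.
Proof.
move=> A2; have /card_gt1P[a [b [_ _ ab]]] : (1 < #|A|)%N by rewrite A2.
pose g (c : bool) := if c then a else b.
have g_inj : injective g by case=> [] [] //= e; move: ab; rewrite e eqxx.
have [f gK fK] : bijective g by apply: inj_card_bij => //; rewrite A2 card_bool.
by exists f, g.
Qed.

Lemma preserves_sturmian (A B : finType) (s : seq A -> seq B) :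
  #|A| = 2%N -> (1 < #|B|)%N -> morphism s -> nonerasing s ->
  preserves_riet_codings R s -> sturmian s.
Proof.
move=> A2 B1 hs sne pres.
have B2 : #|B| = 2%N.
  apply/eqP; rewrite eqn_leq B1 andbT -A2.
  by apply: (preserves_card _ B1 hs sne pres); rewrite A2.
have [f [f' [fK f'K]]] := card2_bool A2; have [g' [g [g'K gK]]] := card2_bool B2.
pose t := map g' \o (s \o map f').
have mf' := morphism_map fK; have mg' := morphism_map gK.
have sf'ne : nonerasing (s \o map f') by exact: nonerasing_comp.
have tne : nonerasing t by exact: nonerasing_comp.
have tE : t =1 bool_morph (t [:: false]) (t [:: true]).
  have ht : morphism t by do 2!apply: morphism_comp => //.
  elim=> [|b w IH]; first by rewrite (morph_nil ht).
  by rewrite (morph_cons ht) IH bool_morph_cons; case: b.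
have t_pres : preserves_riet_codings R (bool_morph (t [:: false]) (t [:: true])).
  have <- : t = bool_morph (t [:: false]) (t [:: true]) by apply/funext.
  apply: preserves_comp => //; last exact: preserves_map g'K gK.
  by apply: preserves_comp => //; exact: preserves_map f'K fK.
have [t' ht' t't] := monoid_up_to_negb_bool_morph (tne false) (tne true) t_pres.
have sE w : s w = map g (t (map f w)).
  by rewrite /t /= (mapK fK) (mapK g'K).
case: t't => t't.
  exists f, g, t'; split=> //; [by exists f' | by exists g' |].
  by move=> w; rewrite sE tE t't.
(* The exchange of letters is absorbed in the identification of the target letters. *)
exists f, (g \o negb), t'; split=> //; first by exists f'.
  by exists (negb \o g') => b /=; rewrite ?gK ?negbK ?g'K.
by move=> w; rewrite sE tE t't -map_comp.
Qed.

End BinaryMorphisms.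

Theorem theorem31 (R : realType) (A B : finType)
    (hA : (2 <= #|A|)%N) (hB : (2 <= #|B|)%N)
    (s : seq A -> seq B) (hs : morphism s) (hne : nonerasing s) :
  preserves_riet_codings R s <->
    (#|A| = 2%N /\ sturmian s) \/ ((3 <= #|A|)%N /\ bijective_coding s).
Proof.
split=> [pres|[[_ st]|[_ bij]]].
- move: hA; rewrite leq_eqVlt => /predU1P[/esym A2|A3]; [left | right]; split=> //.
    exact: preserves_sturmian pres.
  exact: preserves_bijective_coding pres.
- exact: sturmian_preserves.
- exact: preserves_bijective.
Qed.
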